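(* Let $n\ge3$ and $0\le k\le n-3$ be integers. Then: (i) For $d<\binom{n-k}2$ the degree $d$ homogeneous component of $\mathcal{I}(\mathrm{Her}(n)_{k+1})\subseteq\mathbb{R}[\mathrm{Her}(n)]$ is zero. (ii) The degree $\binom{n-k}2$ homogeneous component of $\mathcal{I}(\mathrm{Her}(n)_{k+1})$ contains an irreducible real $SU(n)$-submodule isomorphic to $V^{(n-k,1^k)}_{\mathbb{R}}$. (iii) The $k$-subdiscriminant $\mathrm{sDisc}_k\in\mathbb{R}[\mathrm{Her}(n)]$ can be written as a sum of $2\dim_{\mathbb{C}}(V^{(n-k,1^k)})$ squares of elements of $\mathbb{R}[\mathrm{Her}(n)]$.
   Context: $\mathrm{Her}(n)=\{A\in\mathbb{C}^{n\times n}\mid\bar A=A^T\}$ as a real vector space; $SU(n)$ acts on $\mathbb{R}[\mathrm{Her}(n)]$ by $(g\cdot f)(A)=f(g^{-1}Ag)$. $\mathrm{Her}(n)_{k+1}=\{A\in\mathrm{Her}(n)\mid\deg(m_A)\le n-k-1\}$ with $m_A$ the minimal polynomial, and $\mathcal{I}(\cdot)$ is the vanishing ideal. $\mathrm{sDisc}_k(A)=\sum_{1\le i_1<\dots<i_{n-k}\le n}\prod_{1\le s<t\le n-k}(\lambda_{i_s}-\lambda_{i_t})^2$ with $\lambda_i$ the eigenvalues of $A$. Characters of the diagonal torus of $SL(n,\mathbb{C})$ are identified with $\lambda\in\mathbb{Z}^{n-1}$ via $\mathrm{diag}(z_1,\dots,z_{n-1},(z_1\cdots z_{n-1})^{-1})\mapsto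 z_1^{\lambda_1}\cdots z_{n-1}^{\lambda_{n-1}}$; $V^\lambda$ is the irreducible $SL(n,\mathbb{C})$-module with highest weight $\lambda$ ($\lambda_1\ge\dots\ge\lambda_{n-1}\ge0$). $(n-k,1^k)$ denotes $(n-k,1,\dots,1,0,\dots,0)\in\mathbb{Z}^{n-1}$ with $k$ entries equal to $1$. $V^\lambda_{\mathbb{R}}$ is $V^\lambda$ regarded as a real representation of $SU(n)$ (realification). *)

(* Defs.v *)
From HB Require Import structures.
From mathcomp Require Import all_boot all_order all_algebra.
From mathcomp Require Import complex.
From mathcomp Require Import reals.
From mathcomp Require Import mpoly.

Set Implicit Arguments.
Unset Strict Implicit.
Unset Printing Implicit Defensive.

Import Order.TTheory GRing.Theory Num.Theory.
Local Open Scope ring_scope.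

Section Defs.
Variable R : realType.
Local Notation C := (R[i]).

Definition is_hermitian n (A : 'M[C]_n) : bool := map_mx conjc A == A^T.

(** Real linear coordinates on Her(n) (an R-linear isomorphism Her(n) ~ R^(n*n)):
    entry (i,j) with i <= j gives Re A_ij, entry (i,j) with i > j gives Im A_ij. *)
Definition her_coords n (A : 'M[C]_n) : 'M[R]_n :=
  \matrix_(i, j) if (i <= j)%N then complex.Re (A i j) else complex.Im (A i j).

(** R[Her(n)] is {mpoly R[n*n]} in these coordinates; evaluation at A. *)
Definition heval n (p : {mpoly R[n * n]}) (A : 'M[C]_n) : R :=
  p.@[fun t => mxvec (her_coords A) 0 t].

(** degree of the minimal polynomial (mathcomp's mxminpoly, defined for n > 0). *)
Definition minpoly_deg n : 'M[C]_n -> nat :=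
  match n return 'M[C]_n -> nat with
  | 0 => fun _ => 0%N
  | n'.+1 => fun A => (size (mxminpoly A)).-1
  end.

Definition Her_stratum n k (A : 'M[C]_n) : Prop :=
  is_hermitian A /\ (minpoly_deg A <= n - k - 1)%N.

Definition in_vanishing_ideal n (S : 'M[C]_n -> Prop) (p : {mpoly R[n * n]}) : Prop :=
  forall A, S A -> heval p A = 0.

Definition SU n (g : 'M[C]_n) : bool :=
  (g *m (map_mx conjc g)^T == 1%:M) && (\det g == 1).
Definition SL n (g : 'M[C]_n) : bool := \det g == 1.

Definition su_act n (g : 'M[C]_n) (f f' : {mpoly R[n * n]}) : Prop :=
  forall A, is_hermitian A -> heval f' A = heval f (invmx g *m A *m g).

Definition rational_rep n m (rho : 'M[C]_n -> 'M[C]_m) : Prop :=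
  [/\ rho 1%:M = 1%:M,
      (forall g h, SL g -> SL h -> rho (g *m h) = rho g *m rho h)
    & exists P : 'M[{mpoly C[n * n]}]_m,
        forall g, SL g -> rho g = map_mx (fun p => p.@[fun t => mxvec g 0 t]) P].

Definition csubspace m (W : 'cV[C]_m -> Prop) : Prop :=
  [/\ W 0, (forall u v, W u -> W v -> W (u + v)) & (forall (a : C) u, W u -> W (a *: u))].

Definition irreducible_rep n m (rho : 'M[C]_n -> 'M[C]_m) : Prop :=
  (0 < m)%N /\
  forall W : 'cV[C]_m -> Prop, csubspace W ->
    (forall g v, SL g -> W v -> W (rho g *m v)) ->
    (forall v, W v -> v = 0) \/ (forall v, W v).

(** Characters of the diagonal torus identified with Z^(n-1):
    diag(z_1,..,z_n) |-> z_1^lam_0 ... z_(n-1)^lam_(n-2) (lam with nonnegative entries).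
    rho has highest weight lam: there is a nonzero vector which is an eigenvector
    of the upper-triangular Borel subgroup of SL(n,C) with character lam. *)
Definition torus_char n (lam : nat -> nat) (b : 'M[C]_n) : C :=
  \prod_(i < n | (i < n.-1)%N) b i i ^+ lam i.

Definition upper_triangular n (b : 'M[C]_n) : bool :=
  [forall i : 'I_n, [forall j : 'I_n, (j < i)%N ==> (b i j == 0)]].

Definition has_highest_weight n m (rho : 'M[C]_n -> 'M[C]_m) (lam : nat -> nat) : Prop :=
  exists v : 'cV[C]_m, v != 0 /\
    forall b, SL b -> upper_triangular b -> rho b *m v = torus_char lam b *: v.

Definition is_V n m (rho : 'M[C]_n -> 'M[C]_m) (lam : nat -> nat) : Prop :=
  [/\ rational_rep rho, irreducible_rep rho & has_highest_weight rho lam].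

Definition hook_weight n k : nat -> nat :=
  fun i => if i == 0%N then (n - k)%N else if (i <= k)%N then 1%N else 0%N.

Definition rsubspace n (W : {mpoly R[n * n]} -> Prop) : Prop :=
  [/\ W 0, (forall u v, W u -> W v -> W (u + v)) & (forall (a : R) u, W u -> W (a *: u))].

Definition su_stable n (W : {mpoly R[n * n]} -> Prop) : Prop :=
  forall f g, W f -> SU g -> exists f', W f' /\ su_act g f f'.

Definition sdisc_val n k (ev : 'I_n -> R) : R :=
  \sum_(S : {set 'I_n} | #|S| == (n - k)%N)
     \prod_(s in S) \prod_(t in S | (s < t)%N) (ev s - ev t) ^+ 2.

End Defs.

(* Main.v *)
Require Import Defs.
From HB Require Import structures.
From mathcomp Require Import all_boot all_order all_algebra.
From mathcomp Require Import perm fingroup complex.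
From mathcomp Require Import reals.
From mathcomp Require Import mpoly.
From mathcomp Require Import spectral sesquilinear.
From mathcomp Require boolp.
From mathcomp Require Import zify ring.
Set Implicit Arguments.
Unset Strict Implicit.
Unset Printing Implicit Defensive.
Import Order.TTheory GRing.Theory Num.Theory.
Local Open Scope ring_scope.

(** Write [r = n - k]. In [(End C^n)^(x r)], antisymmetrise [1 (x) A (x) ... (x) A^(r-1)]
    over the input indices and symmetrise it over the output indices. The resulting
    covariant of [A] vanishes when the powers of [A] below the [r]-th are dependent.
    For Hermitian [A] it lies in the irreducible submodule generated by the highest weight
    vector built from [1, E_(0,k+1), ..., E_(0,n-1)]: diagonalise [A], and recover the
    diagonal case as the torus-invariant part of a vector in the orbit of rank one tensors.
    For diagonal [A] its squared norm is a sum of squared Vandermonde determinants, that is,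
    a multiple of [sDisc_k]; expanding it in an orthonormal basis gives (iii), and its real
    and imaginary coordinates give the copy of the realification in (ii), which is
    irreducible because the hook weight is not self-dual.
    For (i), a form of degree [d < C(r,2)] vanishing on spectra with at most [N >= r - 1]
    distinct values vanishes on those with [N + 1]: a generic line in the space of
    eigenvalues meets the [C(N+1,2)] hyperplanes [x_a = x_b] at distinct points. *)

(** From the hook model on, matrices have size [n.+1] and there are [r.+1] tensor factors with
    [r + k = n], so the [r] of the overview is [r.+1] there. One tool replaces Lie algebras and
    topology: a linear subspace that contains infinitely many values of a polynomial curve contains
    all its values and coefficients. It gives the passage from the big cell to SL, from SU to SL, to
    singular limits, and to weight components. Membership of the powers of [A] in the irreducible
    module is the crux: (iii) allows only [2 m] squares, so coordinates in the whole tensor space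
    would be too many. The difficulty is that the tensor of a diagonal [A] is fixed by the diagonal
    torus, whereas the orbit of the highest weight vector yields families of rank one matrices; a
    weight projection has to link the two. Since (ii) and (iii) concern every model of the hook
    module, highest weight uniqueness is proved as well and carries the tensor model over to the
    given one. *)

Section ComplexSubspaces.
Variable R : realType.
Local Notation C := R[i].

Lemma csubspace_sum m (W : 'cV[C]_m -> Prop) (I : Type) (s : seq I) (P : pred I)
    (F : I -> 'cV[C]_m) :
  csubspace W -> (forall i, P i -> W (F i)) -> W (\sum_(i <- s | P i) F i).
Proof. by case=> W0 WD _ WF; apply: (big_ind W). Qed.

Lemma csubspace_add m (W : 'cV[C]_m -> Prop) u v :
  csubspace W -> W u -> W v -> W (u + v).
Proof. by case=> _ WD _; exact: WD. Qed.

Lemma csubspace_scale m (W : 'cV[C]_m -> Prop) a u :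
  csubspace W -> W u -> W (a *: u).
Proof. by case=> _ _; apply. Qed.

Lemma csubspace_sub m (W : 'cV[C]_m -> Prop) u v :
  csubspace W -> W u -> W v -> W (u - v).
Proof.
by move=> cW Wu Wv; apply: csubspace_add => //; rewrite -scaleN1r; exact: csubspace_scale.
Qed.

(** * Polynomial curves and linear subspaces *)

Definition pcol_eval m (z : C) (q : 'cV[{poly C}]_m) : 'cV[C]_m := map_mx (horner_eval z) q.
Definition pcol_coef m (i : nat) (q : 'cV[{poly C}]_m) : 'cV[C]_m := map_mx (coefp i) q.

Lemma pcol_eval_coef m (q : 'cV[{poly C}]_m) D z :
  (forall i, (size (q i 0%R) <= D)%N) ->
  pcol_eval z q = \sum_(i < D) z ^+ i *: pcol_coef i q.
Proof.
move=> sq; apply/colP => j; rewrite summxE !mxE /horner_eval (horner_coef_wide _ (sq j)).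
by apply: eq_bigr => i _; rewrite !mxE mulrC.
Qed.

(** Finite lists of distinct points of any length are the form that both a Vandermonde inversion and
    a root count consume. *)
Definition infinitely_many (Q : C -> Prop) :=
  forall d : nat, exists s : seq C, [/\ uniq s, size s = d & forall z, z \in s -> Q z].

(** Inverting a Vandermonde matrix at enough distinct nodes writes each coefficient of the curve as
    a linear combination of values that lie in [W]. *)
Lemma csubspace_pcol_coef m (W : 'cV[C]_m -> Prop) (q : 'cV[{poly C}]_m) :
  csubspace W -> infinitely_many (fun z => W (pcol_eval z q)) ->
  forall i, W (pcol_coef i q).
Proof.
move=> cW infW i.
(* The bound also exceeds [i], so that [i] is a legal row index even when this coefficient is beyond
   all degrees. *)
pose D := maxn i.+1 (\max_j size (q j 0%R)).
have sq j : (size (q j 0%R) <= D)%N.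
  by rewrite leq_max (leq_bigmax (F := fun j => size (q j 0%R))) orbT.
have iD : (i < D)%N by rewrite leq_max leqnn.
have [s [us ss sW]] := infW D.
pose a : 'rV[C]_D := \row_j s`_j.
pose V := Vandermonde D a.
have Vu : V \in unitmx.
  rewrite unitmxE det_Vandermonde unitfE.
  apply/prodf_neq0 => x _; apply/prodf_neq0 => y xy; rewrite !mxE subr_eq0.
  by rewrite nth_uniq ?ss // gtn_eqF.
have -> : pcol_coef i q = \sum_(j < D) (invmx V) j (Ordinal iD) *: pcol_eval s`_j q.
  under eq_bigr => j _ do rewrite (pcol_eval_coef _ sq) scaler_sumr.
  rewrite exchange_big /=.
  under eq_bigr => l _ do under eq_bigr => j _ do rewrite scalerA mulrC.
  under eq_bigr => l _ do rewrite -scaler_suml.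
  have E (l : 'I_D) : \sum_(j < D) s`_j ^+ l * invmx V j (Ordinal iD) = (l == Ordinal iD)%:R.
    have := congr1 (fun M : 'M_D => M l (Ordinal iD)) (mulmxV Vu); rewrite !mxE => <-.
    by apply: eq_bigr => j _; rewrite !mxE.
  under eq_bigr => l _ do rewrite E.
  rewrite (bigD1 (Ordinal iD)) //= eqxx scale1r big1 ?addr0 // => l /negPf nl.
  by rewrite nl scale0r.
apply: csubspace_sum => // j _; apply: csubspace_scale => //; apply: sW.
by rewrite mem_nth ?ss.
Qed.

Lemma csubspace_pcol_eval m (W : 'cV[C]_m -> Prop) (q : 'cV[{poly C}]_m) :
  csubspace W -> infinitely_many (fun z => W (pcol_eval z q)) ->
  forall z, W (pcol_eval z q).
Proof.
move=> cW infW z.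
rewrite (@pcol_eval_coef _ _ (\max_j size (q j 0%R))); last first.
  by move=> i; rewrite (leq_bigmax (F := fun j => size (q j 0%R))).
apply: csubspace_sum => // i _; apply: csubspace_scale => //.
exact: csubspace_pcol_coef.
Qed.

Lemma infinitely_many_inj (f : nat -> C) (Q : C -> Prop) :
  injective f -> (forall i, Q (f i)) -> infinitely_many Q.
Proof.
move=> fI Qf d; exists [seq f i | i <- iota 0 d].
by split; [rewrite map_inj_uniq ?iota_uniq | rewrite size_map size_iota |
  move=> z /mapP[i _ ->]].
Qed.

Lemma natrC_inj : injective (fun i : nat => i%:R : C).
Proof. by move=> i j /eqP; rewrite eqr_nat => /eqP. Qed.

Lemma infinitely_many_nonroot (p : {poly C}) (Q : C -> Prop) :
  p != 0 -> (forall z, p.[z] != 0 -> Q z) -> infinitely_many Q.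
Proof.
move=> p0 pQ d.
pose s : seq C := [seq i%:R | i <- iota 0 (d + size p)].
have us : uniq s by rewrite map_inj_uniq ?iota_uniq //; exact: natrC_inj.
have ss : size s = (d + size p)%N by rewrite size_map size_iota.
have sf : (d <= size [seq z <- s | ~~ root p z])%N.
  have := count_predC (root p) s; rewrite ss -!size_filter => e.
  have lt : (size (filter (root p) s) <= size p)%N.
    by apply/ltnW/max_poly_roots => //; [exact: filter_all | exact: filter_uniq].
  by rewrite -(leq_add2r (size p)) -e addnC leq_add2l.
exists (take d [seq z <- s | ~~ root p z]); split.
- exact/take_uniq/filter_uniq.
- by rewrite size_take; case: ltngtP sf => // ->.
- by move=> z /mem_take; rewrite mem_filter => /andP[nz _]; exact: pQ.
Qed.

Lemma poly_eq0_inf (p : {poly C}) : infinitely_many (fun z => p.[z] = 0) -> p = 0.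
Proof.
move=> /(_ (size p)) [s [us ss sp]]; apply/eqP/negPn/negP => p0.
have /(max_poly_roots p0) : all (root p) s by apply/allP => z /sp /eqP.
by move=> /(_ us); rewrite ss ltnn.
Qed.

End ComplexSubspaces.

(** * Density of the big cell in SL(n) *)

Section SpecialLinear.
Variable R : realType.
Local Notation C := R[i].

Lemma SL_unit n (g : 'M[C]_n) : SL g -> g \in unitmx.
Proof. by rewrite /SL unitmxE => /eqP->; rewrite unitr1. Qed.

Lemma SL1 n : SL (1%:M : 'M[C]_n).
Proof. by rewrite /SL det1. Qed.

Lemma SLM n (g h : 'M[C]_n) : SL g -> SL h -> SL (g *m h).
Proof. by rewrite /SL det_mulmx => /eqP-> /eqP->; rewrite mulr1. Qed.

Lemma SLV n (g : 'M[C]_n) : SL g -> SL (invmx g).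
Proof. by rewrite /SL det_inv => /eqP->; rewrite invr1. Qed.

Lemma rational_repV n m (rho : 'M[C]_n -> 'M[C]_m) g (v : 'cV_m) :
  rational_rep rho -> SL g -> rho (invmx g) *m (rho g *m v) = v.
Proof.
by case=> r1 rM _ Sg; rewrite mulmxA -rM ?SLV // mulVmx ?SL_unit // r1 mul1mx.
Qed.

Definition peval n (z : C) (A : 'M[{poly C}]_n) : 'M[C]_n := map_mx (horner_eval z) A.

Lemma peval_mul n z (A B : 'M[{poly C}]_n) : peval z (A *m B) = peval z A *m peval z B.
Proof. exact: map_mxM. Qed.

Lemma peval_det n z (A : 'M[{poly C}]_n) : \det (peval z A) = (\det A).[z].
Proof. exact: det_map_mx. Qed.

(** Clearing denominators: a monomial of degree at most [K] evaluated at [a / e] becomes polynomial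
    after multiplication by [e ^+ K]. *)
Lemma mpoly_rational_subst N (P : {mpoly C[N]}) (a : 'I_N -> {poly C}) (e : {poly C}) K :
  (msize P <= K)%N ->
  exists q : {poly C}, forall z, e.[z] != 0 ->
    q.[z] = e.[z] ^+ K * P.@[fun t => e.[z]^-1 * (a t).[z]].
Proof.
move=> sP; exists (\sum_(m <- msupp P) P@_m *: (e ^+ (K - mdeg m) * \prod_i a i ^+ m i)).
move=> z ez; rewrite mevalE horner_sum big_distrr; apply: eq_big_seq => m mP /=.
rewrite hornerZ hornerM horner_prod [RHS]mulrCA; congr (_ * _).
under eq_bigr => i _ do rewrite horner_exp.
have -> : \prod_i (e.[z]^-1 * (a i).[z]) ^+ m i =
    \prod_i (e.[z]^-1 ^+ m i * (a i).[z] ^+ m i).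
  by apply: eq_bigr => i _; rewrite exprMn.
rewrite big_split /= mulrA; congr (_ * _).
rewrite prodrXr -mdegE exprVn horner_exp.
have mK : (mdeg m <= K)%N by rewrite (leq_trans _ sP) // ltnW // msize_mdeg_lt.
by rewrite -{2}(subnK mK) exprD mulfK // expf_neq0.
Qed.

(** [rho] is polynomial only on SL, and normalising a determinant to 1 forces rational entries. With
    a common denominator [e] the orbit curve is polynomial up to a power of [e], which a subspace
    does not notice. *)
Lemma rational_rep_path n m (rho : 'M[C]_n -> 'M[C]_m) (G : 'M[{poly C}]_n)
    (e : {poly C}) (v : 'cV[C]_m) :
  rational_rep rho ->
  (forall z, e.[z] != 0 -> SL (e.[z]^-1 *: peval z G)) ->
  exists K (q : 'cV[{poly C}]_m), forall z, e.[z] != 0 ->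
    pcol_eval z q = e.[z] ^+ K *: (rho (e.[z]^-1 *: peval z G) *m v).
Proof.
case=> _ _ [P rhoP] SLG.
pose K := \max_i \max_j msize (P i j).
have sP i j : (msize (P i j) <= K)%N.
  apply: leq_trans (leq_bigmax (F := fun i => \max_j msize (P i j)) i).
  exact: (leq_bigmax (F := fun j => msize (P i j)) j).
have /fin_all_exists [Q HQ] i : exists Qi : 'I_m -> {poly C}, forall j z, e.[z] != 0 ->
    (Qi j).[z] = e.[z] ^+ K * (P i j).@[fun t => e.[z]^-1 * (mxvec G 0 t).[z]].
  have /fin_all_exists [Qi HQi] j := mpoly_rational_subst (mxvec G 0) e (sP i j).
  by exists Qi.
exists K, (\col_i \sum_j Q i j * (v j 0)%:P) => z ez.
rewrite rhoP ?SLG //; apply/colP => i; rewrite !mxE /horner_eval horner_sum big_distrr.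
apply: eq_bigr => j _; rewrite hornerM hornerC (HQ i j z ez) [RHS]mulrA; congr (_ * _).
rewrite mxE; congr (_ * _).
by apply: meval_eq => t; case/mxvec_indexP: t => x y; rewrite !mxvecE !mxE.
Qed.

Lemma csubspace_path n m (rho : 'M[C]_n -> 'M[C]_m) (G : 'M[{poly C}]_n)
    (e : {poly C}) (v : 'cV[C]_m) (W : 'cV[C]_m -> Prop) :
  rational_rep rho -> csubspace W ->
  (forall z, e.[z] != 0 -> SL (e.[z]^-1 *: peval z G)) ->
  infinitely_many (fun z => e.[z] != 0 /\ W (rho (e.[z]^-1 *: peval z G) *m v)) ->
  forall z, e.[z] != 0 -> W (rho (e.[z]^-1 *: peval z G) *m v).
Proof.
move=> rr cW SLG infW z ez.
have [K [q qE]] := rational_rep_path v rr SLG.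
have -> : rho (e.[z]^-1 *: peval z G) *m v = (e.[z] ^+ K)^-1 *: pcol_eval z q.
  by rewrite qE // scalerA mulVf ?scale1r // expf_neq0.
apply: csubspace_scale => //; apply: csubspace_pcol_eval => // d.
have [s [us ss sW]] := infW d; exists s; split=> // t /sW [et Wt].
by rewrite qE //; exact: csubspace_scale.
Qed.

Definition unitriangular n (l : 'M[C]_n) :=
  (forall i j : 'I_n, (i < j)%N -> l i j = 0) /\ (forall i, l i i = 1).

Lemma upper_triangularP {n} {b : 'M[C]_n} :
  reflect (forall i j : 'I_n, (j < i)%N -> b i j = 0) (upper_triangular b).
Proof.
apply: (iffP forallP) => [h i j ji|h i].
  by have /forallP/(_ j)/implyP/(_ ji)/eqP := h i.
by apply/forallP => j; apply/implyP => /h ->.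
Qed.

Lemma det_unitriangular n (l : 'M[C]_n) : unitriangular l -> \det l = 1.
Proof.
case=> l0 l1; rewrite det_trig; last by apply/is_trig_mxP.
by rewrite big1 // => i _; exact: l1.
Qed.

(** Gaussian elimination over polynomials. Each pivot takes the value 1 at 0, so it is a nonzero
    polynomial, and [q] is the product of the pivots. *)
Lemma LU_generic n (A : 'M[{poly C}]_n) : peval 0 A = 1%:M ->
  exists2 q : {poly C}, q != 0 & forall z, q.[z] != 0 ->
    exists l u, [/\ unitriangular l, upper_triangular u & peval z A = l *m u].
Proof.
elim: n A => [|n IHn] A A0.
  exists 1; first exact: oner_neq0.
  move=> z _; exists 1%:M, 1%:M; split; try by [split=> [[]|[]]|apply/upper_triangularP=> [[]]].
  by apply/matrixP => [[]].
move: A A0; rewrite -[n.+1]/(1 + n)%N => A A0.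
pose a := ulsubmx A 0 0; pose b := ursubmx A; pose c := dlsubmx A; pose d := drsubmx A.
have EA z : peval z A = block_mx (a.[z])%:M (map_mx (horner_eval z) b)
     (map_mx (horner_eval z) c) (peval z d) :> 'M_(1 + n).
  transitivity (map_mx (horner_eval z) (block_mx (ulsubmx A) b c d)); first by rewrite submxK.
  rewrite map_block_mx; congr block_mx.
  by rewrite [ulsubmx _]mx11_scalar map_scalar_mx.
(* The Schur complement times the pivot, which keeps the entries polynomial. *)
pose S := a *: d - c *m b.
have ES z : peval z S = a.[z] *: peval z d - map_mx (horner_eval z) c *m map_mx (horner_eval z) b.
  by rewrite /peval /S map_mxB map_mxM map_mxZ.
have := EA 0; rewrite A0 (@scalar_mx_block _ 1 n 1) => /eq_block_mx [a0 b0 c0 d0].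
have a01 : a.[0] = 1 by move/(congr1 (fun M : 'M_1 => M 0 0)): a0; rewrite !mxE /= !mulr1n.
have [|q q0 Hq] := IHn S.
  by rewrite ES -c0 -b0 -d0 mul0mx subr0 a01 scale1r.
exists (a * q).
  by rewrite mulf_neq0 //; apply: contraTneq (oner_neq0 C) => E; rewrite -a01 E horner0 eqxx.
move=> z; rewrite hornerM mulf_eq0 negb_or => /andP[az /Hq [l [u [[l0 l1] uu Slu]]]].
exists (block_mx 1%:M 0 ((a.[z])^-1 *: map_mx (horner_eval z) c) l : 'M_(1 + n)).
exists (block_mx (a.[z])%:M (map_mx (horner_eval z) b) 0 ((a.[z])^-1 *: u) : 'M_(1 + n)).
split.
- split=> [i j|i]; last first.
    by case: (split_ordP i) => i' ->; rewrite ?block_mxEul ?block_mxEdr ?l1 // !mxE eqxx.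
  case: (split_ordP i) => i' ->; case: (split_ordP j) => j' ->;
    rewrite ?block_mxEul ?block_mxEur ?block_mxEdl ?block_mxEdr ?mxE //=.
  + by rewrite !ord1.
  + by rewrite !ord1.
  + by rewrite ltn_add2l; exact: l0.
- apply/upper_triangularP => i j.
  case: (split_ordP i) => i' ->; case: (split_ordP j) => j' ->;
    rewrite ?block_mxEul ?block_mxEur ?block_mxEdl ?block_mxEdr ?mxE //=.
  + by rewrite !ord1.
  + by move=> h; have := ltn_ord i'; lia.
  + by rewrite ltn_add2l => /(upper_triangularP uu) ->; rewrite mulr0.
- rewrite EA mulmx_block !mul1mx !mul0mx mulmx0 !addr0; congr block_mx.
    by rewrite -scalemxAl mul_mx_scalar scalerA mulVf // scale1r.
  rewrite -scalemxAl -scalemxAr -scalerDr -Slu ES addrC subrK scalerA mulVf //.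
  by rewrite scale1r.
Qed.

(** On the segment from the identity to [g], with determinants normalised, almost every point
    factors as lower times upper; membership in [W] then spreads to the endpoint [g]. *)
Lemma big_cell_dense n m (rho : 'M[C]_n -> 'M[C]_m) (v : 'cV[C]_m) (W : 'cV[C]_m -> Prop) :
  rational_rep rho -> csubspace W ->
  (forall l u, unitriangular l -> upper_triangular u -> SL l -> SL u ->
     W (rho (l *m u) *m v)) ->
  forall g, SL g -> W (rho g *m v).
Proof.
case: n rho => [|n] rho rr cW lu g Sg.
  rewrite -[g]mulmx1; apply: lu => //; rewrite ?SL1 //; first by split=> [[]|[]].
  by apply/upper_triangularP => [[]].
pose G : 'M[{poly C}]_n.+1 := (1 - 'X)%:M + 'X *: map_mx polyC g.
have GE z : peval z G = (1 - z)%:M + z *: g.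
  rewrite /peval /G map_mxD map_scalar_mx map_mxZ /= /horner_eval !hornerE.
  by rewrite -map_mx_comp map_mx_id // => x /=; rewrite /horner_eval hornerC.
pose e := \det G.
have e0 : e.[0] = 1 by rewrite -peval_det GE subr0 scale0r addr0 det1.
have e1 : e.[1] = 1 by rewrite -peval_det GE subrr scale1r -scalemx1 scale0r add0r; apply/eqP.
pose D z : 'M[C]_n.+1 := diag_mx (\row_i if i == 0 then (e.[z])^-1 else 1).
(* Only row 0 has to be divided by the determinant [e]; multiplying the other rows by [e] makes it a
   common denominator. *)
pose N : 'M[{poly C}]_n.+1 := diag_mx (\row_i if i == 0 then 1 else e) *m G.
have NE z : e.[z] != 0 -> e.[z]^-1 *: peval z N = D z *m peval z G.
  move=> ez; rewrite peval_mul scalemxAl; congr (_ *m _).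
  apply/matrixP => i j; rewrite !mxE /horner_eval hornerMn mulrnAr; congr (_ *+ _).
  by case: eqP => _; rewrite ?hornerE ?mulr1 ?mulVf.
have detD z : \det (D z) = (e.[z])^-1.
  rewrite det_diag (bigD1 0) //= !mxE eqxx big1 ?mulr1 // => i /negPf i0.
  by rewrite mxE i0.
have SN z : e.[z] != 0 -> SL (e.[z]^-1 *: peval z N).
  by move=> ez; rewrite NE // /SL det_mulmx detD peval_det mulVf.
have gE : g = e.[1]^-1 *: peval 1 N.
  rewrite NE ?e1 ?oner_neq0 // GE subrr scale1r -scalemx1 scale0r add0r.
  suff -> : D 1 = 1%:M by rewrite mul1mx.
  apply/matrixP => i j; rewrite !mxE e1 invr1; by case: (i == 0).
rewrite gE; apply: (csubspace_path rr cW SN); last by rewrite e1 oner_neq0.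
have [|q q0 Hq] := @LU_generic _ G; first by rewrite GE subr0 scale0r addr0.
apply: (@infinitely_many_nonroot _ (q * e)).
  by rewrite mulf_neq0 //; apply: contraTneq (oner_neq0 C) => E; rewrite -e0 E horner0 eqxx.
move=> z; rewrite hornerM mulf_eq0 negb_or => /andP[qz ez]; split=> //.
have [l [u [ll uu Glu]]] := Hq z qz.
have uD : D z \in unitmx by rewrite unitmxE detD unitfE invr_eq0.
have DE i j : D z i j = (if i == 0 then (e.[z])^-1 else 1) *+ (i == j) by rewrite !mxE.
have DVE : invmx (D z) = diag_mx (\row_i if i == 0 then e.[z] else 1).
  apply: (can_inj (mulKmx uD)); rewrite mulmxV //.
  rewrite mul_diag_mx; apply/matrixP => i j; rewrite !mxE.
  by case: (i == 0); case: (i == j); rewrite ?mulr1n ?mulr0n ?mulr0 ?mulVf ?mulr1.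
(* The determinant correction moves to the upper factor: [D l u] is [(D l D^-1) (D u)], and
   conjugation by a diagonal matrix preserves unitriangularity. *)
pose l' := D z *m l *m invmx (D z).
have ll' : unitriangular l'.
  case: ll => l0 l1; rewrite /l' DVE mul_diag_mx mul_mx_diag.
  split=> [i j ij|i]; rewrite !mxE; first by rewrite l0 // mulr0 mul0r.
  by rewrite l1; case: (i == 0); rewrite !mulr1 // mulVf.
have Sl' : SL l' by rewrite /SL det_unitriangular.
have E : e.[z]^-1 *: peval z N = l' *m (D z *m u).
  by rewrite NE // Glu /l' -!mulmxA; congr (_ *m (_ *m _)); rewrite mulKmx.
rewrite E; apply: lu => //.
  apply/upper_triangularP => i j ij; rewrite mul_diag_mx !mxE.
  by rewrite (upper_triangularP uu) // mulr0.
have : \det l' * \det (D z *m u) = 1 by rewrite -det_mulmx -E; apply/eqP/SN.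
by rewrite det_unitriangular // mul1r /SL => ->.
Qed.

End SpecialLinear.

(** * Orthogonality and highest weights *)

Section Adjoint.
Variable R : realType.
Local Notation C := R[i].

Definition ctr m n (A : 'M[C]_(m, n)) : 'M[C]_(n, m) := (map_mx (@conjc R) A)^T.

Lemma conjcE (x : C) : conjc x = Num.conj x.
Proof. by []. Qed.

Lemma ctrE m n (A : 'M[C]_(m, n)) i j : ctr A i j = conjc (A j i).
Proof. by rewrite !mxE. Qed.

Lemma ctrM m n p (A : 'M[C]_(m, n)) (B : 'M_(n, p)) : ctr (A *m B) = ctr B *m ctr A.
Proof. by rewrite /ctr map_mxM trmx_mul. Qed.

Lemma ctrK m n (A : 'M[C]_(m, n)) : ctr (ctr A) = A.
Proof. by apply/matrixP => i j; rewrite !ctrE conjcK. Qed.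

Lemma ctrZ m n a (A : 'M[C]_(m, n)) : ctr (a *: A) = conjc a *: ctr A.
Proof. by rewrite /ctr map_mxZ linearZ. Qed.

Lemma ctr1 n : ctr (1%:M : 'M[C]_n) = 1%:M.
Proof. by rewrite /ctr map_mx1 trmx1. Qed.

Lemma det_ctr n (A : 'M[C]_n) : \det (ctr A) = conjc (\det A).
Proof. by rewrite det_tr det_map_mx. Qed.

Lemma ctr_sqr m (u : 'cV[C]_m) : (ctr u *m u) 0 0 = \sum_i `|u i 0| ^+ 2.
Proof. by rewrite mxE; apply: eq_bigr => i _; rewrite ctrE normCK conjcE mulrC. Qed.

Lemma ctr_sqr_eq0 m (u : 'cV[C]_m) : (ctr u *m u) 0 0 = 0 -> u = 0.
Proof.
rewrite ctr_sqr => /eqP; rewrite psumr_eq0 => [/allP h|i _]; last exact: exprn_ge0.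
by apply/colP => i; rewrite mxE; have := h i (mem_index_enum i); rewrite sqrf_eq0 normr_eq0 => /eqP.
Qed.

Lemma orthonormal_extend m (W : 'cV[C]_m -> Prop) r (B : 'M[C]_(m, r)) w :
  csubspace W -> ctr B *m B = 1%:M -> (forall x, W (B *m x)) ->
  W w -> B *m (ctr B *m w) <> w ->
  exists B' : 'M[C]_(m, r + 1), ctr B' *m B' = 1%:M /\ forall x, W (B' *m x).
Proof.
move=> cW BB WB Ww nw.
pose u := w - B *m (ctr B *m w).
have u0 : u <> 0 by move/eqP; rewrite subr_eq0 eq_sym => /eqP.
have Bu : ctr B *m u = 0 by rewrite mulmxBr [ctr B *m (B *m _)]mulmxA BB mul1mx subrr.
have Wu : W u by apply: csubspace_sub.
have uB : ctr u *m B = 0.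
  by rewrite -[ctr u *m B]ctrK ctrM ctrK Bu /ctr map_mx0 trmx0.
pose s := (ctr u *m u) 0 0.
have s0 : s != 0 by apply/eqP => /ctr_sqr_eq0.
have sp : 0 <= s by rewrite /s ctr_sqr; apply: sumr_ge0 => i _; exact: exprn_ge0.
pose a := (sqrtC s)^-1.
have aa : conjc a = a by apply: conj_Creal; apply: ger0_real; rewrite invr_ge0 sqrtC_ge0.
exists (row_mx B (a *: u)); split.
  rewrite {1}/ctr map_row_mx tr_row_mx -!/(ctr _) mul_col_row BB ctrZ aa.
  rewrite -!scalemxAr -!scalemxAl Bu uB !scaler0.
  rewrite [ctr u *m u]mx11_scalar -/s. rewrite !scale_scalar_mx mulrA.
  by rewrite -expr2 exprVn sqrtCK mulVf // -scalar_mx_block.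
move=> x; rewrite -[x]vsubmxK mul_row_col; apply: csubspace_add => //.
rewrite -scalemxAl [dsubmx x]mx11_scalar mul_mx_scalar.
by do 2!apply: csubspace_scale => //.
Qed.

(** A subspace is a mere predicate, so a basis is grown by Gram-Schmidt until the projection fixes
    every vector of [W]. The rank bounds the number of columns by [m], hence the fuel [d]. *)
Lemma csubspace_orthobasis m (W : 'cV[C]_m -> Prop) : csubspace W ->
  exists r (B : 'M[C]_(m, r)), ctr B *m B = 1%:M /\
    forall w, W w <-> B *m (ctr B *m w) = w.
Proof.
move=> cW.
suff H d r (B : 'M[C]_(m, r)) : (m < r + d)%N -> ctr B *m B = 1%:M ->
    (forall x, W (B *m x)) ->
    exists r (B : 'M[C]_(m, r)), ctr B *m B = 1%:M /\
      forall w, W w <-> B *m (ctr B *m w) = w.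
  apply: (H m.+1 0%N 0); rewrite ?add0n //; first by apply/matrixP => [[]].
  by move=> x; rewrite mul0mx; case: cW.
elim: d r B => [|d IHd] r B dr BB WB.
  have : (r <= m)%N.
    by rewrite -(mxrank1 C r) -BB (leq_trans (mxrankM_maxr _ _)) // rank_leq_row.
  by rewrite leqNgt -[r]addn0 dr.
have [[w [Ww nw]]|no] := boolp.EM (exists w, W w /\ B *m (ctr B *m w) <> w).
  have [B' [B'B' WB']] := orthonormal_extend cW BB WB Ww nw.
  by apply: (IHd _ B') => //; rewrite addn1 addSnnS.
exists r, B; split=> // w; split=> [Ww|<-//]; apply: boolp.contrapT => nw.
by apply: no; exists w.
Qed.

End Adjoint.

(** * Highest weight vectors and weight bounds on their orbit spans *)

Section HighestWeight.
Variable R : realType.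
Local Notation C := R[i].

Definition highest_vector n m (rho : 'M[C]_n -> 'M[C]_m) (lam : nat -> nat) (v : 'cV[C]_m) :=
  forall b, SL b -> upper_triangular b -> rho b *m v = torus_char lam b *: v.

(** As an intersection of all subspaces that contain the orbit, it comes with its induction
    principle: apply it to the property to be proved. *)
Definition orbit_span n m (rho : 'M[C]_n -> 'M[C]_m) (v w : 'cV[C]_m) :=
  forall W, csubspace W -> (forall g, SL g -> W (rho g *m v)) -> W w.

Lemma orbit_span_csubspace n m (rho : 'M[C]_n -> 'M[C]_m) v : csubspace (orbit_span rho v).
Proof.
split=> [W [] //|w1 w2 h1 h2 W cW Wg|a w h W cW Wg].
  by apply: csubspace_add => //; [exact: h1 | exact: h2].
by apply: csubspace_scale => //; exact: h.
Qed.

Lemma orbit_span_stable n m (rho : 'M[C]_n -> 'M[C]_m) v g w :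
  rational_rep rho -> SL g -> orbit_span rho v w -> orbit_span rho v (rho g *m w).
Proof.
move=> [_ rM _] Sg h W cW Wg; apply: (h (fun w => W (rho g *m w))).
  split=> [|w1 w2|a w1]; first by rewrite mulmx0; case: cW.
    by rewrite mulmxDr; exact: csubspace_add.
  by rewrite -scalemxAr; exact: csubspace_scale.
by move=> h' Sh; rewrite mulmxA -rM //; apply: Wg; exact: SLM.
Qed.

Lemma orbit_span_self n m (rho : 'M[C]_n -> 'M[C]_m) v :
  rational_rep rho -> orbit_span rho v v.
Proof. by case=> r1 _ _ W _ /(_ 1%:M (SL1 _ _)); rewrite r1 mul1mx. Qed.

Lemma irreducible_orbit_span n m (rho : 'M[C]_n -> 'M[C]_m) (v w : 'cV[C]_m) :
  rational_rep rho -> irreducible_rep rho -> v != 0 -> orbit_span rho v w.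
Proof.
move=> rr [_ irr] v0.
have [g u Sg|h|//] := irr _ (orbit_span_csubspace rho v).
  exact: orbit_span_stable.
by have /eqP := h v (@orbit_span_self _ _ _ v rr); rewrite (negPf v0).
Qed.

Definition one_param n (c : 'I_n -> int) (s : C) : 'M[C]_n := diag_mx (\row_i s ^ c i).

Definition weight_pairing n (lam : nat -> nat) (c : 'I_n -> int) : int :=
  \sum_(i < n | (i < n.-1)%N) c i * (lam i)%:Z.

Lemma prod_exprz (I : Type) (r : seq I) (P : pred I) (F : I -> int) (s : C) : s != 0 ->
  \prod_(i <- r | P i) s ^ F i = s ^ (\sum_(i <- r | P i) F i).
Proof.
by move=> s0; apply: (big_rec2 (fun x y => x = s ^ y)) => // i x y _ ->; rewrite expfzDr.
Qed.

Lemma one_param_SL n (c : 'I_n -> int) s : \sum_i c i = 0 -> s != 0 -> SL (one_param c s).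
Proof.
move=> c0 s0; rewrite /SL det_diag.
by under eq_bigr => i _ do rewrite mxE; rewrite prod_exprz // c0 expr0z.
Qed.

Lemma one_param_upper n (c : 'I_n -> int) s : upper_triangular (one_param c s).
Proof. by apply/upper_triangularP => i j ij; rewrite !mxE -val_eqE gtn_eqF. Qed.

Lemma torus_char_one_param n lam (c : 'I_n -> int) s : s != 0 ->
  torus_char lam (one_param c s) = s ^ weight_pairing lam c.
Proof.
move=> s0; rewrite /torus_char -prod_exprz //; apply: eq_bigr => i _.
by rewrite !mxE eqxx mulr1n exprnP exprz_exp.
Qed.

Lemma one_paramV n (c : 'I_n -> int) s : s != 0 ->
  one_param c s *m diag_mx (\row_i s ^ (- c i)) = 1%:M.
Proof.
move=> s0; rewrite mul_diag_mx; apply/matrixP => i j; rewrite !mxE.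
by case: eqP => _; rewrite ?mulr0n ?mulr0 // !mulr1n -expfzDr // subrr.
Qed.

(** All weights of [w] under the one-parameter group are at least [N]: the orbit is [s ^ N] times a
    polynomial curve. The value of that curve at 0 is the component of weight [N]. *)
Definition bounded_weights n m (rho : 'M[C]_n -> 'M[C]_m) (c : 'I_n -> int) (N : int) v w :=
  exists p : 'cV[{poly C}]_m,
    (forall s, s != 0 -> rho (one_param c s) *m w = s ^ N *: pcol_eval s p) /\
    ((forall i j : 'I_n, (i < j)%N -> c i < c j) -> exists a, pcol_eval 0 p = a *: v).

Lemma bounded_weights_csubspace n m (rho : 'M[C]_n -> 'M[C]_m) c N v :
  csubspace (bounded_weights rho c N v).
Proof.
split=> [|w1 w2 [p1 [h1 s1]] [p2 [h2 s2]]|a w1 [p [h s]]].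
- exists 0; split=> [s s0|_]; first by rewrite mulmx0 /pcol_eval map_mx0 scaler0.
  by exists 0; rewrite /pcol_eval map_mx0 scale0r.
- exists (p1 + p2); split=> [s s0|st].
    by rewrite mulmxDr h1 // h2 // /pcol_eval map_mxD scalerDr.
  have [[a1 e1] [a2 e2]] := (s1 st, s2 st); exists (a1 + a2).
  by rewrite /pcol_eval map_mxD -!/(pcol_eval _ _) e1 e2 scalerDl.
- have E z : pcol_eval z (a%:P *: p) = a *: pcol_eval z p.
    by rewrite /pcol_eval map_mxZ /= /horner_eval hornerC.
  exists (a%:P *: p); split=> [t t0|st].
    by rewrite -scalemxAr h // E !scalerA mulrC.
  by have [b e] := s st; exists (a * b); rewrite E e scalerA.
Qed.

(* Conjugation by [one_param c s], [c] increasing, contracts the lower unitriangular group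
   as [s] tends to 0, so the [one_param c]-weights on the orbit span are at least
   [weight_pairing lam c], with only the line of [v] attaining it when [c] is strict. *)
Lemma orbit_span_bounded n m (rho : 'M[C]_n -> 'M[C]_m) lam v (c : 'I_n -> int) w :
  rational_rep rho -> highest_vector rho lam v ->
  (forall i j : 'I_n, (i < j)%N -> c i <= c j) -> \sum_i c i = 0 ->
  orbit_span rho v w -> bounded_weights rho c (weight_pairing lam c) v w.
Proof.
move=> rr hv cle c0; apply; first exact: bounded_weights_csubspace.
apply: big_cell_dense => //; first exact: bounded_weights_csubspace.
move=> l u [l0 l1] uu Sl Su.
(* The conjugate of [l] has entries [l i j * s ^ (c i - c j)]; [l] is lower triangular and [c]
   increasing, so no negative powers occur. *)
pose L : 'M[{poly C}]_n := \matrix_(i, j)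
   if (j <= i)%N then (l i j)%:P * 'X ^+ `|c i - c j|%N else 0.
have LE s : s != 0 -> peval s L = one_param c s *m l *m diag_mx (\row_i s ^ (- c i)).
  move=> s0; rewrite mul_diag_mx mul_mx_diag; apply/matrixP => i j; rewrite !mxE /horner_eval.
  case: leqP => ij; last by rewrite horner0 l0 // mulr0 mul0r.
  rewrite hornerM hornerC hornerXn mulrAC -expfzDr // mulrC exprnP gez0_abs //.
  by rewrite subr_ge0; move: ij; rewrite leq_eqVlt => /predU1P[/val_inj->|/cle].
have L0 : (forall i j : 'I_n, (i < j)%N -> c i < c j) -> peval 0 L = 1%:M.
  move=> st; apply/matrixP => i j; rewrite !mxE /horner_eval.
  case: (ltngtP i j) => ij; rewrite ?horner0 ?hornerM ?hornerC ?hornerXn.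
  - by rewrite -val_eqE ltn_eqF.
  - by rewrite expr0n absz_eq0 subr_eq0 gt_eqF ?st // mulr0 -val_eqE gtn_eqF.
  - by rewrite (val_inj ij) subrr expr0 mulr1 l1 eqxx.
have detL s : \det (peval s L) = 1.
  apply: det_unitriangular; split=> [i j|i]; rewrite !mxE /horner_eval.
    by rewrite ltnNge => /negPf->; rewrite horner0.
  by rewrite leqnn subrr expr0 mulr1 hornerC l1.
have one z : (1 : {poly C}).[z]^-1 *: peval z L = peval z L by rewrite hornerC invr1 scale1r.
have [|K [q Hq]] := @rational_rep_path _ _ _ rho L 1 v rr.
  by move=> z _; rewrite one /SL detL.
have {}Hq z : pcol_eval z q = rho (peval z L) *m v.
  by rewrite Hq ?one !hornerC ?oner_neq0 // expr1n scale1r.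
pose t := torus_char lam u.
have E z : pcol_eval z (t%:P *: q) = t *: pcol_eval z q.
  by rewrite /pcol_eval map_mxZ /= /horner_eval hornerC.
exists (t%:P *: q); split=> [s s0|st]; last first.
  by have [r1 _ _] := rr; exists t; rewrite E Hq L0 // r1 mul1mx.
have [_ rM _] := rr.
have Sc := one_param_SL c0 s0.
have Sq : SL (peval s L) by rewrite /SL detL.
have e : one_param c s *m l = peval s L *m one_param c s.
  by rewrite LE // -mulmxA (mulmx1C (one_paramV c s0)) mulmx1.
rewrite rM // [_ *m (_ *m v)]mulmxA [X in X *m v]mulmxA -rM // e rM // -!mulmxA.
rewrite hv // -/t -scalemxAr hv ?one_param_upper // torus_char_one_param // -scalemxAr.
by rewrite -scalemxAr E Hq !scalerA mulrC.
Qed.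

(** The negative of the sum of the positive coroots; it is antisymmetric under reversal of the
    indices, hence of sum zero. *)
Definition strict_coweight n (i : 'I_n) : int := i.*2%:Z - n.-1%:Z.

Lemma strict_coweight_lt n (i j : 'I_n) :
  (i < j)%N -> strict_coweight i < strict_coweight j.
Proof. by rewrite /strict_coweight; lia. Qed.

Lemma strict_coweight_sum n : \sum_(i < n) strict_coweight i = 0.
Proof.
have h : \sum_(i < n) strict_coweight i = - \sum_(i < n) strict_coweight i.
  rewrite {1}(reindex_inj rev_ord_inj) -sumrN; apply: eq_bigr => i _.
  by rewrite /strict_coweight /=; have := ltn_ord i; lia.
lia.
Qed.

(** For a strict coweight the curve attached to [w] is constantly [w] away from 0, hence also at 0,
    where its value lies on the line of [v]. *)
Lemma top_weight_unique n m (rho : 'M[C]_n -> 'M[C]_m) lam v w :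
  rational_rep rho -> highest_vector rho lam v -> orbit_span rho v w ->
  (forall b, SL b -> upper_triangular b -> rho b *m w = torus_char lam b *: w) ->
  exists a, w = a *: v.
Proof.
move=> rr hv ow hw; pose c := @strict_coweight n.
have c0 : \sum_i c i = 0 := strict_coweight_sum n.
have [|p [ps st]] := orbit_span_bounded rr hv _ c0 ow.
  by move=> i j ij; rewrite ltW // strict_coweight_lt.
have [a pa] := st (@strict_coweight_lt n).
exists a; rewrite -pa; apply/colP => i; rewrite mxE /horner_eval.
have pw s : s != 0 -> pcol_eval s p = w.
  move=> s0; have := ps s s0; rewrite hw ?one_param_upper ?one_param_SL //.
  rewrite torus_char_one_param // => /(congr1 ( *:%R (s ^ weight_pairing lam c)^-1)).
  by rewrite !scalerA mulVf ?expfz_neq0 // !scale1r.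
suff /eqP : p i 0 - (w i 0)%:P = 0 by rewrite subr_eq0 => /eqP->; rewrite hornerC.
apply: poly_eq0_inf; apply: (@infinitely_many_nonroot _ 'X); first by rewrite polyX_eq0.
move=> z; rewrite hornerX => z0; rewrite hornerD hornerN hornerC.
by rewrite -[in X in _ - X](pw z z0) mxE subrr.
Qed.

End HighestWeight.

(** * Irreducibility from unitarity, and uniqueness of the module with given highest weight *)

Section Irreducibility.
Variable R : realType.
Local Notation C := R[i].

Lemma SL_ctr n (g : 'M[C]_n) : SL g -> SL (ctr g).
Proof. by rewrite /SL det_ctr => /eqP->; rewrite rmorph1. Qed.

Lemma mulmx_colP m p (A B : 'M[C]_(m, p)) :
  (forall y : 'cV_p, A *m y = B *m y) -> A = B.
Proof.
move=> h; apply/matrixP => i j; have := h (delta_mx j 0).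
by move/(congr1 (fun M : 'cV_m => M i 0)); rewrite -!colE !mxE.
Qed.

(** Compatibility with adjoints makes the orthogonal complement of a stable [U] stable. The
    projection of [v] to [U] is then again a highest vector, so a multiple [a *: v]: if [a] is 0 the
    whole span is orthogonal to [U], otherwise [U] contains [v]. *)
Lemma star_rep_irreducible n m (rho : 'M[C]_n -> 'M[C]_m) lam (v : 'cV[C]_m) :
  rational_rep rho -> (forall g, SL g -> rho (ctr g) = ctr (rho g)) ->
  highest_vector rho lam v -> v != 0 -> (forall w, orbit_span rho v w) ->
  irreducible_rep rho.
Proof.
move=> rr star hv v0 span; split.
  by case: m rho v rr star hv v0 span => // rho v _ _ _ /eqP[]; apply/colP => [[]].
move=> U cU stU.
have [r [B [BB UB]]] := csubspace_orthobasis cU.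
have UBy y : U (B *m y) by apply/UB; rewrite [ctr B *m _]mulmxA BB mul1mx.
have perp g w : SL g -> ctr B *m w = 0 -> ctr B *m (rho g *m w) = 0.
  move=> Sg Bw.
  have e : rho (ctr g) *m B = B *m (ctr B *m (rho (ctr g) *m B)).
    apply: mulmx_colP => y.
    have /UB : U (rho (ctr g) *m (B *m y)) by apply: stU => //; exact: SL_ctr.
    by rewrite -!mulmxA => ->.
  rewrite mulmxA -[ctr B *m rho g]ctrK ctrM ctrK -star // e !ctrM.
  by rewrite -!mulmxA Bw !mulmx0.
pose u := B *m (ctr B *m v); pose u' := v - u.
have Uu : U u by exact: UBy.
have Bu' : ctr B *m u' = 0.
  by rewrite mulmxBr /u [ctr B *m (B *m _)]mulmxA BB mul1mx subrr.
have hu b : SL b -> upper_triangular b -> rho b *m u = torus_char lam b *: u.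
  (* The defect [d] lies in [U], and it is minus the corresponding defect of [u'], which is
     orthogonal to [U]. *)
  move=> Sb ub; apply/eqP; rewrite -subr_eq0; set d := _ - _.
  have Ud : U d by apply: csubspace_sub => //; [exact: stU | exact: csubspace_scale].
  have -> : d = B *m (ctr B *m d) by apply/esym/UB.
  have -> : d = - (rho b *m u' - torus_char lam b *: u').
    by rewrite /d /u' mulmxBr hv // scalerBr !opprB [RHS]addrC addrA subrK.
  by rewrite mulmxN mulmxBr perp // -scalemxAr Bu' scaler0 subrr oppr0 mulmx0.
have [a ua] := top_weight_unique rr hv (span u) hu.
have [a0|a0] := eqVneq a 0; [left|right] => w.
  have Bv : ctr B *m v = 0.
    by rewrite -[v](subrK u) mulmxDr Bu' ua a0 scale0r mulmx0 addr0.
  have Bw : ctr B *m w = 0.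
    apply: (span w (fun w => ctr B *m w = 0)) => [|g Sg]; last exact: perp.
    split=> [|w1 w2 h1 h2|c w1 h1]; first by rewrite mulmx0.
      by rewrite mulmxDr h1 h2 addr0.
    by rewrite -scalemxAr h1 scaler0.
  by move/UB; rewrite Bw mulmx0.
apply: (span w U cU) => g Sg; apply: stU => //.
by rewrite -[v](scalerK a0) -ua; exact: csubspace_scale.
Qed.

Lemma trivial_kernel_rank p q (A : 'M[C]_(p, q)) :
  (forall w : 'cV_q, A *m w = 0 -> w = 0) -> \rank A = q.
Proof.
move=> iA; have : row_free A^T.
  rewrite -kermx_eq0; apply/eqP/trmx_inj/mulmx_colP => y.
  rewrite trmx0 mul0mx; apply: iA.
  have e : A *m (kermx A^T)^T = 0.
    by apply: trmx_inj; rewrite trmx_mul trmxK mulmx_ker trmx0.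
  by rewrite mulmxA e mul0mx.
by rewrite /row_free mxrank_tr => /eqP.
Qed.

(** In the direct sum, the span [E] of the orbit of [(v1, v2)] is the graph of an isomorphism:
    irreducibility of the factors decides its kernels and projections. *)
Lemma highest_weight_unique n m1 m2 (rho1 : 'M[C]_n -> 'M[C]_m1)
    (rho2 : 'M[C]_n -> 'M[C]_m2) lam :
  is_V rho1 lam -> is_V rho2 lam ->
  exists T : 'M[C]_(m1, m2),
    [/\ forall g, SL g -> rho1 g *m T = T *m rho2 g,
        forall w : 'cV_m2, T *m w = 0 -> w = 0 & m1 = m2].
Proof.
move=> [rr1 irr1 [v1 [v10 hv1]]] [rr2 irr2 [v2 [v20 hv2]]].
pose rho g : 'M[C]_(m1 + m2) := block_mx (rho1 g) 0 0 (rho2 g).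
have rhoE g (w1 : 'cV_m1) (w2 : 'cV_m2) :
    rho g *m col_mx w1 w2 = col_mx (rho1 g *m w1) (rho2 g *m w2).
  by rewrite mul_block_col !mul0mx addr0 add0r.
have rr : rational_rep rho.
  case: rr1 rr2 => [r11 r1M [P1 rP1]] [r21 r2M [P2 rP2]]; split.
  - by rewrite /rho r11 r21 -scalar_mx_block.
  - move=> g h Sg Sh; rewrite /rho mulmx_block !mul0mx !mulmx0 !addr0 add0r.
    by rewrite r1M // r2M.
  - exists (block_mx P1 0 0 P2) => g Sg.
    by rewrite map_block_mx !map_mx0 /rho rP1 // rP2.
pose v : 'cV[C]_(m1 + m2) := col_mx v1 v2.
have hv : highest_vector rho lam v.
  by move=> b Sb ub; rewrite rhoE hv1 // hv2 // scale_col_mx.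
pose E w1 w2 := orbit_span rho v (col_mx w1 w2).
have cE := orbit_span_csubspace rho v.
have E0 : E 0 0 by rewrite /E col_mx0; case: cE.
have ED w1 w2 u1 u2 : E w1 w2 -> E u1 u2 -> E (w1 + u1) (w2 + u2).
  by rewrite /E -add_col_mx; exact: csubspace_add.
have EZ a w1 w2 : E w1 w2 -> E (a *: w1) (a *: w2).
  by rewrite /E -scale_col_mx; exact: csubspace_scale.
have Eg g w1 w2 : SL g -> E w1 w2 -> E (rho1 g *m w1) (rho2 g *m w2).
  by rewrite /E -rhoE => Sg; exact: orbit_span_stable.
have Ev : E v1 v2 by exact: orbit_span_self.
have top w1 w2 : E w1 w2 -> (forall b, SL b -> upper_triangular b ->
     rho b *m col_mx w1 w2 = torus_char lam b *: col_mx w1 w2) ->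
     exists a, w1 = a *: v1 /\ w2 = a *: v2.
  move=> Ew hw; have [a] := top_weight_unique rr hv Ew hw.
  by rewrite scale_col_mx => /eq_col_mx[-> ->]; exists a.
(* If the kernel were everything, [(0, v2)] would be a highest vector in [E], hence a multiple of
   [(v1, v2)], against [v1 != 0]. *)
have K2 w : E 0 w -> w = 0.
  have [||h|h] := irr2.2 (fun w => E 0 w); last first.
  - have [|a [/esym/eqP av /eqP v2a]] := top 0 v2 (h v2).
      by move=> b Sb ub; rewrite rhoE mulmx0 hv2 // scale_col_mx scaler0.
    move: av v2a; rewrite scaler_eq0 (negPf v10) orbF => /eqP->.
    by rewrite scale0r (negPf v20).
  - exact: h.
  - by move=> g u Sg /(Eg g _ _ Sg); rewrite mulmx0.
  - split=> // [u1 u2 h1 h2|a u h1]; first by rewrite -[0]addr0; exact: ED.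
    by rewrite -(scaler0 _ a); exact: EZ.
have K1 w : E w 0 -> w = 0.
  have [||h|h] := irr1.2 (fun w => E w 0); last first.
  - have [|a [/eqP v1a /esym/eqP av]] := top v1 0 (h v1).
      by move=> b Sb ub; rewrite rhoE mulmx0 hv1 // scale_col_mx scaler0.
    move: av v1a; rewrite scaler_eq0 (negPf v20) orbF => /eqP->.
    by rewrite scale0r (negPf v10).
  - exact: h.
  - by move=> g u Sg /(Eg g _ _ Sg); rewrite mulmx0.
  - split=> // [u1 u2 h1 h2|a u h1]; first by rewrite -[0]addr0; exact: ED.
    by rewrite -(scaler0 _ a); exact: EZ.
have S2 w2 : exists w1, E w1 w2.
  have [||h|h] := irr2.2 (fun w2 => exists w1, E w1 w2); last first.
  - exact: h.
  - by have /eqP := h v2 (ex_intro _ v1 Ev); rewrite (negPf v20).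
  - by move=> g u Sg [w1 Ew]; exists (rho1 g *m w1); exact: Eg.
  - split=> [|u1 u2 [w1 h1] [w2' h2]|a u [w1 h1]]; first by exists 0.
      by exists (w1 + w2'); exact: ED.
    by exists (a *: w1); exact: EZ.
have S1 w1 : exists w2, E w1 w2.
  have [||h|h] := irr1.2 (fun w1 => exists w2, E w1 w2); last first.
  - exact: h.
  - by have /eqP := h v1 (ex_intro _ v2 Ev); rewrite (negPf v10).
  - by move=> g u Sg [w2 Ew]; exists (rho2 g *m w2); exact: Eg.
  - split=> [|u1 u2 [w1' h1] [w2' h2]|a u [w1' h1]]; first by exists 0.
      by exists (w1' + w2'); exact: ED.
    by exists (a *: w1'); exact: EZ.
have EB w1 w2 u1 u2 : E w1 w2 -> E u1 u2 -> E (w1 - u1) (w2 - u2).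
  by move=> h1 h2; rewrite -!(scaleN1r (_ : 'cV_ _)); apply: ED => //; exact: EZ.
have /fin_all_exists [t Et] (j : 'I_m2) := S2 (delta_mx j 0).
have ET (w : 'cV_m2) : E ((\matrix_(i, j) t j i 0) *m w) w.
  have -> : (\matrix_(i, j) t j i 0) *m w = \sum_j w j 0 *: t j.
    apply/colP => i; rewrite mxE summxE; apply: eq_bigr => j _.
    by rewrite !mxE mulrC.
  have {2}-> : w = \sum_j w j 0 *: delta_mx j 0.
    by rewrite [LHS]matrix_sum_delta; apply: eq_bigr => j _; rewrite big_ord1.
  apply: (big_rec2 (fun x y => E x y)) => // j x y _; apply: ED; exact: EZ.
pose T : 'M[C]_(m1, m2) := \matrix_(i, j) t j i 0.
have inj (w : 'cV_m2) : T *m w = 0 -> w = 0 by move=> Tw; apply: K2; rewrite -Tw; exact: ET.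
exists T; split=> // [g Sg|].
  apply: mulmx_colP => w; apply/eqP; rewrite -subr_eq0; apply/eqP/K1.
  rewrite -!mulmxA -(subrr (rho2 g *m w)); apply: EB; last exact: ET.
  by apply: Eg => //; exact: ET.
apply/eqP; rewrite eqn_leq -{2}(trivial_kernel_rank inj) rank_leq_row andbT.
have /fin_all_exists [t' Et'] (j : 'I_m1) := S1 (delta_mx j 0).
rewrite -{1}(@trivial_kernel_rank _ _ (\matrix_(i, j) t' j i 0)) ?rank_leq_row // => w Tw.
apply: K1; rewrite -Tw.
have -> : (\matrix_(i, j) t' j i 0) *m w = \sum_j w j 0 *: t' j.
  apply/colP => i; rewrite mxE summxE; apply: eq_bigr => j _.
  by rewrite !mxE mulrC.
have {1}-> : w = \sum_j w j 0 *: delta_mx j 0.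
  by rewrite [LHS]matrix_sum_delta; apply: eq_bigr => j _; rewrite big_ord1.
apply: (big_rec2 (fun x y => E x y)) => // j x y _; apply: ED; exact: EZ.
Qed.

End Irreducibility.

(** * Density of SU(n) in SL(n) *)

Section SpecialUnitary.
Variable R : realType.
Local Notation C := R[i].

Lemma SU_ctr n (g : 'M[C]_n) : SU g = (g *m ctr g == 1%:M) && (\det g == 1).
Proof. by []. Qed.

Lemma SU_SL n (g : 'M[C]_n) : SU g -> SL g.
Proof. by case/andP. Qed.

Definition stabilizes n m (rho : 'M[C]_n -> 'M[C]_m) (W : 'cV[C]_m -> Prop) (g : 'M[C]_n) :=
  SL g /\ forall w, W w -> W (rho g *m w).

Lemma stabilizesM n m (rho : 'M[C]_n -> 'M[C]_m) W g h :
  rational_rep rho -> stabilizes rho W g -> stabilizes rho W h -> stabilizes rho W (g *m h).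
Proof.
case=> _ rM _ [Sg Wg] [Sh Wh]; split; first exact: SLM.
by move=> w Ww; rewrite rM // -mulmxA; apply/Wg/Wh.
Qed.

Lemma conjc_unit_circle (z : C) : z * conjc z = 1 -> z != 0.
Proof. by move=> h; apply: contra_eq_neq h => ->; rewrite mul0r eq_sym oner_neq0. Qed.

Lemma unit_circle_infinite (Q : C -> Prop) :
  (forall z, z * conjc z = 1 -> Q z) -> infinitely_many Q.
Proof.
move=> h.
(* The Cayley transform maps the naturals injectively to the unit circle. *)
pose f (j : nat) : C := (1 + j%:R * 'i%C) / (1 - j%:R * 'i%C).
have d0 (j : nat) : 1 - j%:R * 'i%C != 0 :> C.
  rewrite subr_eq0 eq_sym; apply/eqP => /(congr1 (fun z : C => z ^+ 2)).
  rewrite exprMn sqr_i expr1n mulrN1 => /esym/eqP.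
  by rewrite -addr_eq0 -natrX -[1]/(1%:R) -natrD pnatr_eq0.
apply: (@infinitely_many_inj _ f) => [i j|j]; last first.
  apply: h.
  have ci : conjc ('i%C : C) = - 'i%C by apply/eqP; rewrite eq_complex /= oppr0 !eqxx.
  have e1 : conjc (1 + j%:R * 'i%C : C) = 1 - j%:R * 'i%C.
    by rewrite rmorphD rmorphM rmorph1 rmorph_nat [X in _ * X]ci mulrN.
  have e2 : conjc (1 - j%:R * 'i%C : C) = 1 + j%:R * 'i%C.
    by rewrite rmorphB rmorphM rmorph1 rmorph_nat [X in _ * X]ci mulrN opprK.
  have n0 : 1 + j%:R * 'i%C != 0 :> C by rewrite -e2 conjc_eq0.
  by rewrite /f rmorphM fmorphV /= e1 e2 mulrA mulfVK // mulfV.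
rewrite /f => /eqP; rewrite eqr_div // => /eqP e.
have i0 : 'i%C != 0 :> C by rewrite eq_complex /= oner_eq0 andbF.
have : 2 * 'i%C * ((i%:R : C) - j%:R) = 0.
  move: e; set I := 'i%C; move=> e.
  have -> : 2 * I * ((i%:R : C) - j%:R) =
    (1 + i%:R * I) * (1 - j%:R * I) - (1 + j%:R * I) * (1 - i%:R * I) by ring.
  by rewrite e subrr.
move/eqP; rewrite !mulf_eq0 (negPf i0) pnatr_eq0 /= subr_eq0 eqr_nat => /eqP; exact.
Qed.

Definition torus_elem n (i : 'I_n.+1) (z : C) : 'M[C]_n.+1 :=
  diag_mx (\row_j if j == i then z else if j == 0 then z^-1 else 1).

Lemma torus_elem_SL n (i : 'I_n.+1) z : i != 0 -> z != 0 -> SL (torus_elem i z).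
Proof.
move=> i0 z0; rewrite /SL det_diag (bigD1 i) //= (bigD1 0) 1?eq_sym //= !mxE !eqxx.
rewrite (eq_sym 0) (negPf i0) big1 ?mulr1 ?mulfV // => j /andP[/negPf ji /negPf j0].
by rewrite !mxE ji j0.
Qed.

(** A one-parameter subgroup of the torus, written with common denominator ['X]: its points on the
    unit circle are in SU, and these are infinitely many. *)
Lemma SU_stable_torus n m (rho : 'M[C]_n.+1 -> 'M[C]_m) W (i : 'I_n.+1) z :
  rational_rep rho -> csubspace W -> (forall g, SU g -> stabilizes rho W g) ->
  i != 0 -> z != 0 -> stabilizes rho W (torus_elem i z).
Proof.
move=> rr cW SUW i0 z0; split=> [|w Ww]; first exact: torus_elem_SL.
pose G : 'M[{poly C}]_n.+1 :=
  diag_mx (\row_j if j == i then 'X^2 else if j == 0 then 1 else 'X).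
have GE t : t != 0 -> ('X : {poly C}).[t]^-1 *: peval t G = torus_elem i t.
  move=> t0; apply/matrixP => a b; rewrite !mxE hornerX /horner_eval hornerMn mulrnAr.
  congr (_ *+ _); case: eqP => _; first by rewrite hornerXn expr2 mulKf.
  by case: eqP => _; rewrite ?hornerX ?hornerC ?mulr1 ?mulVf.
have Xz : ('X : {poly C}).[z] != 0 by rewrite hornerX.
rewrite -GE //; apply: (csubspace_path rr cW) => // [t|].
  by rewrite hornerX => t0; rewrite -[t in t^-1]hornerX GE //; exact: torus_elem_SL.
apply: unit_circle_infinite => t tt.
have t0 := conjc_unit_circle tt.
rewrite GE // hornerX; split=> //; apply: (SUW _ _).2 => //.
have /eqP dt := torus_elem_SL i0 t0; rewrite SU_ctr dt eqxx andbT; apply/eqP.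
rewrite mul_diag_mx; apply/matrixP => a b; rewrite mxE ctrE !mxE (eq_sym b a).
case: (eqVneq a b) => [->|_]; rewrite ?mulr1n ?mulr0n ?conjc0 ?mulr0 //.
case: eqP => // _; case: eqP => // _; last by rewrite conjc1 mulr1.
by rewrite conjc_inv -invfM tt invr1.
Qed.

Lemma SU_stable_diag n m (rho : 'M[C]_n.+1 -> 'M[C]_m) W (d : 'rV[C]_n.+1) :
  rational_rep rho -> csubspace W -> (forall g, SU g -> stabilizes rho W g) ->
  \prod_i d 0 i = 1 -> stabilizes rho W (diag_mx d).
Proof.
move=> rr cW SUW d1.
have dn0 i : d 0 i != 0.
  by apply: contra_eq_neq d1 => di; rewrite (bigD1 i) //= di mul0r eq_sym oner_neq0.
pose D s : 'M[C]_n.+1 := diag_mx (\row_j if j \in s then d 0 j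
   else if j == 0 then (\prod_(l <- s) d 0 l)^-1 else 1).
have SD s : uniq s -> 0 \notin s -> stabilizes rho W (D s).
  elim: s => [_ _|i s IHs /= /andP[ins us]].
    have -> : D [::] = 1%:M.
      by apply/matrixP => a b; rewrite !mxE big_nil invr1 /=; case: (a == 0).
    have [r1 _ _] := rr; split=> [|w Ww]; first exact: SL1.
    by rewrite r1 mul1mx.
  rewrite inE negb_or => /andP[i0 s0].
  have -> : D (i :: s) = torus_elem i (d 0 i) *m D s.
    rewrite mul_diag_mx; apply/matrixP => a b; rewrite !mxE mulrnAr; congr (_ *+ _).
    rewrite inE big_cons; case: (eqVneq a i) => [->|ai] /=.
      by rewrite (negPf ins) eq_sym (negPf i0) mulr1.
    case: (boolP (a \in s)) => [as_|_].
      case: eqP => [a0|_]; last by rewrite mul1r.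
      by rewrite a0 (negPf s0) in as_.
    by case: eqP => _; rewrite ?invfM ?mul1r.
  apply: stabilizesM => //; last exact: IHs.
  by apply: SU_stable_torus => //; rewrite eq_sym.
have -> : diag_mx d = D [seq i <- enum 'I_n.+1 | i != 0].
  apply/matrixP => a b; rewrite !mxE mem_filter mem_enum andbT.
  congr (_ *+ _); case: (eqVneq a 0) => [->|_] //=.
  rewrite big_filter big_enum_cond /=; apply: (@mulIf _ (\prod_(i | i != 0) d 0 i)).
    by apply/prodf_neq0 => i _.
  rewrite mulVf; last by apply/prodf_neq0 => i _.
  by move: d1; rewrite (bigD1 0).
apply: SD; first by rewrite filter_uniq ?enum_uniq.
by rewrite mem_filter eqxx.
Qed.

Lemma unitarymx_ctr n (P : 'M[C]_n) : P \is unitarymx -> P *m ctr P = 1%:M.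
Proof. by move=> /unitarymxP; rewrite -map_trmx. Qed.

(** [P] is unitary of arbitrary determinant. A diagonal unitary factor corrects it to an element of
    SU and disappears from the conjugate, since it commutes with [diag_mx d]. *)
Lemma SU_stable_spectral n m (rho : 'M[C]_n.+1 -> 'M[C]_m) W (P : 'M[C]_n.+1) (d : 'rV[C]_n.+1) :
  rational_rep rho -> csubspace W -> (forall g, SU g -> stabilizes rho W g) ->
  P *m ctr P = 1%:M -> \prod_i d 0 i = 1 -> stabilizes rho W (ctr P *m diag_mx d *m P).
Proof.
move=> rr cW SUW PP d1.
have dP : conjc (\det P) * \det P = 1.
  by rewrite -det_ctr -det_mulmx (mulmx1C PP) det1.
pose E a : 'M[C]_n.+1 := diag_mx (\row_j if j == 0 then a else 1).
have EE a b : E a *m E b = E (a * b).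
  rewrite mul_diag_mx; apply/matrixP => i j; rewrite !mxE mulrnAr; congr (_ *+ _).
  by case: eqP; rewrite ?mulr1.
have E1 : E 1 = 1%:M by apply/matrixP => i j; rewrite !mxE; case: (i == 0).
have cE a : ctr (E a) = E (conjc a).
  apply/matrixP => i j; rewrite ctrE !mxE (eq_sym j i).
  by case: (eqVneq i j) => [->|_]; rewrite ?mulr0n ?conjc0 // !mulr1n; case: eqP; rewrite ?conjc1.
have dE a : \det (E a) = a.
  rewrite det_diag (bigD1 0) //= !mxE eqxx big1 ?mulr1 // => i /negPf i0.
  by rewrite !mxE i0.
pose Q := E (conjc (\det P)) *m P.
have QQ : Q *m ctr Q = 1%:M.
  by rewrite /Q ctrM mulmxA -[_ *m P *m _]mulmxA PP mulmx1 cE EE conjcK dP E1.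
have SQ : SU Q by rewrite SU_ctr QQ eqxx det_mulmx dE dP /=.
have SQ' : SU (ctr Q).
  by rewrite SU_ctr ctrK (mulmx1C QQ) eqxx det_ctr; case/andP: SQ => _ /eqP->; rewrite rmorph1 /=.
have -> : ctr P *m diag_mx d *m P = ctr Q *m diag_mx d *m Q.
  rewrite /Q ctrM cE conjcK -!mulmxA; congr (_ *m _).
  rewrite [diag_mx d *m (E _ *m P)]mulmxA.
  have -> : diag_mx d *m E (conjc (\det P)) = E (conjc (\det P)) *m diag_mx d.
    by rewrite diag_mxC.
  rewrite !mulmxA EE mulrC dP E1 mul1mx //.
apply: (stabilizesM rr _ (SUW _ SQ)); apply: (stabilizesM rr (SUW _ SQ')).
exact: SU_stable_diag.
Qed.

(* Polar decomposition [g = u h]: the positive factor [h] is a unitary conjugate of a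
   diagonal matrix, and Laurent polynomials in [z] vanishing on the unit circle vanish. *)
Lemma SU_stable_SL n m (rho : 'M[C]_n.+1 -> 'M[C]_m) W g :
  rational_rep rho -> csubspace W -> (forall g, SU g -> stabilizes rho W g) ->
  SL g -> stabilizes rho W g.
Proof.
move=> rr cW SUW Sg.
have [H Hg] : exists H, H = ctr g *m g by exists (ctr g *m g).
have Hn : H \is normalmx by apply/normalmxP; rewrite -map_trmx -/(ctr H) Hg ctrM ctrK.
have [d0 HE] : exists d : 'rV_n.+1, H = ctr (spectralmx H) *m diag_mx d *m spectralmx H.
  have iP : invmx (spectralmx H) = ctr (spectralmx H).
    by rewrite (invmx_unitary (spectral_unitarymx H)) -map_trmx.
  by exists (spectral_diag H); rewrite -iP; apply/orthomx_spectralP.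
move: (spectralmx H) (unitarymx_ctr (spectral_unitarymx H)) HE => P PP HE.
(* The eigenvalues of [ctr g *m g] are squared norms of the columns of the invertible matrix
   [g *m ctr P], hence positive. *)
have dE i : d0 0 i = (ctr (col i (g *m ctr P)) *m col i (g *m ctr P)) 0 0.
  have : P *m H *m ctr P = diag_mx d0.
    by rewrite HE !mulmxA PP mul1mx -mulmxA PP mulmx1.
  move/(congr1 (fun M : 'M_n.+1 => M i i)); rewrite [in RHS]mxE eqxx mulr1n => <-.
  have -> : P *m H *m ctr P = ctr (g *m ctr P) *m (g *m ctr P).
    by rewrite ctrM ctrK Hg !mulmxA.
  by rewrite [LHS]mxE [RHS]mxE; apply: eq_bigr => k _; rewrite !ctrE !mxE.
have gPu : g *m ctr P \in unitmx.
  by rewrite unitmx_mul SL_unit //=; have := mulmx1_unit PP => -[].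
have dp i : 0 < d0 0 i.
  rewrite lt_neqAle; apply/andP; split; last first.
    by rewrite dE ctr_sqr; apply: sumr_ge0 => j _; exact: exprn_ge0.
  apply/negP => /eqP/esym; rewrite dE => /ctr_sqr_eq0.
  move/(congr1 (mulmx (invmx (g *m ctr P)))); rewrite mulmx0 colE mulKmx // => /colP/(_ i).
  by rewrite !mxE !eqxx => /eqP; rewrite oner_eq0.
pose d : 'rV[C]_n.+1 := \row_i sqrtC (d0 0 i).
have dd : diag_mx d *m diag_mx d = diag_mx d0.
  rewrite mul_diag_mx; apply/matrixP => i j; rewrite !mxE mulrnAr.
  by rewrite -expr2 sqrtCK.
pose h := ctr P *m diag_mx d *m P.
have hh : h *m h = H.
  rewrite /h -!mulmxA [P *m (ctr P *m _)]mulmxA PP mul1mx [diag_mx d *m (_ *m P)]mulmxA dd.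
  by rewrite HE !mulmxA.
have ch : ctr h = h.
  rewrite /h !ctrM ctrK -mulmxA; congr (_ *m (_ *m _)).
  apply/matrixP => i j; rewrite ctrE !mxE (eq_sym j i); case: (eqVneq i j) => [->|_].
    by rewrite !mulr1n; apply: conj_Creal; rewrite ger0_real // sqrtC_ge0 ltW.
  by rewrite !mulr0n conjc0.
have pp : \det (ctr P) * \det P = 1 by rewrite -det_mulmx (mulmx1C PP) det1.
have dprod : \prod_i d 0 i = 1.
  have dh : \det h = \prod_i d 0 i.
    by rewrite /h !det_mulmx mulrAC pp mul1r det_diag.
  have p0 : 0 <= \prod_i d 0 i.
    by apply: prodr_ge0 => i _; rewrite mxE sqrtC_ge0 ltW.
  (* The determinant of [h] is a nonnegative number of square 1. *)
  apply/eqP; rewrite -(@eqrXn2 _ 2 _ 1) ?ler01 // expr1n expr2 -dh -det_mulmx hh.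
  by rewrite Hg det_mulmx det_ctr; move/eqP: Sg => ->; rewrite rmorph1 mulr1.
have [Sh Wh] : stabilizes rho W h by exact: SU_stable_spectral.
have hu := SL_unit Sh.
have -> : g = (g *m invmx h) *m h by rewrite mulmxKV.
apply: stabilizesM => //; apply: SUW.
have dg : \det (g *m invmx h) == 1 by apply: SLM => //; exact: SLV.
rewrite SU_ctr dg andbT; apply/eqP/mulmx1C.
rewrite ctrM; have -> : ctr (invmx h) = invmx h.
  apply: (can_inj (mulKmx hu)); rewrite mulmxV // -{1}ch -ctrM mulVmx //; exact: ctr1.
by rewrite !mulmxA -[_ *m ctr g *m g]mulmxA -Hg -hh mulmxA mulVmx // mul1mx mulmxV.
Qed.

End SpecialUnitary.

(** * Real irreducibility *)

Section RealIrreducibility.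
Variable R : realType.
Local Notation C := R[i].

Definition realsubspace m (U : 'cV[C]_m -> Prop) : Prop :=
  [/\ U 0, (forall u v, U u -> U v -> U (u + v)) & (forall (a : R) u, U u -> U ((a%:C)%C *: u))].

(* The antilinear map [a + i b |-> a - i b], [a b] in a totally real form [U]. *)
Lemma real_subrep_conj n m (rho : 'M[C]_n.+1 -> 'M[C]_m) (U : 'cV[C]_m -> Prop) :
  rational_rep rho -> irreducible_rep rho -> realsubspace U ->
  (forall g v, SU g -> U v -> U (rho g *m v)) ->
  [\/ forall v, U v -> v = 0, forall v, U v |
      forall x : 'cV[C]_m, x != 0 -> exists2 y : 'cV[C]_m, y != 0 &
        forall g mu, SU g -> rho g *m x = mu *: x -> rho g *m y = conjc mu *: y].
Proof.
move=> rr irr [U0 UD UZ] stU.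
have ii : 'i%C * 'i%C = -1 :> C by rewrite -expr2 sqr_i.
have UN u : U u -> U (- u).
  by move=> Uu; have := UZ (-1) u Uu; rewrite rmorphN rmorph1 scaleN1r.
have UB u v : U u -> U v -> U (u - v) by move=> ? ?; apply: UD => //; exact: UN.
have SLstable W : csubspace W -> (forall g v, SU g -> W v -> W (rho g *m v)) ->
    (forall v, W v -> v = 0) \/ (forall v, W v).
  move=> cW stW; apply: irr.2 => // g v Sg Wv.
  have [_] : stabilizes rho W g; last by apply.
  apply: SU_stable_SL => // h Sh; split; first exact: SU_SL.
  by move=> w; exact: stW.
have CE (z : C) (w : 'cV[C]_m) : z *: w = ((complex.Re z)%:C)%C *: w + ((complex.Im z)%:C)%C *: ('i%C *: w).
  by rewrite scalerA -scalerDl mulrC -complexE.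
(* The intersection of [U] with its multiple by the imaginary unit is a complex subrepresentation,
   hence zero or everything. *)
have [||X0|Xall] := SLstable (fun w => U w /\ U ('i%C *: w)).
- split=> [|u v [u1 u2] [v1 v2]|z u [u1 u2]].
  + by rewrite scaler0.
  + by rewrite scalerDr; split; exact: UD.
  + have h w : U w -> U ('i%C *: w) -> U (z *: w).
      by move=> ? ?; rewrite CE; apply: UD; exact: UZ.
    split; first exact: h.
    by rewrite scalerA mulrC -scalerA; apply: h => //; rewrite scalerA ii scaleN1r; exact: UN.
- by move=> g v Sg [v1 v2]; rewrite scalemxAr; split; exact: stU.
(* The sum of [U] and its multiple by the imaginary unit is also complex and stable; when it is
   everything, [U] is a real form. *)
- pose Y w := exists a b, [/\ U a, U b & w = a + 'i%C *: b].
  have [||Y0|Yall] := SLstable Y.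
  + split=> [|u v [a [b [Ua Ub ->]]] [a' [b' [Ua' Ub' ->]]]|z u [a [b [Ua Ub ->]]]].
    * by exists 0, 0; rewrite scaler0 addr0.
    * by exists (a + a'), (b + b'); split; [exact: UD|exact: UD|by rewrite scalerDr addrACA].
    * exists (((complex.Re z)%:C)%C *: a - ((complex.Im z)%:C)%C *: b).
      exists (((complex.Re z)%:C)%C *: b + ((complex.Im z)%:C)%C *: a).
      split; [by apply: UB; exact: UZ | by apply: UD; exact: UZ|].
      apply/colP => l; rewrite !mxE {1}[z]complexE; set I := 'i%C in ii *; ring: ii.
  + move=> g v Sg [a [b [Ua Ub ->]]]; exists (rho g *m a), (rho g *m b).
    by rewrite mulmxDr -scalemxAr; split=> //; exact: stU.
  + apply: Or31 => v Uv; apply: Y0; exists v, 0; rewrite scaler0 addr0; split=> //.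
  + apply: Or33 => x x0; have [a [b [Ua Ub xE]]] := Yall x.
    exists (a - 'i%C *: b).
      apply: contra_neq x0 => /eqP; rewrite subr_eq0 => /eqP ab.
      have b0 : b = 0 by apply: X0; split=> //; rewrite -ab.
      by rewrite xE ab b0 scaler0 addr0.
    move=> g mu Sg gx.
    pose al := ((complex.Re mu)%:C)%C : C; pose be := ((complex.Im mu)%:C)%C : C.
    pose e := rho g *m a - (al *: a - be *: b).
    pose f := rho g *m b - (be *: a + al *: b).
    have Ue : U e by apply: (UB); [exact: stU | apply: UB; exact: UZ].
    have Uf : U f by apply: UB; [exact: stU | apply: UD; exact: UZ].
    have muE : mu = al + 'i%C * be by exact: complexE.
    have ef : e + 'i%C *: f = 0.
      have -> : e + 'i%C *: f = rho g *m x - mu *: x; last by rewrite gx subrr.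
      rewrite /e /f xE mulmxDr -scalemxAr muE; apply/colP => k; rewrite !mxE.
      set I := 'i%C in ii *; ring: ii.
    have iE : 'i%C *: e = f.
      have : 'i%C *: (e + 'i%C *: f) = 0 by rewrite ef scaler0.
      by rewrite scalerDr scalerA ii scaleN1r => /eqP; rewrite subr_eq0 => /eqP.
    have e0 : e = 0 by apply: X0; rewrite iE.
    have f0 : f = 0 by rewrite -iE e0 scaler0.
    have ga : rho g *m a = al *: a - be *: b by apply/eqP; rewrite -subr_eq0 -/e e0.
    have gb : rho g *m b = be *: a + al *: b by apply/eqP; rewrite -subr_eq0 -/f f0.
    have cmu : conjc mu = al - 'i%C * be.
      rewrite {1}muE rmorphD rmorphM -mulNr; congr (_ + _ * _); try exact: conjc_real.
      by apply/eqP; rewrite eq_complex /= oppr0 !eqxx.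
    rewrite mulmxBr -scalemxAr ga gb cmu; apply/colP => k; rewrite !mxE.
    set I := 'i%C in ii *; ring: ii.
- by apply: Or32 => v; have [] := Xall v.
Qed.

(** This coweight and the next are constant but for one coordinate, so their pairings with a hook
    see only its size and one row. Increasing order makes this one fit [orbit_span_bounded]. *)
Definition coweight_last n (i : 'I_n.+1) : int := if i == ord_max then n%:Z else -1.
Definition coweight_first n (i : 'I_n.+1) : int := if i == 0 then n%:Z else -1.

Lemma coweight_last_sum n : \sum_i @coweight_last n i = 0.
Proof.
rewrite (bigD1 ord_max) //= /coweight_last eqxx.
under eq_bigr => i /negPf-> do [].
rewrite sumr_const cardC1 card_ord /= mulNrn natz; lia.
Qed.

Lemma coweight_first_sum n : \sum_i @coweight_first n i = 0.
Proof.
rewrite (bigD1 0) //= /coweight_first eqxx.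
under eq_bigr => i /negPf-> do [].
rewrite sumr_const cardC1 card_ord /= mulNrn natz; lia.
Qed.

(** The Weyl group element exchanging the first and last coordinates, with a sign that brings the
    determinant to 1. *)
Definition signed_swap n : 'M[C]_n.+1 :=
  diag_mx (\row_j if j == 0 then -1 else 1) *m perm_mx (tperm 0 ord_max).

Lemma signed_swap_SL n : (0 < n)%N -> SL (signed_swap n).
Proof.
move=> n0; rewrite /SL det_mulmx det_perm odd_tperm det_diag (bigD1 0) //= mxE eqxx.
rewrite big1 => [|i /negPf i0]; last by rewrite mxE i0.
have -> : (0 != ord_max :> 'I_n.+1) by rewrite -val_eqE /= eq_sym -lt0n.
by rewrite expr1 mulr1 mulrNN mulr1.
Qed.

Lemma signed_swap_conj n s :
  signed_swap n *m one_param (@coweight_first n) s = one_param (@coweight_last n) s *m signed_swap n.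
Proof.
rewrite mul_mx_diag mul_diag_mx /signed_swap mul_diag_mx; apply/matrixP => i j; rewrite !mxE.
rewrite [RHS]mulrC; case: (eqVneq (tperm 0 ord_max i) j) => [ij|_]; last by rewrite !mulr0 !mul0r.
congr (_ * s ^ _); rewrite /coweight_first /coweight_last -ij.
by rewrite (can2_eq (@tpermK _ 0 ord_max) (@tpermK _ 0 ord_max)) tpermL.
Qed.

Lemma sum_hook_weight n k : (k < n)%N ->
  \sum_(i < n | (0 < i)%N) (hook_weight n.+1 k i)%:Z = k%:Z.
Proof.
move=> kn; rewrite -(big_mkord (fun i => (0 < i)%N) (fun i => (hook_weight n.+1 k i)%:Z)).
rewrite (@big_cat_nat _ _ _ k.+1) //= addrC big1_seq ?add0r => [|i]; last first.
  by rewrite mem_index_iota /hook_weight => /andP[/lt0n_neq0/negPf-> /andP[ki _]]; rewrite leqNgt ki.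
rewrite big_mkcond big_nat_recl //= add0r.
rewrite (eq_big_nat _ _ (F2 := fun=> 1)) => [|i /andP[_ ik]]; last by rewrite /hook_weight /= ik.
by rewrite sumr_const_nat subn0 natz.
Qed.

Lemma sum_widen n (F : 'I_n.+1 -> int) :
  \sum_(i < n.+1 | (i < n)%N) F i = \sum_(i < n) F (widen_ord (leqnSn n) i).
Proof.
rewrite big_mkcond big_ord_recr /= ltnn addr0; apply: eq_bigr => i _.
by rewrite ltn_ord.
Qed.

Lemma hook_pairing_first n k : (k < n)%N ->
  weight_pairing (hook_weight n.+1 k) (@coweight_first n) = (n.+1 * (n - k))%N%:Z.
Proof.
case: n => // n kn; rewrite /weight_pairing sum_widen (bigD1 0) //=.
rewrite (eq_bigr (fun i : 'I_n.+1 => - (hook_weight n.+2 k i)%:Z)) => [|i i0]; last first.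
  by rewrite /coweight_first -val_eqE /= (negPf (i0 : (i : nat) != 0%N)) mulN1r.
rewrite sumrN (eq_bigl (fun i : 'I_n.+1 => (0 < i)%N)) => [|i]; last by rewrite lt0n.
rewrite sum_hook_weight // /coweight_first /hook_weight /=; nia.
Qed.

Lemma hook_pairing_last n k : (k < n)%N ->
  weight_pairing (hook_weight n.+1 k) (@coweight_last n) = - n.+1%:Z.
Proof.
case: n => // n kn; rewrite /weight_pairing sum_widen.
rewrite (eq_bigr (fun i : 'I_n.+1 => - (hook_weight n.+2 k i)%:Z)) => [|i i0]; last first.
  by rewrite /coweight_last -val_eqE /= ltn_eqF // mulN1r.
rewrite sumrN (bigD1 0) //= (eq_bigl (fun i : 'I_n.+1 => (0 < i)%N)) => [|i]; last by rewrite lt0n.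
rewrite sum_hook_weight // /hook_weight /=; lia.
Qed.

Lemma conjc_exprz (s : C) z : conjc (s ^ z) = conjc s ^ z.
Proof. by case: z => k; rewrite ?NegzE -?exprnN -?exprnP ?conjc_inv (rmorphXn (@conjc R)). Qed.

Lemma one_param_SU n (c : 'I_n -> int) (s : C) :
  \sum_i c i = 0 -> s * conjc s = 1 -> SU (one_param c s).
Proof.
move=> c0 ss; have s0 := conjc_unit_circle ss.
have /eqP dc := one_param_SL c0 s0; rewrite SU_ctr dc eqxx andbT; apply/eqP.
rewrite mul_diag_mx; apply/matrixP => a b; rewrite mxE ctrE !mxE (eq_sym b a).
case: (eqVneq a b) => [->|_]; rewrite ?mulr1n ?mulr0n ?conjc0 ?mulr0 //.
by rewrite conjc_exprz -expfzMl ss exp1rz.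
Qed.

(* The hook module is not self-dual: its [coweight_last]-weights are at least [-(n+1)], while
   [rho (signed_swap n) *m v] has weight [(n+1)(n-k)], whose opposite the antilinear map
   of [real_subrep_conj] would produce. *)
Lemma hook_rep_real_irreducible n k m (rho : 'M[C]_n.+1 -> 'M[C]_m) (U : 'cV[C]_m -> Prop) :
  (k + 3 <= n.+1)%N -> is_V rho (hook_weight n.+1 k) -> realsubspace U ->
  (forall g v, SU g -> U v -> U (rho g *m v)) ->
  (forall v, U v -> v = 0) \/ (forall v, U v).
Proof.
move=> kn [rr irr [v [v0 hv]]] rU stU.
have [h|h|h] := real_subrep_conj rr irr rU stU; [by left | by right|exfalso].
have Sw : SL (@signed_swap n) by apply: signed_swap_SL; lia.
pose x := rho (signed_swap n) *m v.
have x0 : x != 0.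
  by apply: contra_neq v0 => x0; rewrite -(rational_repV v rr Sw) -/x x0 mulmx0.
have [y y0 Hy] := h x x0.
have [_ rM _] := rr.
have kn' : (k < n)%N by lia.
have xw s : s != 0 -> rho (one_param (@coweight_last n) s) *m x = s ^ (n.+1 * (n - k))%N *: x.
  move=> s0; have S1 := one_param_SL (@coweight_last_sum n) s0.
  have S2 := one_param_SL (@coweight_first_sum n) s0.
  rewrite /x mulmxA -rM // -signed_swap_conj rM // -mulmxA hv ?one_param_upper //.
  by rewrite torus_char_one_param // hook_pairing_first // -scalemxAr.
have [|p [ps _]] := orbit_span_bounded rr hv _ (@coweight_last_sum n)
    (@irreducible_orbit_span _ _ _ _ v y rr irr v0).
  move=> i j ij; rewrite /coweight_last -!val_eqE /= ltn_eqF; first by case: eqP.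
  by rewrite (leq_trans ij) // -ltnS.
rewrite hook_pairing_last // in ps.
have e : (n.+1 * (n - k))%N = ((n.+1 * (n - k).-1) + n.+1)%N by nia.
(* The gap between the weight [(n+1)(n-k)] and the bound [n+1] on opposite weights; this is where
   [k + 3 <= n.+1] enters. *)
have pos : (0 < n.+1 * (n - k).-1)%N by rewrite muln_gt0 /=; lia.
(* On the unit circle conjugation is inversion, so [y] equals a polynomial curve divisible by a
   positive power of [s]; its constant term forces [y = 0]. *)
have pE s : s * conjc s = 1 -> s ^+ (n.+1 * (n - k).-1) *: pcol_eval s p = y.
  move=> ss; have s0 := conjc_unit_circle ss.
  have := Hy _ _ (one_param_SU (@coweight_last_sum n) ss) (xw s s0).
  rewrite ps // => /(congr1 ( *:%R (s ^ (n.+1 * (n - k))%N))).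
  rewrite !scalerA conjc_exprz -expfzMl ss exp1rz scale1r -expfzDr //.
  by rewrite {1}e PoszD addrK -exprnP.
case/eqP: y0; apply/colP => i; rewrite mxE.
have : 'X ^+ (n.+1 * (n - k).-1) * p i 0 - (y i 0)%:P = 0.
  apply: poly_eq0_inf; apply: unit_circle_infinite => s ss.
  by rewrite hornerD hornerN hornerC hornerM hornerXn -(pE s ss) !mxE subrr.
move/(congr1 (fun q : {poly C} => q`_0)); rewrite coefB coefXnM pos coefC /= coef0.
by rewrite sub0r => /eqP; rewrite oppr_eq0 => /eqP.
Qed.

End RealIrreducibility.

(** * Alternating-symmetric tensors *)

Section AlternatingSymmetric.
Variables (n r : nat).
Local Notation idx := {ffun 'I_r -> 'I_n}.

(* Component at [(b, a)] of [X_0 (x) ... (x) X_(r-1)], symmetrised over the output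
   indices [b] and antisymmetrised over the input indices [a]. *)
Definition altsym (K : comNzRingType) (X : 'I_r -> 'M[K]_n) (b a : idx) : K :=
  \sum_(s : 'S_r) (-1) ^+ s * \det (\matrix_(i, j) X i (b j) (a (s j))).

Lemma eq_altsym (K : comNzRingType) (X Y : 'I_r -> 'M[K]_n) b a :
  X =1 Y -> altsym X b a = altsym Y b a.
Proof.
move=> XY; apply: eq_bigr => s _; congr (_ * \det _).
by apply/matrixP => i j; rewrite !mxE XY.
Qed.

(** Each summand is a determinant whose rows are indexed by the family. Triangular changes of the
    family and linear dependence of its members are both handled by this. *)
Lemma altsym_lin (K : comNzRingType) (M : 'M[K]_r) (X : 'I_r -> 'M[K]_n) (b a : idx) :
  altsym (fun i => \sum_l M i l *: X l) b a = \det M * altsym X b a.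
Proof.
rewrite big_distrr; apply: eq_bigr => s _ /=; rewrite mulrCA -det_mulmx; congr (_ * \det _).
apply/matrixP => i j; rewrite !mxE summxE; apply: eq_bigr => l _.
by rewrite !mxE.
Qed.

Lemma altsym_map (K L : comNzRingType) (f : {rmorphism K -> L}) (X : 'I_r -> 'M[K]_n) (b a : idx) :
  altsym (fun i => map_mx f (X i)) b a = f (altsym X b a).
Proof.
rewrite rmorph_sum; apply: eq_bigr => s _; rewrite rmorphMsign -det_map_mx.
by congr (_ * \det _); apply/matrixP => i j; rewrite !mxE.
Qed.

Lemma sum_ffun_perm (K : comNzRingType) (t : 'S_r) (F : idx -> K) :
  \sum_(b : idx) F b = \sum_(b : idx) F [ffun j => b (t j)].
Proof.
rewrite (reindex (fun b : idx => [ffun j => b (t j)])) //.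
exists (fun b : idx => [ffun j => b (t^-1%g j)]) => b _; apply/ffunP => j; rewrite !ffunE.
  by rewrite permKV.
by rewrite permK.
Qed.

(** Simultaneous permutations of tensor factors commute with the action of [g] and [h]; after
    reindexing by [t] and [t * s] the sum of products is a product of entries of [g *m X i *m h]. *)
Lemma altsym_conj (K : comNzRingType) (g h : 'M[K]_n) (X : 'I_r -> 'M[K]_n) (b a : idx) :
  \sum_(y : idx * idx)
     (\prod_j (g (b j) (y.1 j) * h (y.2 j) (a j))) * altsym X y.1 y.2 =
  altsym (fun i => g *m X i *m h) b a.
Proof.
rewrite -(pair_bigA _ (fun b' a' : idx =>
   (\prod_j (g (b j) (b' j) * h (a' j) (a j))) * altsym X b' a')) /=.
under eq_bigr => b' _ do under eq_bigr => a' _ do rewrite big_distrr /=.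
under eq_bigr => b' _ do rewrite exchange_big /=.
rewrite exchange_big; apply: eq_bigr => s _ /=.
under eq_bigr => b' _ do under eq_bigr => a' _ do rewrite mulrCA /determinant big_distrr /=.
under eq_bigr => b' _ do rewrite -big_distrr /= exchange_big /=.
rewrite -big_distrr /= exchange_big; congr (_ * _); apply: eq_bigr => t _ /=.
under eq_bigr => b' _ do under eq_bigr => a' _ do rewrite mulrCA.
under eq_bigr => b' _ do rewrite -big_distrr /=.
rewrite -big_distrr; congr (_ * _) => /=.
transitivity (\sum_(b' : idx) \sum_(a' : idx) \prod_i
  (g (b (t i)) (b' i) * X i (b' i) (a' i) * h (a' i) (a (s (t i))))).
  rewrite (sum_ffun_perm t^-1%g); apply: eq_bigr => b' _.
  rewrite (sum_ffun_perm (t * s)^-1%g); apply: eq_bigr => a' _.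
  rewrite big_split /= (reindex_perm t) /= [X in _ * X * _](reindex_perm (t * s)%g) /=.
  rewrite -!big_split; apply: eq_bigr => i _ /=.
  by rewrite !mxE !ffunE -!(permM t s) !permK mulrAC.
transitivity (\prod_i \sum_p \sum_q g (b (t i)) p * X i p q * h q (a (s (t i)))).
  rewrite bigA_distr_bigA; apply: eq_bigr => b' _; rewrite bigA_distr_bigA.
  by apply: eq_bigr => a' _.
apply: eq_bigr => i _; rewrite !mxE exchange_big; apply: eq_bigr => q _ /=.
by rewrite mxE big_distrl.
Qed.

End AlternatingSymmetric.

(** * Diagonal families as the torus-invariant part of rank one families *)

Section ZeroWeight.
Variables (K : comNzRingType) (n r : nat).
Local Notation idx := {ffun 'I_r.+1 -> 'I_n}.

Definition detw (w : 'I_r.+1 -> 'rV[K]_n) (b : idx) : K := \det (\matrix_(i, j) w i 0 (b j)).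

Definition mult (b : idx) (p : 'I_n) : nat := #|[pred j | b j == p]|.

(** Under conjugation by a diagonal matrix [z], the coordinate [(b, a)] is scaled by the product of
    the [z (b j) / z (a j)]; balanced pairs are those of weight zero. *)
Definition balanced (b a : idx) : bool := [forall p, mult b p == mult a p].

Lemma balancedP (b a : idx) : reflect (exists s : 'S_r.+1, b = [ffun j => a (s j)]) (balanced b a).
Proof.
have cnt (c : idx) p : count_mem p [tuple c j | j < r.+1] = mult c p.
  by rewrite -sum1_count big_map big_enum_cond /mult -sum1_card; apply: eq_bigl => j.
apply: (iffP forallP) => [h|[s ->] p]; last first.
  rewrite /mult -(card_imset _ (@perm_inj _ s)) /=; apply/eqP/eq_card => j.
  apply/imsetP/idP => [[i ia ->]|ja]; first by move: ia; rewrite !inE ffunE.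
  by exists (s^-1 j)%g; rewrite ?permKV // !inE ffunE permKV.
have /tuple_permP [s es] : perm_eq [tuple b j | j < r.+1] [tuple a j | j < r.+1].
  by apply/allP => p _ /=; have := h p; rewrite -!cnt.
exists s; apply/ffunP => j; rewrite ffunE.
have /(congr1 (fun t => nth (b j) t j)) := es.
by rewrite -[LHS]tnth_nth -[RHS]tnth_nth !tnth_mktuple.
Qed.

Lemma prod_nat_bool (I : finType) (F : I -> bool) :
  \prod_i (F i)%:R = [forall i, F i]%:R :> K.
Proof.
case: forallP => [h|/forallP]; first by rewrite big1 // => i _; rewrite h.
by rewrite negb_forall => /existsP[i /negPf Fi]; rewrite (bigD1 i) //= Fi mul0r.
Qed.

Lemma altsym_diag (w : 'I_r.+1 -> 'rV[K]_n) (b a : idx) :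
  altsym (fun i => diag_mx (w i)) b a =
  detw w b * \sum_(s : 'S_r.+1) (-1) ^+ s * (b == [ffun j => a (s j)])%:R.
Proof.
rewrite big_distrr; apply: eq_bigr => s _ /=; rewrite mulrCA; congr (_ * _).
have -> : (b == [ffun j => a (s j)])%:R = \det (diag_mx (\row_j (b j == a (s j))%:R)) :> K.
  rewrite det_diag; under eq_bigr => j _ do rewrite mxE.
  rewrite prod_nat_bool; congr (nat_of_bool _)%:R.
  by apply/eqP/forallP => [-> j|h]; [rewrite ffunE | apply/ffunP => j; rewrite ffunE; apply/eqP/h].
rewrite -det_mulmx mul_mx_diag; congr (\det _); apply/matrixP => i j; rewrite !mxE.
by rewrite mulr_natr.
Qed.

Lemma det_col_perm m (s : 'S_m) (A : 'M[K]_m) : \det (col_perm s A) = (-1) ^+ s * \det A.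
Proof. by rewrite col_permE det_mulmx det_perm odd_permV mulrC. Qed.

Lemma det_eq_col m (A : 'M[K]_m) j1 j2 : j1 != j2 -> (forall i, A i j1 = A i j2) -> \det A = 0.
Proof.
by move=> nj e; rewrite -det_tr (determinant_alternate nj) // => i; rewrite !mxE.
Qed.

Lemma detw_perm w (a : idx) (s : 'S_r.+1) : detw w [ffun j => a (s j)] = (-1) ^+ s * detw w a.
Proof.
rewrite -det_col_perm; congr (\det _); apply/matrixP => i j.
by rewrite !mxE ffunE.
Qed.

Lemma detw_noninj w (a : idx) j1 j2 : j1 != j2 -> a j1 = a j2 -> detw w a = 0.
Proof. by move=> nj e; apply: (det_eq_col nj) => i; rewrite !mxE e. Qed.

(** This is the factorial of [r], the order of a point stabiliser; only that it is invertible over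
    the complex numbers will matter. *)
Definition stab_count : K := \sum_(s : 'S_r.+1) (s 0 == 0)%:R.

Lemma sum_perm_val (F : 'I_r.+1 -> K) j :
  \sum_(s : 'S_r.+1) F (s j) = stab_count * \sum_l F l.
Proof.
transitivity (\sum_(s : 'S_r.+1) \sum_l F l * (s j == l)%:R).
  apply: eq_bigr => s _; rewrite (bigD1 (s j)) //= eqxx mulr1 big1 ?addr0 // => l.
  by rewrite eq_sym => /negPf ->; rewrite mulr0.
rewrite exchange_big big_distrr; apply: eq_bigr => l _ /=.
rewrite -big_distrr /= mulrC; congr (_ * _).
rewrite (reindex_inj (mulgI (tperm 0 j))) (reindex_inj (mulIg (tperm 0 l))).
apply: eq_bigr => s _; rewrite !permM tpermR.
by rewrite (can2_eq (@tpermK _ 0 l) (@tpermK _ 0 l)) tpermR.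
Qed.

(** An entry of [const_mx 1 *m w i] depends on the input index alone, so once columns are permuted
    only row 0 depends on [s]. Summing over [s] turns that row into multiplicities of the [a j],
    which are all 1, as in [w 0], when [a] is injective. *)
Lemma altsym_rank1 (w : 'I_r.+1 -> 'rV[K]_n) (b a : idx) :
  w 0 = const_mx 1 -> balanced b a ->
  altsym (fun i => if i == 0 then 1%:M else const_mx 1 *m w i) b a =
  stab_count * altsym (fun i => diag_mx (w i)) b a.
Proof.
move=> w0 bal.
pose Y (u : 'rV[K]_r.+1) : 'M[K]_r.+1 := \matrix_(i, j) if i == 0 then u 0 j else w i 0 (a j).
have detY u : \det (Y u) = \sum_j u 0 j * cofactor (Y 0) 0 j.
  rewrite (expand_det_row _ 0); apply: eq_bigr => j _; rewrite mxE eqxx; congr (_ * _).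
  congr (_ * \det _); apply/matrixP => i l; rewrite !mxE.
  by rewrite (eq_sym _ 0) (negPf (neq_lift 0 i)).
have -> : altsym (fun i => if i == 0 then 1%:M else const_mx 1 *m w i) b a =
    \sum_(s : 'S_r.+1) \det (Y (\row_j (b (s^-1 j)%g == a j)%:R)).
  apply: eq_bigr => s _.
  have -> : \det (Y (\row_j (b (s^-1 j)%g == a j)%:R)) =
     (-1) ^+ s * ((-1) ^+ s * \det (Y (\row_j (b (s^-1 j)%g == a j)%:R))).
    by rewrite mulrA -expr2 sqrr_sign mul1r.
  rewrite -[X in _ = _ * X]det_col_perm; congr (_ * \det _).
  apply/matrixP => i j; rewrite !mxE.
  by case: eqP => _; rewrite !mxE ?permK // big_ord1 !mxE mul1r.
have -> : \sum_(s : 'S_r.+1) \det (Y (\row_j (b (s^-1 j)%g == a j)%:R)) =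
    stab_count * \det (Y (\row_j (mult b (a j))%:R)).
  under eq_bigr => s _ do rewrite detY.
  rewrite exchange_big detY big_distrr; apply: eq_bigr => j _ /=.
  rewrite -big_distrl /= mulrA; congr (_ * _).
  rewrite (reindex_inj invg_inj); under eq_bigr => s _ do rewrite invgK mxE.
  rewrite (sum_perm_val (fun l => (b l == a j)%:R)) mxE; congr (_ * _).
  by rewrite -natr_sum; congr _%:R; rewrite /mult -sum1_card [RHS]big_mkcond.
congr (_ * _).
have multE j : mult b (a j) = mult a (a j) by apply/eqP; exact: (forallP bal).
have [s bs] := balancedP _ _ bal.
have db : detw w b = (-1) ^+ s * detw w a by rewrite bs detw_perm.
rewrite altsym_diag db.
(* A repeated input index gives two equal columns on both sides, so both vanish. *)
have [/injectiveP inj|/injectivePn [j1 [j2 nj e]]] := boolP (injectiveb a); last first.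
  rewrite (detw_noninj w nj e) mulr0 mul0r; apply: (det_eq_col nj) => i.
  by rewrite !mxE !multE e.
rewrite (bigD1 s) //= -bs eqxx mulr1 big1 => [|t nts].
  rewrite addr0 mulrAC -expr2 sqrr_sign mul1r; congr (\det _).
  apply/matrixP => i j; rewrite !mxE; case: eqP => [->|//].
  rewrite w0 !mxE multE /mult (eq_card1 (x := j)) // => l.
  by rewrite !inE (inj_eq inj).
case: eqP => [/ffunP e|_]; last by rewrite mulr0.
case/eqP: nts; apply/permP => j; have := e j; rewrite bs !ffunE.
by move/inj.
Qed.

Lemma altsym_diag_unbalanced (w : 'I_r.+1 -> 'rV[K]_n) (b a : idx) :
  ~~ balanced b a -> altsym (fun i => diag_mx (w i)) b a = 0.
Proof.
move=> nb; rewrite altsym_diag big1 ?mulr0 // => s _.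
by case: eqP => [e|_]; rewrite ?mulr0 //; case/balancedP: nb; exists s.
Qed.

End ZeroWeight.

(** * The conjugation representation on tensor powers of matrices *)

Section TensorRep.
Variable R : realType.
Local Notation C := R[i].

Lemma invmx_mul n (g h : 'M[C]_n) : g \in unitmx -> h \in unitmx ->
  invmx (g *m h) = invmx h *m invmx g.
Proof.
move=> ug uh; have ugh : g *m h \in unitmx by rewrite unitmx_mul ug.
apply: (can_inj (mulKmx ugh)); rewrite mulmxV // mulmxA -[g *m h *m _]mulmxA.
by rewrite mulmxV // mulmx1 mulmxV.
Qed.

Lemma invmx_ctr n (g : 'M[C]_n) : invmx (ctr g) = ctr (invmx g).
Proof. by rewrite /ctr map_invmx trmx_inv. Qed.

Definition SL_poly n (F : 'M[C]_n -> C) :=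
  exists P : {mpoly C[n * n]}, forall g, SL g -> F g = P.@[fun t => mxvec g 0 t].

Lemma SL_poly_const n c : SL_poly (fun _ : 'M_n => c).
Proof. by exists c%:MP => g _; rewrite mevalC. Qed.

Lemma SL_poly_entry n i j : SL_poly (fun g : 'M_n => g i j).
Proof. by exists 'X_(mxvec_index i j) => g _; rewrite mevalXU mxvecE. Qed.

Lemma SL_polyM n (F G : 'M[C]_n -> C) : SL_poly F -> SL_poly G -> SL_poly (fun g => F g * G g).
Proof. by case=> P hP [Q hQ]; exists (P * Q) => g Sg; rewrite mevalM hP ?hQ. Qed.

Lemma SL_poly_sum n (I : finType) (F : I -> 'M[C]_n -> C) :
  (forall i, SL_poly (F i)) -> SL_poly (fun g => \sum_i F i g).
Proof.
move=> /fin_all_exists [P hP]; exists (\sum_i P i) => g Sg.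
by rewrite rmorph_sum; apply: eq_bigr => i _; exact: hP.
Qed.

Lemma SL_poly_prod n (I : finType) (F : I -> 'M[C]_n -> C) :
  (forall i, SL_poly (F i)) -> SL_poly (fun g => \prod_i F i g).
Proof.
move=> /fin_all_exists [P hP]; exists (\prod_i P i) => g Sg.
by rewrite rmorph_prod; apply: eq_bigr => i _; exact: hP.
Qed.

Lemma SL_poly_ext n (F G : 'M[C]_n -> C) :
  (forall g, SL g -> F g = G g) -> SL_poly G -> SL_poly F.
Proof. by move=> e [P hP]; exists P => g Sg; rewrite e ?hP. Qed.

(** On SL the inverse is the adjugate, whose entries are polynomial. *)
Lemma SL_poly_inv n i j : SL_poly (fun g : 'M_n => invmx g i j).
Proof.
apply: (@SL_poly_ext _ _ (fun g => (-1) ^+ (j + i) *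
    \sum_(s : 'S_n.-1) (-1) ^+ s * \prod_l g (lift j l) (lift i (s l)))).
  move=> g Sg; rewrite /invmx SL_unit // (eqP Sg) invr1 scale1r !mxE /cofactor.
  congr (_ * _); apply: eq_bigr => s _; congr (_ * _); apply: eq_bigr => l _.
  by rewrite !mxE.
apply: SL_polyM; first exact: SL_poly_const.
apply: SL_poly_sum => s; apply: SL_polyM; first exact: SL_poly_const.
by apply: SL_poly_prod => l; exact: SL_poly_entry.
Qed.

Variables (n r : nat).
Local Notation idx := {ffun 'I_r -> 'I_n}.
Local Notation tidx := (idx * idx)%type.

Definition tvec (T : tidx -> C) : 'cV[C]_#|{: tidx}| := \col_i T (enum_val i).
Definition tmat (K : tidx -> tidx -> C) : 'M[C]_#|{: tidx}| :=
  \matrix_(i, j) K (enum_val i) (enum_val j).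

Lemma sum_tidx (T : tidx -> C) : \sum_(i < #|{: tidx}|) T (enum_val i) = \sum_x T x.
Proof. by rewrite [RHS](reindex _ (onW_bij _ (@enum_val_bij tidx))). Qed.

Lemma eq_tvec (T U : tidx -> C) : T =1 U -> tvec T = tvec U.
Proof. by move=> e; apply/colP => i; rewrite !mxE e. Qed.

Lemma tmat_tvec K T : tmat K *m tvec T = tvec (fun x => \sum_y K x y * T y).
Proof.
apply/colP => i; rewrite !mxE -sum_tidx; apply: eq_bigr => j _.
by rewrite !mxE.
Qed.

Definition tker (g h : 'M[C]_n) (x y : tidx) : C :=
  \prod_j (g (x.1 j) (y.1 j) * h (y.2 j) (x.2 j)).

Lemma tkerM g h g' h' x z :
  \sum_y tker g h x y * tker g' h' y z = tker (g *m g') (h' *m h) x z.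
Proof.
rewrite -(pair_bigA _ (fun b a : idx => tker g h x (b, a) * tker g' h' (b, a) z)) /=.
transitivity (\prod_j \sum_p \sum_q
    (g (x.1 j) p * h q (x.2 j)) * (g' p (z.1 j) * h' (z.2 j) q)).
  rewrite bigA_distr_bigA; apply: eq_bigr => b _; rewrite bigA_distr_bigA.
  by apply: eq_bigr => a _; rewrite -big_split.
apply: eq_bigr => j _; rewrite !mxE big_distrl; apply: eq_bigr => p _ /=.
by rewrite big_distrr; apply: eq_bigr => q _ /=; rewrite mulrACA [h _ _ * _]mulrC.
Qed.

Definition trep (g : 'M[C]_n) : 'M[C]_#|{: tidx}| := tmat (tker g (invmx g)).

Lemma trepM g h : g \in unitmx -> h \in unitmx -> trep (g *m h) = trep g *m trep h.
Proof.
move=> ug uh; apply/matrixP => i j; rewrite !mxE invmx_mul // -tkerM -sum_tidx.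
by apply: eq_bigr => l _; rewrite !mxE.
Qed.

Lemma trep1 : trep 1%:M = 1%:M.
Proof.
apply/matrixP => i j; rewrite !mxE invmx1 -(inj_eq (@enum_val_inj _ _)).
move: (enum_val i) (enum_val j) => [b a] [b' a']; rewrite /tker /=.
transitivity (\prod_j (((b j == b' j) && (a j == a' j))%:R : C)).
  by apply: eq_bigr => l _; rewrite !mxE (eq_sym (a' l)) -natrM mulnb.
rewrite prod_nat_bool; congr (nat_of_bool _)%:R.
apply/forallP/eqP => [h|[-> ->] l]; last by rewrite !eqxx.
by congr (_, _); apply/ffunP => l; have /andP[/eqP ? /eqP ?] := h l.
Qed.

Lemma trep_ctr g : trep (ctr g) = ctr (trep g).
Proof.
apply/matrixP => i j; rewrite ctrE !mxE invmx_ctr /tker rmorph_prod.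
by apply: eq_bigr => l _; rewrite rmorphM !ctrE.
Qed.

Lemma trep_scale a g : a != 0 -> g \in unitmx -> trep (a *: g) = trep g.
Proof.
move=> a0 ug; have uag : a *: g \in unitmx by rewrite unitmxZ ?unitfE.
apply/matrixP => i j; rewrite !mxE invmxZ //; apply: eq_bigr => l _.
by rewrite !mxE mulrACA mulfV // mul1r.
Qed.

Lemma trep_rational : rational_rep trep.
Proof.
split; [exact: trep1 | by move=> g h Sg Sh; rewrite trepM ?SL_unit|].
have H i j : SL_poly (fun g => trep g i j).
  apply: (@SL_poly_ext _ _ (fun g => tker g (invmx g) (enum_val i) (enum_val j))).
    by move=> g _; rewrite mxE.
  apply: SL_poly_prod => l; apply: SL_polyM; [exact: SL_poly_entry | exact: SL_poly_inv].
have /fin_all_exists [P hP] i : exists Pi : 'I_#|{: tidx}| -> {mpoly C[n * n]}, forall j g, SL g ->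
    trep g i j = (Pi j).@[fun t => mxvec g 0 t].
  by have /fin_all_exists [Pi hPi] j := H i j; exists Pi.
by exists (\matrix_(i, j) P i j) => g Sg; apply/matrixP => i j; rewrite !mxE -hP // !mxE.
Qed.

Definition avec (X : 'I_r -> 'M[C]_n) := tvec (fun x => altsym X x.1 x.2).

Lemma eq_avec X Y : X =1 Y -> avec X = avec Y.
Proof. by move=> XY; apply: eq_tvec => x; exact: eq_altsym. Qed.

Lemma trep_avec g X : trep g *m avec X = avec (fun i => g *m X i *m invmx g).
Proof. by rewrite tmat_tvec; apply: eq_tvec => x; rewrite altsym_conj. Qed.

Lemma avec_lin (M : 'M[C]_r) X : avec (fun i => \sum_l M i l *: X l) = \det M *: avec X.
Proof. by apply/colP => i; rewrite !mxE altsym_lin. Qed.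

End TensorRep.

(** * The hook representation and the powers of a matrix *)

Section HookModel.
Variable R : realType.
Local Notation C := R[i].

Lemma upper_triangular_inv n (b : 'M[C]_n) :
  upper_triangular b -> (forall i, b i i != 0) -> b \in unitmx ->
  (forall i j : 'I_n, (j < i)%N -> invmx b i j = 0) /\ (forall i, invmx b i i = (b i i)^-1).
Proof.
move=> /upper_triangularP ub bn0 bu.
have bV i j : \sum_l b i l * invmx b l j = (i == j)%:R.
  by have := congr1 (fun M : 'M_n => M i j) (mulmxV bu); rewrite !mxE.
have H d (i j : 'I_n) : (n - i <= d)%N -> (j < i)%N -> invmx b i j = 0.
  elim: d i j => [|d IHd] i j; first by have := ltn_ord i; lia.
  move=> di ji; have := bV i j; rewrite (bigD1 i) //= big1 => [|l li].
    by rewrite addr0 -val_eqE gtn_eqF // => /eqP; rewrite mulf_eq0 (negPf (bn0 i)) => /eqP.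
  have [l_i|i_l|e] := ltngtP l i; first by rewrite ub // mul0r.
    by rewrite IHd ?mulr0 //; [have := ltn_ord l; lia | exact: ltn_trans i_l].
  by rewrite (val_inj e) eqxx in li.
have H' (i j : 'I_n) : (j < i)%N -> invmx b i j = 0 by exact: (H (n - i)%N).
split=> // i; have := bV i i; rewrite (bigD1 i) //= big1 => [|l li].
  by rewrite addr0 eqxx => e; apply: (mulfI (bn0 i)); rewrite e mulfV.
have [l_i|i_l|e] := ltngtP l i; first by rewrite ub // mul0r.
  by rewrite H' ?mulr0.
by rewrite (val_inj e) eqxx in li.
Qed.

Variables (n r k : nat).
Hypothesis rkn : (r + k = n)%N.
Local Notation idx := {ffun 'I_r.+1 -> 'I_n.+1}.
Local Notation tidx := (idx * idx)%type.
Local Notation rho := (@trep R n.+1 r.+1).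

Definition hook_index (i : 'I_r.+1) : 'I_n.+1 := inord (k + i).

Lemma hook_indexE i : hook_index i = (k + i)%N :> nat.
Proof. by rewrite inordK // ltnS -rkn addnC leq_add2r -ltnS. Qed.

Definition hook_family (K : comNzRingType) (l : 'I_r.+1 -> 'rV[K]_n.+1) (i : 'I_r.+1) : 'M[K]_n.+1 :=
  if i == 0 then 1%:M else delta_mx 0 (0 : 'I_1) *m l i.

Definition hook_vector : 'cV[C]_#|{: tidx}| :=
  avec (hook_family (fun i => delta_mx 0 (hook_index i))).

Lemma hook_familyE (K : comNzRingType) (l : 'I_r.+1 -> 'rV[K]_n.+1) i p q : i != 0 ->
  hook_family l i p q = (p == 0)%:R * l i 0 q.
Proof. by rewrite /hook_family => /negPf->; rewrite !mxE big_ord1 !mxE eqxx andbT. Qed.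

(** [E_(0,j)] has weight [e_0 - e_j]. Adding the determinant character, trivial on SL, to the sum
    over [j = k+1, ..., n] gives [(r+1) e_0 + e_1 + ... + e_k], the hook. *)
Lemma torus_char_hook (b : 'M[C]_n.+1) : (0 < r)%N -> SL b -> upper_triangular b ->
  torus_char (hook_weight n.+1 k) b =
  b 0 0 ^+ r * \prod_(i < r.+1 | i != 0) (b (hook_index i) (hook_index i))^-1.
Proof.
move=> r0 /eqP Sb /upper_triangularP ub.
have db : \prod_i b i i = 1.
  rewrite -[RHS]Sb -det_tr det_trig; last by apply/is_trig_mxP => i j ij; rewrite mxE ub.
  by apply: eq_bigr => i _; rewrite mxE.
have split_prod : \prod_i b i i =
    \prod_(i < n.+1 | (i <= k)%N) b i i * \prod_(i < r.+1 | i != 0) b (hook_index i) (hook_index i).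
  rewrite (bigID (fun i : 'I_n.+1 => (i <= k)%N)) /=; congr (_ * _).
  rewrite (reindex_onto hook_index (fun i : 'I_n.+1 => inord (i - k))) => [|i] /=.
    apply: eq_bigl => i; rewrite hook_indexE -ltnNge -[X in (X < _)%N]addn0 ltn_add2l.
    by rewrite addKn inord_val eqxx andbT lt0n.
  rewrite -ltnNge => ki; apply: val_inj; rewrite /= hook_indexE inordK ?subnKC //; first exact: ltnW.
  by have := ltn_ord i; lia.
have -> : torus_char (hook_weight n.+1 k) b = b 0 0 ^+ r * \prod_(i < n.+1 | (i <= k)%N) b i i.
  rewrite /torus_char /= (bigD1 0) /=; last by lia.
  rewrite [X in _ = _ * X](bigD1 0) //= mulrA -exprSr.
  have -> : hook_weight n.+1 k 0%N = r.+1 by rewrite /hook_weight /=; lia.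
  congr (_ * _).
  rewrite big_mkcond [RHS]big_mkcond; apply: eq_bigr => i _; rewrite /hook_weight -val_eqE /=.
  case: eqP => _; rewrite ?andbF //= !andbT.
  case: (leqP i k) => ik; last by rewrite expr0; case: ifP.
  by have -> : (i < n)%N by lia.
congr (_ * _); apply: (mulIf (_ : \prod_(i < r.+1 | i != 0) b (hook_index i) (hook_index i) != 0)).
  by move: db; rewrite split_prod; apply: contra_eq_neq => ->; rewrite mulr0 eq_sym oner_neq0.
rewrite -split_prod db -big_split big1 //= => i i0.
apply: mulVf; apply: contra_eq_neq db => bi.
by rewrite (bigD1 (hook_index i)) //= bi mul0r eq_sym oner_neq0.
Qed.

Lemma hook_vector_highest : (0 < r)%N -> highest_vector rho (hook_weight n.+1 k) hook_vector.
Proof.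
move=> r0 b Sb ub; rewrite torus_char_hook // trep_avec.
have bu := SL_unit Sb.
have bn0 i : b i i != 0.
  move/eqP: Sb; rewrite -det_tr det_trig; last first.
    by apply/is_trig_mxP => p q pq; rewrite mxE (upper_triangularP ub).
  apply: contra_eq_neq => bi.
  by rewrite (bigD1 i) //= mxE bi mul0r eq_sym oner_neq0.
have [V0 V1] := upper_triangular_inv ub bn0 bu.
(* Conjugation by [b] scales the column [e_0] by [b 0 0] and sends the row of index [k+i] to a
   combination of later rows; the family thus undergoes a triangular substitution whose determinant
   is the character. *)
pose M : 'M[C]_r.+1 := \matrix_(i, l)
  if i == 0 then (l == 0)%:R else if l == 0 then 0 else b 0 0 * invmx b (hook_index i) (hook_index l).
have M0 (i j : 'I_r.+1) : (j < i)%N -> M i j = 0.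
  move=> ji; rewrite mxE; case: eqP => [i0|_]; first by rewrite i0 in ji.
  by case: eqP => // _; rewrite V0 ?mulr0 // !hook_indexE ltn_add2l.
have -> : b 0 0 ^+ r * \prod_(i < r.+1 | i != 0) (b (hook_index i) (hook_index i))^-1 = \det M.
  rewrite -det_tr det_trig; last by apply/is_trig_mxP => i j ij; rewrite mxE M0.
  rewrite [RHS](bigD1 0) //= !mxE eqxx mul1r.
  under [RHS]eq_bigr => i /negPf i0 do rewrite !mxE i0 V1.
  by rewrite big_split /= prodr_const cardC1 card_ord.
rewrite -avec_lin; apply: eq_avec => i.
have [->|i0] := eqVneq i 0.
  rewrite {1}/hook_family eqxx mulmx1 mulmxV //.
  rewrite (bigD1 0) //= mxE eqxx scale1r /hook_family eqxx big1 ?addr0 // => l /negPf l0.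
  by rewrite mxE eqxx l0 scale0r.
apply/matrixP => p q; rewrite summxE (bigD1 0) //= !mxE (negPf i0) eqxx mul0r add0r.
have -> : (\sum_j (b *m hook_family (fun i => delta_mx 0 (hook_index i)) i) p j * invmx b j q) =
   (p == 0)%:R * b 0 0 * invmx b (hook_index i) q.
  rewrite (bigD1 (hook_index i)) //= [X in _ + X]big1 ?addr0 => [|j ji].
    rewrite mxE (bigD1 0) //= [X in _ + X]big1 ?addr0 => [|j j0]; last first.
      by rewrite hook_familyE // (negPf j0) mul0r mulr0.
    rewrite hook_familyE // !mxE !eqxx !mulr1; congr (_ * _).
    case: (eqVneq p 0) => [->|p0]; first by rewrite mul1r.
    by rewrite mul0r (upper_triangularP ub) // lt0n.
  rewrite mxE big1 ?mul0r // => l _.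
  by rewrite hook_familyE // !mxE (negPf ji) andbF mulr0 mulr0.
have -> : \sum_(l < r.+1 | l != 0) (M i l *: hook_family (fun i => delta_mx 0 (hook_index i)) l) p q
   = \sum_(l < r.+1 | l != 0) (p == 0)%:R * b 0 0 * (invmx b (hook_index i) (hook_index l) * (q == hook_index l)%:R).
  apply: eq_bigr => l l0; rewrite mxE hook_familyE // !mxE (negPf i0) (negPf l0) /=.
  by ring.
rewrite -big_distrr /=; congr (_ * _).
have [qk|kq] := leqP q k.
  rewrite V0 ?hook_indexE; last by rewrite (leq_ltn_trans qk) // -[X in (X < _)%N]addn0 ltn_add2l lt0n.
  rewrite big1 // => l l0; rewrite (_ : (q == _) = false) ?mulr0 // -val_eqE [val (hook_index _)]hook_indexE.
  by apply/negbTE; rewrite neq_ltn (leq_ltn_trans qk) // -[X in (X < _)%N]addn0 ltn_add2l lt0n.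
pose l : 'I_r.+1 := inord (q - k).
have lE : l = (q - k)%N :> nat by rewrite inordK //; have := ltn_ord q; lia.
have ql : q = hook_index l by apply: val_inj; rewrite [val (hook_index _)]hook_indexE lE subnKC // ltnW.
rewrite (bigD1 l) /=; last by rewrite -val_eqE /= lE; lia.
rewrite -ql eqxx mulr1 big1 ?addr0 // => j /andP[_ jl].
rewrite (_ : (q == _) = false) ?mulr0 //; apply/negbTE; apply: contra jl => /eqP e.
have /addnI jl : (k + j = k + l)%N by rewrite -!hook_indexE -e -ql.
by apply/eqP/val_inj.
Qed.

End HookModel.

(** * The powers of a Hermitian matrix lie in the hook module *)

Section PowersInModel.
Variable R : realType.
Local Notation C := R[i].
Variables (n r k : nat).
Hypothesis rkn : (r + k = n)%N.
Local Notation idx := {ffun 'I_r.+1 -> 'I_n.+1}.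
Local Notation tidx := (idx * idx)%type.
Local Notation rho := (@trep R n.+1 r.+1).
Local Notation V := (orbit_span rho (hook_vector R n r k)).

(** Dividing [g] by an [(n+1)]-st root of its determinant lands in SL, and scalars act trivially by
    conjugation. *)
Lemma orbit_span_GL g w : g \in unitmx -> V w -> V (rho g *m w).
Proof.
move=> ug Vw; pose c := n.+1.-root (\det g).
have cn : c ^+ n.+1 = \det g by rewrite rootCK.
have dg0 : \det g != 0 by rewrite -unitfE -unitmxE.
have c0 : c != 0.
  by apply: contra_neq dg0 => c0; rewrite -cn c0 expr0n.
have -> : rho g = rho (c^-1 *: g) by rewrite trep_scale // invr_eq0.
apply: orbit_span_stable => //; first exact: trep_rational.
by rewrite /SL detZ exprVn cn mulVf.
Qed.

(* Both sides are polynomial in [h], so singular [h] are reached along the segment from [1]. *)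
Lemma hook_family_e0 (l : 'I_r.+1 -> 'rV[C]_n.+1) :
  (forall i, l i 0 0 = 0) -> V (avec (hook_family l)).
Proof.
move=> l0.
(* [h] fixes [e_0] and has the prescribed [l i] as its hook rows, so for invertible [h] its inverse
   carries the hook vector to the wanted family. *)
pose h : 'M[C]_n.+1 := \matrix_(p, q)
  if p == 0 then (q == 0)%:R else if (k < p)%N then l (inord (p - k)) 0 q else 0.
have h0 p : h p 0 = (p == 0)%:R.
  by rewrite mxE eqxx; case: eqP => // _; case: ifP.
have hE i : i != 0 -> row (hook_index n k i) h = l i.
  move=> i0; have ip : (0 < i)%N by rewrite lt0n.
  have vE := hook_indexE rkn i; apply/rowP => q; rewrite 2!mxE.
  have -> : (hook_index n k i == 0) = false.
    by apply/negbTE/eqP => /(congr1 val) /=; rewrite vE; lia.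
  have -> : (k < hook_index n k i)%N by rewrite vE; lia.
  by rewrite vE addKn inord_val.
pose H : 'M[{poly C}]_n.+1 := (1 - 'X)%:M + 'X *: map_mx polyC h.
have HE z : peval z H = (1 - z)%:M + z *: h.
  rewrite /peval /H map_mxD map_scalar_mx map_mxZ /= /horner_eval !hornerE.
  by rewrite -map_mx_comp map_mx_id // => x /=; rewrite /horner_eval hornerC.
pose L z (i : 'I_r.+1) := row (hook_index n k i) (peval z H).
pose q : 'cV[{poly C}]_#|{: tidx}| := \col_i
  altsym (hook_family (fun i => row (hook_index n k i) H)) (enum_val i).1 (enum_val i).2.
have qE z : pcol_eval z q = avec (hook_family (L z)).
  apply/colP => x; rewrite !mxE -altsym_map; apply: eq_altsym => i.
  rewrite /hook_family; case: ifP => _; first by rewrite map_mx1.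
  by rewrite map_mxM map_delta_mx map_row.
have -> : avec (hook_family l) = pcol_eval 1 q.
  rewrite qE; apply: eq_avec => i; rewrite /hook_family; case: eqP => [//|/eqP i0].
  by rewrite /L HE subrr scale1r -scalemx1 scale0r add0r hE.
apply: csubspace_pcol_eval; first exact: orbit_span_csubspace.
have H0 : (\det H).[0] = 1 by rewrite -peval_det HE subr0 scale0r addr0 det1.
apply: (@infinitely_many_nonroot _ (\det H)).
  by apply: contraTneq (oner_neq0 C) => E; rewrite -H0 E horner0 eqxx.
move=> z; rewrite -peval_det => dz.
have uz : peval z H \in unitmx by rewrite unitmxE unitfE.
rewrite qE.
suff -> : avec (hook_family (L z)) = rho (invmx (peval z H)) *m hook_vector R n r k.
  by apply: orbit_span_GL; [rewrite unitmx_inv | apply: orbit_span_self; exact: trep_rational].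
rewrite trep_avec invmxK; apply: eq_avec => i; rewrite /hook_family; case: ifP => _.
  by rewrite mulmx1 mulVmx.
have e0 : peval z H *m delta_mx 0 (0 : 'I_1) = delta_mx 0 0.
  apply/colP => p; rewrite -colE HE mxE mxE [X in _ + X = _]mxE h0 !mxE eqxx andbT.
  by case: (p == 0); rewrite ?mulr1n ?mulr0n ?mulr1 ?mulr0 ?addr0 ?subrK.
by rewrite mulmxA -[in RHS]e0 mulKmx // -mulmxA -rowE.
Qed.

(** The matrix [g] sends [e_0] to the all-ones column, and the first coordinate of [l i *m g] is the
    sum of the entries of [l i], that is, the trace of [const_mx 1 *m l i]. *)
Lemma rank1_family_mem (l : 'I_r.+1 -> 'rV[C]_n.+1) :
  (forall i, i != 0 -> \sum_q l i 0 q = 0) ->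
  V (avec (fun i => if i == 0 then 1%:M else const_mx 1 *m l i)).
Proof.
move=> ls.
pose g : 'M[C]_n.+1 := \matrix_(p, q) ((p == q) || (q == 0))%:R.
have ug : g \in unitmx.
  rewrite unitmxE det_unitriangular ?unitr1 //; split=> [p q pq|p]; rewrite mxE ?eqxx //.
  by rewrite -!val_eqE /= ltn_eqF //= gtn_eqF // (leq_ltn_trans _ pq).
have -> : avec (fun i => if i == 0 then 1%:M else const_mx 1 *m l i) =
    rho g *m avec (hook_family (fun i => if i == 0 then 0 else l i *m g)).
  rewrite trep_avec; apply: eq_avec => i; rewrite /hook_family.
  case: ifP => i0; first by rewrite mulmx1 mulmxV.
  rewrite -mulmxA -[_ *m _ *m invmx g]mulmxA mulmxK // mulmxA; congr (_ *m _).
  by apply/colP => p; rewrite -colE !mxE orbT.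
apply: orbit_span_GL => //; apply: hook_family_e0 => i.
case: eqP => [_|/eqP i0]; first by rewrite mxE.
rewrite mxE -[RHS](ls i i0); apply: eq_bigr => q _.
by rewrite mxE eqxx orbT mulr1.
Qed.

(* The component of weight zero under one coordinate of the diagonal torus of [GL_n]. *)
Lemma orbit_span_coordinate T (p : 'I_n.+1) :
  V (tvec T) -> V (tvec (fun x : tidx => T x * (mult x.1 p == mult x.2 p)%:R)).
Proof.
move=> VT.
have le_mult (c : idx) : (mult c p <= r.+1)%N by rewrite -[X in (_ <= X)%N]card_ord max_card.
(* The shift by [r.+1] clears the negative powers, so weight zero sits at the coefficient of index
   [r.+1]. *)
pose q : 'cV[{poly C}]_#|{: tidx}| := \col_i
  let x : tidx := enum_val i in (T x)%:P * 'X ^+ (mult x.1 p + (r.+1 - mult x.2 p)).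
have -> : tvec (fun x : tidx => T x * (mult x.1 p == mult x.2 p)%:R) = pcol_coef r.+1 q.
  apply/colP => i; rewrite !mxE /= coefCM coefXn; congr (_ * _%:R); congr (nat_of_bool _).
  have := le_mult (enum_val i).2.
  by move: (mult _ p) (mult _ p) => u v uv; apply/eqP/eqP; lia.
apply: csubspace_pcol_coef; first exact: orbit_span_csubspace.
apply: (@infinitely_many_nonroot _ 'X); first by rewrite polyX_eq0.
move=> z; rewrite hornerX => z0.
pose D a : 'M[C]_n.+1 := diag_mx (\row_j if j == p then a else 1).
have DD : D z *m D z^-1 = 1%:M.
  rewrite mul_diag_mx; apply/matrixP => i j; rewrite !mxE mulrnAr; congr (_ *+ _).
  by case: eqP; rewrite ?mulfV ?mulr1.
have uD : D z \in unitmx by case/mulmx1_unit: DD.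
have iD : invmx (D z) = D z^-1 by rewrite -[LHS]mulmx1 -DD mulKmx.
suff -> : pcol_eval z q = z ^+ r.+1 *: (rho (D z) *m tvec T).
  by apply: (csubspace_scale (z ^+ r.+1) (orbit_span_csubspace _ _)); exact: orbit_span_GL.
rewrite tmat_tvec; apply/colP => i; rewrite !mxE /=.
move: (enum_val i) => [b a] /=.
rewrite (bigD1 (b, a)) //= big1 => [|[b' a'] ne]; last first.
  have [j /=] : exists j, (b j != b' j) || (a j != a' j).
    apply/existsP; apply: contraNT ne => /existsPn h.
    by apply/eqP; congr (_, _); apply/ffunP => j; have := h j;
      rewrite negb_or !negbK => /andP[/eqP ? /eqP ?].
  move=> hj; rewrite /tker (bigD1 j) //= iD !mxE.
  by case/orP: hj => /negPf hj; rewrite ?hj ?(eq_sym (a' j)) ?hj mulr0n ?mulr0 !mul0r.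
have powE (c : idx) x : \prod_j (if c j == p then x else 1) = x ^+ mult c p :> C.
  by rewrite -big_mkcond prodr_const.
rewrite addr0 /tker iD.
under eq_bigr => j _ do rewrite !mxE !eqxx !mulr1n.
rewrite big_split /= !powE /horner_eval hornerM hornerC hornerXn mulrC mulrA; congr (_ * _).
rewrite exprD mulrCA; congr (_ * _); rewrite exprVn.
by rewrite -{2}(subnK (le_mult a)) exprD mulfK // expf_neq0.
Qed.

Lemma orbit_span_balanced T :
  V (tvec T) -> V (tvec (fun x : tidx => T x * (balanced x.1 x.2)%:R)).
Proof.
move=> VT.
suff H s : V (tvec (fun x : tidx => T x * (all (fun p => mult x.1 p == mult x.2 p) s)%:R)).
  have := H (enum 'I_n.+1); congr (V _); apply: eq_tvec => x; congr (_ * _%:R).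
  congr (nat_of_bool _); apply/allP/forallP => h p; first by rewrite h // mem_enum.
  by move=> _; exact: h.
elim: s => [|p s IHs] /=; first by congr (V _): VT; apply: eq_tvec => x; rewrite mulr1.
have := orbit_span_coordinate p IHs; congr (V _); apply: eq_tvec => x.
by rewrite -mulrA -natrM mulnb andbC.
Qed.

Lemma stab_count_neq0 m : stab_count C m != 0.
Proof.
rewrite /stab_count (bigD1 1%g) //= perm1 eqxx paddr_eq0 ?ler01 ?oner_eq0 //.
by apply: sumr_ge0 => s _; exact: ler0n.
Qed.

Lemma diag_family_mem0 (w : 'I_r.+1 -> 'rV[C]_n.+1) :
  w 0 = const_mx 1 -> (forall i, i != 0 -> \sum_q w i 0 q = 0) ->
  V (avec (fun i => diag_mx (w i))).
Proof.
move=> w0 ws; have := orbit_span_balanced (rank1_family_mem ws).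
move/(csubspace_scale (stab_count C r)^-1 (orbit_span_csubspace _ _)).
congr (V _); apply/colP => i; rewrite !mxE; move: (enum_val i) => [b a] /=.
have [bal|nbal] := boolP (balanced b a); last by rewrite mulr0 mulr0 altsym_diag_unbalanced.
by rewrite mulr1 altsym_rank1 // mulKf // stab_count_neq0.
Qed.

Lemma diag_family_mem (w : 'I_r.+1 -> 'rV[C]_n.+1) :
  w 0 = const_mx 1 -> V (avec (fun i => diag_mx (w i))).
Proof.
move=> w0.
pose c i := (\sum_q w i 0 q) / n.+1%:R.
pose w' i : 'rV[C]_n.+1 := if i == 0 then const_mx 1 else w i - const_mx (c i).
(* Subtracting multiples of the identity, the member of index 0, removes the traces without changing
   the alternating vector. *)
pose M : 'M[C]_r.+1 := \matrix_(i, l) ((i == l)%:R + ((i != 0) && (l == 0))%:R * c i).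
have -> : avec (fun i => diag_mx (w i)) = avec (fun i => diag_mx (w' i)).
  have dM : \det M = 1.
    apply: det_unitriangular; split=> [i j ij|i]; rewrite mxE.
      have j0 : j == 0 = false by apply/negbTE; rewrite -lt0n (leq_ltn_trans _ ij).
      by rewrite -val_eqE /= ltn_eqF // j0 andbF mul0r addr0.
    by rewrite eqxx andNb mul0r addr0.
  rewrite -[RHS]scale1r -dM -avec_lin; apply: eq_avec => i.
  have Mi l : M i l *: diag_mx (w' l) = diag_mx (M i l *: w' l) by rewrite linearZ.
  under eq_bigr => l _ do rewrite Mi.
  rewrite -linear_sum; congr diag_mx.
  have [->|i0] := eqVneq i 0.
    rewrite (bigD1 0) //= big1 => [|l /negPf l0]; last first.
      by rewrite mxE eq_sym l0 eqxx /= mul0r addr0 scale0r.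
    by rewrite mxE !eqxx mul0r !addr0 scale1r /w' eqxx w0.
  rewrite (bigD1 0) //= (bigD1 i) //= big1 => [|l /andP[/negPf l0 /negPf li]]; last first.
    by rewrite mxE eq_sym li i0 l0 /= mul0r addr0 scale0r.
  rewrite !mxE (negPf i0) !eqxx /= mul0r !addr0 add0r mul1r scale1r /w' (negPf i0) eqxx.
  by apply/rowP => q; rewrite !mxE mulr1 addrC subrK.
apply: diag_family_mem0 => [|i i0]; first by rewrite /w' eqxx.
rewrite /w' (negPf i0); under eq_bigr => q _ do rewrite !mxE.
rewrite sumrB sumr_const card_ord -mulr_natr /c divfK ?subrr //.
by rewrite pnatr_eq0.
Qed.

Definition pow_vec (A : 'M[C]_n.+1) : 'cV[C]_#|{: tidx}| := avec (fun i : 'I_r.+1 => A ^+ i).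

Lemma pow_vec_conj g A : g \in unitmx -> pow_vec (g *m A *m invmx g) = rho g *m pow_vec A.
Proof.
move=> ug; rewrite trep_avec; apply: eq_avec => i.
elim: (i : nat) => [|j IHj]; first by rewrite !expr0 mulmx1 mulmxV.
by rewrite !exprS -!mulmxE IHj !mulmxA mulmxKV.
Qed.

Lemma pow_vec_diag d : pow_vec (diag_mx d) = avec (fun i => diag_mx (\row_q d 0 q ^+ i)).
Proof.
apply: eq_avec => i; elim: (i : nat) => [|j IHj].
  by rewrite expr0; apply/matrixP => p q; rewrite !mxE expr0.
rewrite exprS IHj -mulmxE mul_diag_mx; apply/matrixP => p q; rewrite !mxE exprS.
by rewrite mulrnAr.
Qed.

Lemma pow_vec_mem (P : 'M[C]_n.+1) d : P *m ctr P = 1%:M -> V (pow_vec (ctr P *m diag_mx d *m P)).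
Proof.
move=> PP; have [uP _] := mulmx1_unit PP.
have iP : invmx P = ctr P by rewrite -[RHS]mul1mx -(mulVmx uP) -mulmxA PP mulmx1.
rewrite -iP -{2}[P]invmxK pow_vec_conj ?unitmx_inv //.
apply: orbit_span_GL; rewrite ?unitmx_inv // pow_vec_diag.
by apply: diag_family_mem; apply/rowP => q; rewrite !mxE expr0.
Qed.

End PowersInModel.

(** * The subdiscriminant as a squared norm *)

Section Subdiscriminant.
Variable R : realType.
Local Notation C := R[i].

Definition vander_sq m n (ev : 'I_n -> R) (b : 'I_m -> 'I_n) : R :=
  \prod_(i < m) \prod_(j < m | (i < j)%N) (ev (b j) - ev (b i)) ^+ 2.

Lemma prod_pairs_sqr m (h : 'I_m -> 'I_m -> R) (S : {set 'I_m}) :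
  (forall i j, h i j = h j i) ->
  (\prod_(i in S) \prod_(j in S | (i < j)%N) h i j) ^+ 2 =
  \prod_(i in S) \prod_(j in S | j != i) h i j.
Proof.
move=> hs; rewrite expr2.
have {2}-> : \prod_(i in S) \prod_(j in S | (i < j)%N) h i j =
    \prod_(i in S) \prod_(j in S | (j < i)%N) h i j.
  rewrite (exchange_big_dep (mem S)) //= => [|i j _ /andP[] //].
  apply: eq_bigr => j Sj; rewrite Sj; apply: eq_big => [i|i _]; last exact: hs.
  by [].
rewrite -big_split; apply: eq_bigr => i Si /=.
rewrite [RHS](bigID (fun j : 'I_m => (i < j)%N)) /=; congr (_ * _);
  apply: eq_bigl => j; rewrite -andbA; congr (_ && _); rewrite -val_eqE /= neq_ltn; by case: ltngtP.
Qed.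

(** [b] need not be increasing, so pairs [i < j] do not map to pairs [s < t]. Both sides are
    nonnegative and their squares are products over all ordered pairs of distinct elements, where
    order is irrelevant. *)
Lemma vander_sq_image m n (ev : 'I_n -> R) (b : 'I_m -> 'I_n) (S : {set 'I_n}) :
  injective b -> b @: [set: 'I_m] = S ->
  vander_sq ev b = \prod_(s in S) \prod_(t in S | (s < t)%N) (ev s - ev t) ^+ 2.
Proof.
move=> bI bS; pose h p q := (ev p - ev q) ^+ 2.
have hs p q : h p q = h q p by rewrite /h -sqrrN opprB.
have p0 (I J : finType) (P : pred I) (Q : I -> pred J) (F : I -> J -> R) :
    0 <= \prod_(i | P i) \prod_(j | Q i j) F i j ^+ 2.
  by apply: prodr_ge0 => i _; apply: prodr_ge0 => j _; exact: sqr_ge0.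
apply/eqP; rewrite -(@eqrXn2 _ 2) ?p0 //; apply/eqP.
have -> : vander_sq ev b = \prod_(i in [set: 'I_m]) \prod_(j in [set: 'I_m] | (i < j)%N) h (b i) (b j).
  by apply: eq_big => i; rewrite ?inE // => _; apply: eq_big => j; rewrite ?inE.
rewrite (prod_pairs_sqr _ (fun i j => hs (b i) (b j))) (prod_pairs_sqr _ hs) -bS.
rewrite big_imset /=; last by move=> x y _ _; exact: bI.
apply: eq_bigr => i _; rewrite big_imset_cond /=; last by move=> x y _ _; exact: bI.
by apply: eq_bigl => j; rewrite (inj_eq bI).
Qed.

Lemma vander_sq_noninj m n (ev : 'I_n -> R) (b : 'I_m -> 'I_n) :
  ~~ injectiveb b -> vander_sq ev b = 0.
Proof.
move=> /injectivePn [i [j ij e]]; rewrite /vander_sq.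
wlog lt_ij : i j ij e / (i < j)%N.
  move=> W; have [lt|gt|/val_inj eq] := ltngtP i j; first exact: (W i j).
    by apply: (W j i) => //; rewrite eq_sym.
  by rewrite eq eqxx in ij.
by rewrite (bigD1 i) //= (bigD1 j) //= e subrr expr0n !mul0r.
Qed.

(** Noninjective [b] contribute nothing, and each subset of size [r] is the image of [r]!
    injections. *)
Lemma sum_vander_sq n k r (ev : 'I_n -> R) : (n - k = r)%N ->
  \sum_(b : {ffun 'I_r -> 'I_n}) vander_sq ev b = r`!%:R * sdisc_val k ev.
Proof.
move=> nkr; rewrite (bigID (fun b : {ffun 'I_r -> 'I_n} => injectiveb b)) /=.
rewrite [X in _ + X]big1 ?addr0 => [|b]; last exact: vander_sq_noninj.
rewrite (partition_big (fun b : {ffun 'I_r -> 'I_n} => b @: [set: 'I_r])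
  (fun S => #|S| == (n - k)%N)) /=; last first.
  by move=> b /injectiveP bI; rewrite card_imset // cardsT card_ord nkr.
rewrite /sdisc_val big_distrr; apply: eq_bigr => S /eqP cS /=.
rewrite (eq_bigr (fun _ => \prod_(s in S) \prod_(t in S | (s < t)%N) (ev s - ev t) ^+ 2)); last first.
  by move=> b /andP[/injectiveP bI /eqP bS]; exact: vander_sq_image.
rewrite sumr_const -[LHS]mulr_natl; congr (_%:R * _).
have -> : r`! = #|[set f : {ffun 'I_r -> 'I_n} in ffun_on (mem S) | injectiveb f]|.
  by rewrite card_inj_ffuns_on card_ord cS nkr ffactnn.
apply: eq_card => b; rewrite [RHS]inE [LHS]inE [RHS]andbC; case: (boolP (injectiveb b)) => //=.
move=> /injectiveP bI; apply/eqP/ffun_onP => [<- j|h]; first by rewrite imset_f ?inE.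
apply/eqP; rewrite eqEcard card_imset // cardsT card_ord cS nkr leqnn andbT.
by apply/subsetP => p /imsetP[j _ ->]; exact: h.
Qed.

Lemma sdisc_val_neq0 n k (ev : 'I_n -> R) : injective ev -> sdisc_val k ev != 0.
Proof.
move=> evI; apply/eqP => s0; have := sum_vander_sq ev (erefl (n - k)%N).
rewrite s0 mulr0 => /eqP; rewrite psumr_eq0 => [/allP h|b _]; last first.
  by apply: prodr_ge0 => i _; apply: prodr_ge0 => j _; exact: sqr_ge0.
have := h [ffun i => widen_ord (leq_subr k n) i] (mem_index_enum _).
apply/negP/prodf_neq0 => i _; apply/prodf_neq0 => j ij.
by rewrite sqrf_eq0 subr_eq0 !ffunE (inj_eq evI) -val_eqE /= gtn_eqF.
Qed.

Lemma sdisc_val_perm n k (ev : 'I_n -> R) (s : 'S_n) :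
  sdisc_val k (ev \o s) = sdisc_val k ev.
Proof.
pose r := (n - k)%N.
have r0 : r`!%:R != 0 :> R by rewrite pnatr_eq0 -lt0n fact_gt0.
apply: (mulfI r0); rewrite -!sum_vander_sq //.
rewrite [RHS](reindex (fun b : {ffun 'I_r -> 'I_n} => [ffun j => s (b j)])) /=.
  by apply: eq_bigr => b _; apply: eq_bigr => i _; apply: eq_bigr => j _; rewrite !ffunE.
exists (fun b : {ffun 'I_r -> 'I_n} => [ffun j => (s^-1)%g (b j)]) => b _;
  by apply/ffunP => j; rewrite !ffunE ?permK ?permKV.
Qed.

Lemma char_poly_conj n (P Q A : 'M[C]_n) : Q *m P = 1%:M ->
  char_poly (Q *m A *m P) = char_poly A.
Proof.
move=> QP; have PQ := mulmx1C QP.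
have E : char_poly_mx (Q *m A *m P) = map_mx polyC Q *m char_poly_mx A *m map_mx polyC P.
  rewrite /char_poly_mx mulmxBr mulmxBl !map_mxM; congr (_ - _).
  by rewrite scalar_mxC -mulmxA -map_mxM QP map_mx1 mulmx1.
rewrite /char_poly E !det_mulmx mulrAC -det_mulmx -map_mxM QP map_mx1 det1 mul1r //.
Qed.

Lemma char_poly_diag n (d : 'rV[C]_n) :
  char_poly (diag_mx d) = \prod_i ('X - (d 0 i)%:P).
Proof.
rewrite char_poly_trig; last by apply/is_trig_mxP => i j ij; rewrite !mxE -val_eqE ltn_eqF.
by apply: eq_bigr => i _; rewrite mxE eqxx mulr1n.
Qed.

Lemma eigenvalues_unique n (e ev : 'I_n -> R) :
  \prod_i ('X - ((e i)%:C)%C%:P) = \prod_i ('X - ((ev i)%:C)%C%:P) :> {poly C} ->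
  exists s : 'S_n, e =1 ev \o s.
Proof.
move=> E; pose f x : C := (x%:C)%C.
have pf : perm_eq (map f [tuple e i | i < n]) (map f [tuple ev i | i < n]).
  by apply: prod_XsubC_eq; rewrite !big_map.
have /tuple_permP [s es] := perm_map_inj (@complexI R) pf.
exists s => i; have /(congr1 (fun t => nth (e i) t i)) := es.
by rewrite -[LHS]tnth_nth -[RHS]tnth_nth !tnth_mktuple.
Qed.

Variables (n r k : nat).
Hypothesis rkn : (r + k = n)%N.
Local Notation idx := {ffun 'I_r.+1 -> 'I_n.+1}.

(** For each [a] at most one permutation [s] carries it to the injective [b], so the inner sum is 0
    or a sign; conversely each [s] determines one [a]. *)
Lemma sqr_norm_altsym_sign (b : idx) : injectiveb b ->
  \sum_(a : idx) `|\sum_(s : 'S_r.+1) (-1) ^+ s * (b == [ffun j => a (s j)])%:R : C| ^+ 2 = (r.+1)`!%:R.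
Proof.
move=> /injectiveP bI.
have -> : \sum_(a : idx) `|\sum_(s : 'S_r.+1) (-1) ^+ s * (b == [ffun j => a (s j)])%:R : C| ^+ 2 =
  \sum_(a : idx) \sum_(s : 'S_r.+1) (b == [ffun j => a (s j)])%:R.
  apply: eq_bigr => a _.
  have [|no] := boolP [exists s : 'S_r.+1, b == [ffun j => a (s j)]]; last first.
    have h (s : 'S_r.+1) : (b == [ffun j => a (s j)]) = false.
      by apply/negbTE; move: no => /existsPn /(_ s).
    under eq_bigr => s _ do rewrite h mulr0.
    under [RHS]eq_bigr => s _ do rewrite h.
    by rewrite !big1_eq normr0 expr0n.
  move=> /existsP [s0 /eqP e0].
  have h s : s != s0 -> (b == [ffun j => a (s j)]) = false.
    move=> ns; apply/negbTE; apply: contra ns => /eqP e; apply/eqP/permP => j.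
    have aI i i' : a i = a i' -> i = i'.
      move=> aa; apply: (@perm_inj _ s0^-1%g); apply: bI.
      by rewrite e0 !ffunE !permKV.
    by apply: aI; have := congr1 (fun c : idx => c j) e; rewrite e0 !ffunE.
  rewrite (bigD1 s0) //= big1 => [|s /h ->]; last by rewrite mulr0.
  rewrite [RHS](bigD1 s0) //= [X in _ = _ + X]big1 => [|s /h -> //].
  by rewrite -e0 eqxx mulr1 !addr0 normrX normrN1 !expr1n.
rewrite exchange_big /= (eq_bigr (fun=> 1)) => [|s _].
  by rewrite sumr_const card_Sn.
rewrite (bigD1 [ffun j => b (s^-1%g j)]) //= big1 => [|a na].
  by rewrite (_ : b == _) ?addr0 //; apply/eqP/ffunP => j; rewrite !ffunE permK.
rewrite (_ : (b == _) = false) //; apply/negbTE; apply: contra na => /eqP ->.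
by apply/eqP/ffunP => j; rewrite !ffunE permKV.
Qed.

Lemma trep_unitary_norm (P : 'M[C]_n.+1) (w : 'cV[C]_#|{: (idx * idx)%type}|) :
  P *m ctr P = 1%:M -> ctr (trep r.+1 P *m w) *m (trep r.+1 P *m w) = ctr w *m w.
Proof.
move=> PP; have [uP uP'] := mulmx1_unit PP.
rewrite ctrM -trep_ctr -mulmxA [trep _ (ctr P) *m _]mulmxA -trepM // (mulmx1C PP).
by rewrite trep1 mul1mx.
Qed.

(** Unitary conjugation preserves the norm, so [A] may be diagonal. Entries are then Vandermonde
    determinants in [b] times signs; the sums over [a] and over [b] give one factorial each. *)
Lemma pow_vec_norm (P A : 'M[C]_n.+1) (e : 'I_n.+1 -> R) :
  P *m ctr P = 1%:M -> A = ctr P *m diag_mx (\row_i ((e i)%:C)%C) *m P ->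
  (ctr (pow_vec r A) *m pow_vec r A) 0 0 = (((r.+1)`!%:R ^+ 2 * sdisc_val k e)%:C)%C.
Proof.
move=> PP AE; have [uP _] := mulmx1_unit PP.
have iP : invmx P = ctr P by rewrite -[RHS]mul1mx -(mulVmx uP) -mulmxA PP mulmx1.
have -> : pow_vec r A = trep r.+1 (ctr P) *m pow_vec r (diag_mx (\row_i ((e i)%:C)%C)).
  have uiP : invmx P \in unitmx by rewrite unitmx_inv.
  by rewrite AE -iP -{2}[P]invmxK (pow_vec_conj r _ uiP).
have PP' : ctr P *m ctr (ctr P) = 1%:M by rewrite ctrK (mulmx1C PP).
rewrite (trep_unitary_norm (pow_vec r (diag_mx (\row_i ((e i)%:C)%C))) PP').
rewrite ctr_sqr pow_vec_diag.
under eq_bigr => i _ do rewrite mxE.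
rewrite (@sum_tidx R n.+1 r.+1 (fun x => `|altsym _ x.1 x.2| ^+ 2)).
rewrite -(pair_bigA _ (fun b a : idx => `|altsym (fun i : 'I_r.+1 =>
  diag_mx (\row_q ((\row_i0 ((e i0)%:C)%C) 0 q ^+ i))) b a| ^+ 2)) /=.
have dE (b : idx) : detw (fun i : 'I_r.+1 => \row_q ((\row_i0 ((e i0)%:C)%C) 0 q ^+ i)) b
    = ((\prod_(i < r.+1) \prod_(j < r.+1 | (i < j)%N) (e (b j) - e (b i)))%:C)%C.
  transitivity (\det (Vandermonde r.+1 (\row_j ((e (b j))%:C)%C))).
    by congr (\det _); apply/matrixP => i j; rewrite !mxE.
  rewrite det_Vandermonde [RHS]rmorph_prod; apply: eq_bigr => i _.
  by rewrite [RHS]rmorph_prod; apply: eq_bigr => j _; rewrite !mxE rmorphB.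
have dN (b : idx) : `|detw (fun i : 'I_r.+1 => \row_q ((\row_i0 ((e i0)%:C)%C) 0 q ^+ i)) b| ^+ 2
    = ((vander_sq e b)%:C)%C.
  rewrite dE real_normK; last by apply/complex_realP; eexists.
  rewrite -rmorphXn; congr (_%:C)%C; rewrite -prodrXl; apply: eq_bigr => i _.
  by rewrite -prodrXl.
transitivity (\sum_(b : idx) ((vander_sq e b)%:C)%C * (r.+1)`!%:R).
  apply: eq_bigr => b _.
  under eq_bigr => a _ do rewrite altsym_diag normrM exprMn dN.
  rewrite -big_distrr /=; have [bI|nbI] := boolP (injectiveb b).
    by rewrite sqr_norm_altsym_sign.
  by rewrite vander_sq_noninj // !mul0r.
rewrite -big_distrl /= -(rmorph_sum (real_complex R)) (@sum_vander_sq _ k); last by lia.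
by rewrite rmorphM rmorph_nat mulrAC -expr2 [RHS]rmorphM rmorphXn rmorph_nat.
Qed.

End Subdiscriminant.

(** * Polynomials on Hermitian matrices *)

Section VanishingPolynomials.
Variable R : realType.
Local Notation C := R[i].

Lemma poly_nonroot (p : {poly R}) : p != 0 -> exists t, p.[t] != 0.
Proof.
move=> p0; pose s : seq R := [seq i%:R | i <- iota 0 (size p)].
have us : uniq s.
  by rewrite map_inj_uniq ?iota_uniq // => i j /eqP; rewrite eqr_nat => /eqP.
have : ~~ all (root p) s.
  by apply/negP => /(max_poly_roots p0) /(_ us); rewrite size_map size_iota ltnn.
by rewrite -has_predC => /hasP[t _ rt]; exists t.
Qed.

Lemma base_expansion_inj B N (f g : 'I_N -> nat) :
  (forall i, f i < B)%N -> (forall i, g i < B)%N ->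
  (\sum_i f i * B ^ i = \sum_i g i * B ^ i)%N -> f =1 g.
Proof.
elim: N f g => [|N IHN] f g fB gB; first by move=> _ [].
have E (h : 'I_N.+1 -> nat) : (\sum_i h i * B ^ i =
    (\sum_(i < N) h (lift ord0 i) * B ^ i) * B + h ord0)%N.
  rewrite big_ord_recl expn0 muln1 big_distrl addnC; congr (_ + _)%N.
  by apply: eq_bigr => i _; rewrite /= /bump add1n expnSr mulnA.
rewrite !E => e; have B0 : (0 < B)%N := leq_ltn_trans (leq0n _) (fB ord0).
have e0 : f ord0 = g ord0.
  by have := congr1 (modn^~ B) e; rewrite /= !modnMDl !modn_small.
move: e; rewrite e0 => /addIn /eqP; rewrite eqn_pmul2r // => /eqP e i.
by case: (unliftP ord0 i) => [j|] -> //; apply: (IHN _ _ _ _ e).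
Qed.

(* Kronecker's substitution. *)
Lemma mpoly_eq0 N (p : {mpoly R[N]}) : (forall v, p.@[v] = 0) -> p = 0.
Proof.
move=> p0; pose B := msize p.
pose K (m : 'X_{1..N}) := (\sum_i m i * B ^ i)%N.
pose q : {poly R} := \sum_(m <- msupp p) p@_m *: 'X ^+ K m.
have q0 : q = 0.
  apply/eqP/negPn/negP => /poly_nonroot [t] /eqP; apply.
  rewrite -(p0 (fun i => t ^+ (B ^ i))) mevalE horner_sum; apply: eq_bigr => m _.
  rewrite hornerZ hornerXn -prodrXr; congr (_ * _); apply: eq_bigr => i _.
  by rewrite mulnC exprM.
have mB m i : m \in msupp p -> (m i < B)%N.
  move=> mp; apply: leq_ltn_trans (msize_mdeg_lt mp).
  by rewrite mdegE (bigD1 i) //= leq_addr.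
apply/mpolyP => m; rewrite mcoeff0; apply/eqP; rewrite mcoeff_eq0; apply/negP => mp.
have := congr1 (fun u : {poly R} => u`_(K m)) q0; rewrite coef0 coef_sum.
rewrite (bigD1_seq m) ?msupp_uniq //= coefZ coefXn eqxx mulr1 big1_seq => [|m' /andP[nm m'p]].
  by rewrite addr0 => /eqP; rewrite mcoeff_eq0 mp.
rewrite coefZ coefXn (_ : (_ == _) = false) ?mulr0 //; apply/negbTE; apply: contra nm => /eqP e.
apply/eqP/mnmP => i; apply: (@base_expansion_inj B N m' m) => // j; exact: mB.
Qed.

Section HermitianPolynomials.
Variable n : nat.

Definition herm_of_coords (M : 'M[R]_n) : 'M[C]_n := \matrix_(i, j)
  if (i < j)%N then Complex (M i j) (- M j i)
  else if (j < i)%N then Complex (M j i) (M i j) else ((M i j)%:C)%C.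

Lemma herm_of_coords_herm M : is_hermitian (herm_of_coords M).
Proof.
apply/eqP/matrixP => i j; rewrite !mxE; case: ltngtP => ij /=; rewrite ?opprK //.
by rewrite (val_inj ij) oppr0.
Qed.

Lemma herm_of_coordsK M : her_coords (herm_of_coords M) = M.
Proof.
by apply/matrixP => i j; rewrite !mxE; case: ltngtP. Qed.

Lemma heval_eq0 (p : {mpoly R[n * n]}) : (forall A, is_hermitian A -> heval p A = 0) -> p = 0.
Proof.
move=> h; apply: mpoly_eq0 => v.
have := h _ (herm_of_coords_herm (vec_mx (\row_t v t))).
rewrite /heval herm_of_coordsK vec_mxK => <-; apply: meval_eq => t.
by rewrite mxE.
Qed.

Lemma heval_inj (p q : {mpoly R[n * n]}) :
  (forall A, is_hermitian A -> heval p A = heval q A) -> p = q.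
Proof.
move=> h; apply/eqP; rewrite -subr_eq0; apply/eqP/heval_eq0 => A hA.
by rewrite /heval mevalB -!/(heval _ _) h // subrr.
Qed.

Lemma her_coords_line (A B : 'M[C]_n) (t : R) :
  her_coords (A + (t%:C)%C *: B) = her_coords A + t *: her_coords B.
Proof.
apply/matrixP => i j; rewrite !mxE; case: (A i j) (B i j) => [a b] [c d] /=.
by case: ifP; rewrite /= !mul0r ?subr0 ?addr0.
Qed.

Lemma size_prod_leq_sum (I : finType) (F : I -> {poly R}) (m : I -> nat) :
  (forall i, (size (F i) <= (m i).+1)%N) -> (size (\prod_i F i)%R <= (\sum_i m i).+1)%N.
Proof.
move=> h; elim/big_rec2: _ => [|i d f _ IH]; first by rewrite size_poly1.
by apply: leq_trans (size_polyMleq _ _) _; have := h i; lia.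
Qed.

Lemma heval_line d (p : {mpoly R[n * n]}) (A B : 'M[C]_n) : p \is d.-homog ->
  exists2 q : {poly R}, (size q <= d.+1)%N & forall t, q.[t] = heval p (A + (t%:C)%C *: B).
Proof.
move=> /dhomogP hp; pose a := mxvec (her_coords A); pose b := mxvec (her_coords B).
exists (\sum_(m <- msupp p) p@_m *: \prod_i ((a 0 i)%:P + b 0 i *: 'X) ^+ m i).
  apply: (leq_trans (size_sum _ _ _)); apply/bigmax_leqP_seq => m mp _.
  apply: leq_trans (size_scale_leq _ _) _.
  have mE : mdeg m = d := hp m mp; rewrite -mE mdegE; apply: size_prod_leq_sum => i.
  apply: leq_trans (size_poly_exp_leq _ _) _; rewrite ltnS.
  have : (size ((a 0 i)%:P + b 0 i *: 'X)%R <= 2)%N.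
    apply: leq_trans (size_polyD _ _) _; rewrite geq_max (leq_trans (size_polyC_leq1 _)) //.
    by rewrite (leq_trans (size_scale_leq _ _)) // size_polyX.
  by case: (size _) => [|[|[|]]] //= _; rewrite ?mul0n ?mul1n.
move=> t; rewrite /heval mevalE horner_sum; apply: eq_bigr => m _.
rewrite hornerZ horner_prod; congr (_ * _); apply: eq_bigr => i _.
rewrite horner_exp hornerD hornerC hornerZ hornerX her_coords_line; congr (_ ^+ _).
by rewrite linearD linearZ /= !mxE mulrC.
Qed.

End HermitianPolynomials.

Lemma hermitian_spectral n (A : 'M[C]_n) : is_hermitian A ->
  exists P (e : 'I_n -> R), P *m ctr P = 1%:M /\
    A = ctr P *m diag_mx (\row_i ((e i)%:C)%C) *m P.
Proof.
move=> /eqP hA.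
have hAh : A \is hermsymmx.
  apply/is_hermitianmxP; rewrite expr0 scale1r; apply/matrixP => i j.
  by have := congr1 (fun M : 'M_n => M j i) hA; rewrite !mxE => <-.
have PP := unitarymx_ctr (spectral_unitarymx A).
have iP : invmx (spectralmx A) = ctr (spectralmx A).
  by rewrite (invmx_unitary (spectral_unitarymx A)) -map_trmx.
have /orthomx_spectralP AE := hermitian_normalmx hAh.
have /mxOverP dr := hermitian_spectral_diag_real hAh.
exists (spectralmx A), (fun i => complex.Re (spectral_diag A 0 i)); split; first exact: PP.
have -> : \row_i ((complex.Re (spectral_diag A 0 i))%:C)%C = spectral_diag A.
  by apply/rowP => i; rewrite mxE RRe_real.
by rewrite -iP.
Qed.

Lemma hermitian_diag n (P : 'M[C]_n) (e : 'I_n -> R) :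
  is_hermitian (ctr P *m diag_mx (\row_i ((e i)%:C)%C) *m P).
Proof.
apply/eqP; apply: trmx_inj; rewrite trmxK -/(ctr _) !ctrM ctrK mulmxA; congr (_ *m _ *m _).
apply/matrixP => i j; rewrite ctrE !mxE (eq_sym j i); case: (eqVneq i j) => [->|_].
  by rewrite !mulr1n conjc_real.
by rewrite !mulr0n conjc0.
Qed.

(* A direction [mu = theta^a] along which the hyperplanes [x_a = x_b] are crossed at
   pairwise distinct times. *)
Lemma generic_direction N (x : 'I_N -> R) : injective x ->
  exists mu : 'I_N -> R,
    (forall a b : 'I_N, (a < b)%N -> mu a != mu b) /\
    (forall a b c d : 'I_N, (a < b)%N -> (c < d)%N -> (a, b) != (c, d) ->
       (x a - x b) * (mu c - mu d) != (x c - x d) * (mu a - mu b)).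
Proof.
move=> xI.
pose F1 (p : 'I_N * 'I_N) : {poly R} := 'X^(p.1) - 'X^(p.2).
pose F2 (p q : 'I_N * 'I_N) : {poly R} := (x p.1 - x p.2) *: F1 q - (x q.1 - x q.2) *: F1 p.
have x0 a b : a != b -> x a - x b != 0 by rewrite subr_eq0 (inj_eq xI).
have F10 (p : 'I_N * 'I_N) : (p.1 < p.2)%N -> F1 p != 0.
  move=> lt; apply/eqP => /(congr1 (fun q : {poly R} => q`_p.1)).
  rewrite coefB !coefXn eqxx ltn_eqF // subr0 coef0 => /eqP; exact/negP/oner_neq0.
have F20 (p q : 'I_N * 'I_N) : (p.1 < p.2)%N -> (q.1 < q.2)%N -> p != q -> F2 p q != 0.
  move=> ltp ltq npq.
  have cF (j : nat) : (F2 p q)`_j = (x p.1 - x p.2) * ((j == q.1)%:R - (j == q.2)%:R)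
      - (x q.1 - x q.2) * ((j == p.1)%:R - (j == p.2)%:R).
    by rewrite coefB !coefZ !coefB !coefXn.
  have nq : q.1 != q.2 by rewrite -val_eqE /= ltn_eqF.
  have [h|h] : (q.1 != p.1 /\ q.2 != p.1) \/ (q.1 != p.2 /\ q.2 != p.2).
    move: p q ltp ltq npq {cF nq} => [a b] [c d] /= ab cd; rewrite xpair_eqE -!val_eqE /=; lia.
  - apply/eqP => /(congr1 (fun u : {poly R} => u`_p.1)); rewrite cF coef0 eqxx.
    case: h; rewrite -!val_eqE /= !(eq_sym (p.1 : nat)) => /negPf -> /negPf ->.
    rewrite (gtn_eqF ltp) subrr mulr0 subr0 mulr1 sub0r => /eqP.
    by rewrite oppr_eq0 (negPf (x0 _ _ nq)).
  - apply/eqP => /(congr1 (fun u : {poly R} => u`_p.2)); rewrite cF coef0 eqxx.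
    case: h; rewrite -!val_eqE /= !(eq_sym (p.2 : nat)) => /negPf -> /negPf ->.
    rewrite (ltn_eqF ltp) subrr mulr0 sub0r sub0r mulrN1 opprK => /eqP.
    by rewrite (negPf (x0 _ _ nq)).
have [|th] := @poly_nonroot (\prod_(p : 'I_N * 'I_N | (p.1 < p.2)%N) F1 p *
  \prod_(p : 'I_N * 'I_N | (p.1 < p.2)%N)
     \prod_(q : 'I_N * 'I_N | (q.1 < q.2)%N && (p != q)) F2 p q).
  rewrite mulf_neq0 //; first exact/prodf_neq0.
  by apply/prodf_neq0 => p lp; apply/prodf_neq0 => q /andP[lq npq]; exact: F20.
rewrite hornerM mulf_eq0 negb_or !horner_prod => /andP[/prodf_neq0 h1 /prodf_neq0 h2].
exists (fun a => th ^+ a); split=> [a b ab|a b c d ab cd npq].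
  by have := h1 (a, b) ab; rewrite /F1 hornerD hornerN !hornerXn subr_eq0.
have := h2 (a, b) ab; rewrite horner_prod => /prodf_neq0 /(_ (c, d)).
rewrite /= cd npq /F2 /F1 /= hornerD hornerN !hornerZ !hornerD !hornerN !hornerXn subr_eq0.
by apply.
Qed.

Lemma card_ltn_pairs N : #|[pred p : 'I_N * 'I_N | (p.1 < p.2)%N]| = 'C(N, 2).
Proof.
rewrite -sum1_card -(pair_big_dep xpredT (fun a b : 'I_N => (a < b)%N) (fun _ _ => 1%N)) /=.
rewrite (exchange_big_dep xpredT) //= -bin2_sum big_mkord; apply: eq_bigr => b _.
by rewrite -(big_ord_widen _ (fun=> 1%N)) 1?ltnW // sum1_card card_ord.
Qed.

Lemma noninjective_factor N (x : 'I_N.+1 -> R) a b : a != b -> x a = x b ->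
  exists (h : 'I_N.+1 -> 'I_N) (y : 'I_N -> R), x =1 y \o h.
Proof.
move=> ab xab; have [j bj _] := unlift_some ab.
exists (fun i => if unlift a i is Some l then l else j), (fun l => x (lift a l)) => i /=.
by case: unliftP => [l ->|->] //; rewrite -bj.
Qed.

(** The eigenvector matrix [P] stays fixed and only eigenvalues vary, so the induction takes place
    on a real linear family of commuting Hermitian matrices. *)
Lemma stratum_ideal_low_degree n r k d (p : {mpoly R[n.+1 * n.+1]}) :
  (n.+1 - k - 1 = r)%N -> (0 < r)%N -> (d < 'C(r.+1, 2))%N -> p \is d.-homog ->
  in_vanishing_ideal (@Her_stratum R n.+1 k) p -> p = 0.
Proof.
move=> nkr r0 dr hp vp; apply: heval_eq0 => A /hermitian_spectral [P [e [PP ->]]].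
have [uP _] := mulmx1_unit PP.
have iP : invmx P = ctr P by rewrite -[RHS]mul1mx -(mulVmx uP) -mulmxA PP mulmx1.
pose D (c : 'I_n.+1 -> R) := ctr P *m diag_mx (\row_i ((c i)%:C)%C) *m P.
have DE c c' : c =1 c' -> D c = D c'.
  by move=> cc; rewrite /D; congr (_ *m diag_mx _ *m _); apply/rowP => i; rewrite !mxE cc.
(* [N] bounds the number of distinct eigenvalues and [blk] tells which one each eigenvector gets;
   [N = n.+1] covers every spectrum. *)
suff H N : (r <= N)%N -> forall (blk : 'I_n.+1 -> 'I_N) (x : 'I_N -> R), heval p (D (x \o blk)) = 0.
  rewrite -/(D e); have [rn|nr] := leqP r n.+1; first exact: (H n.+1 rn id e).
  by exfalso; move: nkr nr; lia.
elim: N => [|N IHN]; first by rewrite leqn0 => /eqP r00; rewrite r00 in r0.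
rewrite leq_eqVlt => /predU1P[rN|rN] blk x.
  apply: vp; split; first exact: hermitian_diag.
  rewrite /minpoly_deg nkr rN.
  have dv : mxminpoly (D (x \o blk)) %| \prod_(a < N.+1) ('X - ((x a)%:C)%C%:P).
    apply: mxminpoly_min; rewrite /D -iP horner_mx_uconjC //.
    rewrite horner_mx_diag (_ : map_mx _ _ = 0) ?(raddf0 diag_mx) ?mulmx0 ?mul0mx //.
    apply/rowP => i; rewrite !mxE horner_prod (bigD1 (blk i)) //=.
    by rewrite hornerXsubC subrr mul0r.
  have := dvdp_leq (monic_neq0 (monic_prod_XsubC _ _ _)) dv; rewrite size_prod_XsubC.
  have -> : size (index_enum 'I_N.+1) = N.+1 by rewrite -[RHS]card_ord cardE enumT.
  by case: (size _).
have [/injectiveP xI|/injectivePn [a [b ab xab]]] := boolP (injectiveb x); last first.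
  have [h [y xy]] := noninjective_factor ab xab.
  by rewrite (DE _ (y \o (h \o blk))) ?IHN // => i; rewrite /= xy.
have [mu [mu1 mu2]] := generic_direction xI.
have [q sq qE] := heval_line (D (x \o blk)) (D (mu \o blk)) hp.
have lineE t : q.[t] = heval p (D ((fun a => x a + t * mu a) \o blk)).
  rewrite qE; congr heval; rewrite /D scalemxAl scalemxAr -mulmxDl -mulmxDr.
  congr (_ *m _ *m _); rewrite -linearZ -linearD; congr diag_mx; apply/rowP => i.
  by rewrite !mxE rmorphD rmorphM.
suff q0 : q = 0 by rewrite -(DE _ _ (fun i => addr0 _)) -[RHS](horner0 0) -q0 lineE; congr heval; apply: DE => i /=; rewrite mul0r.
(* The time at which the two moving eigenvalues collide; there [IHN] applies, so each such time is a
   root of [q]. *)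
pose T (pr : 'I_N.+1 * 'I_N.+1) := (x pr.1 - x pr.2) / (mu pr.2 - mu pr.1).
pose s := [seq T pr | pr <- enum [pred pr : 'I_N.+1 * 'I_N.+1 | (pr.1 < pr.2)%N]].
have m0 (pr : 'I_N.+1 * 'I_N.+1) : (pr.1 < pr.2)%N -> mu pr.2 - mu pr.1 != 0.
  by move=> lt; rewrite subr_eq0 eq_sym mu1.
apply/eqP/negPn/negP => q0.
have : (size s < size q)%N.
  apply: max_poly_roots => //.
    apply/allP => t /mapP[pr]; rewrite mem_enum inE => lt ->.
    rewrite rootE lineE; set y := fun a : 'I_N.+1 => _.
    have ne : pr.1 != pr.2 by rewrite -val_eqE ltn_eqF.
    have yy : y pr.1 = y pr.2.
      by apply/eqP; rewrite -subr_eq0; apply/eqP; rewrite /y /T; field; exact: m0.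
    have [h [z yz]] := noninjective_factor ne yy.
    by rewrite (DE _ (z \o (h \o blk))) ?IHN // => i; rewrite /= yz.
  rewrite map_inj_in_uniq ?enum_uniq // => p1 p2; rewrite !mem_enum !inE => l1 l2 /eqP.
  rewrite /T eqr_div ?m0 // => /eqP e12; apply/eqP/negPn/negP => ne.
  move: p1 p2 l1 l2 e12 ne => [a1 b1] [a2 b2] /= l1 l2 e12 ne.
  have /eqP := mu2 _ _ _ _ l1 l2 ne; apply.
  by apply: oppr_inj; rewrite -!mulrN !opprB.
rewrite size_map -cardE card_ltn_pairs => h.
have := leq_trans h sq; rewrite ltnS leqNgt => /negP; apply.
by apply: leq_trans dr _; apply: leq_bin2l.
Qed.

End VanishingPolynomials.

(** * Complex-valued forms on Hermitian matrices *)

Section HermitianPolynomialFunctions.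
Variable R : realType.
Local Notation C := R[i].
Variable n : nat.

Definition herm_poly d (F : 'M[C]_n -> C) := exists p q : {mpoly R[n * n]},
  [/\ p \is d.-homog, q \is d.-homog &
      forall A, is_hermitian A -> F A = Complex (heval p A) (heval q A)].

Lemma heval_coord (i j : 'I_n) (A : 'M[C]_n) :
  heval 'X_(mxvec_index i j) A = her_coords A i j.
Proof. by rewrite /heval mevalXU mxvecE. Qed.

Lemma hermitianE (A : 'M[C]_n) i j : is_hermitian A -> A j i = conjc (A i j).
Proof. by move=> /eqP /(congr1 (fun M : 'M_n => M i j)); rewrite !mxE. Qed.

Lemma herm_poly_entry i j : herm_poly 1 (fun A => A i j).
Proof.
have X1 a b : ('X_(mxvec_index a b) : {mpoly R[n * n]}) \is 1.-homog.
  by rewrite dhomogX; apply/eqP; exact: mdeg1.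
have [ij|ji|/val_inj ->] := ltngtP i j.
- exists 'X_(mxvec_index i j), (- 'X_(mxvec_index j i)); split; rewrite ?dhomogN ?X1 //.
  move=> A hA; rewrite [heval (- _) A]mevalN -/(heval _ _) !heval_coord !mxE.
  rewrite ltnW // leqNgt ij /= (hermitianE i j hA).
  by case: (A i j) => a b /=; rewrite opprK.
- exists 'X_(mxvec_index j i), 'X_(mxvec_index i j); split; rewrite ?X1 //.
  move=> A hA; rewrite !heval_coord !mxE.
  rewrite ltnW // leqNgt ji /= (hermitianE i j hA).
  by case: (A i j) => a b /=.
- exists 'X_(mxvec_index j j), 0; split; rewrite ?X1 ?dhomog0 //.
  move=> A hA; rewrite [heval 0 A]meval0 !heval_coord !mxE leqnn.
  have := hermitianE j j hA; case: (A j j) => a b /= [] e; congr Complex.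
  by move/eqP: e; rewrite -subr_eq0 opprK -mulr2n mulrn_eq0 => /eqP.
Qed.

Lemma herm_poly_const c : herm_poly 0 (fun _ => c).
Proof.
exists (complex.Re c)%:MP, (complex.Im c)%:MP; split.
- by rewrite -[_%:MP]mulr1 mul_mpolyC dhomogZ // dhomog1.
- by rewrite -[_%:MP]mulr1 mul_mpolyC dhomogZ // dhomog1.
- by move=> A _; rewrite /heval !mevalC; case: c.
Qed.

Lemma herm_polyM d1 d2 F G : herm_poly d1 F -> herm_poly d2 G ->
  herm_poly (d1 + d2) (fun A => F A * G A).
Proof.
move=> [p1 [q1 [hp1 hq1 h1]]] [p2 [q2 [hp2 hq2 h2]]].
exists (p1 * p2 - q1 * q2), (p1 * q2 + q1 * p2); split.
- by rewrite dhomogD ?dhomogN ?dhomogM.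
- by rewrite dhomogD ?dhomogM.
- by move=> A hA; rewrite h1 // h2 // /heval mevalB mevalD !mevalM.
Qed.

Lemma herm_poly_sum d (I : finType) (F : I -> 'M[C]_n -> C) :
  (forall i, herm_poly d (F i)) -> herm_poly d (fun A => \sum_i F i A).
Proof.
move=> h; have /fin_all_exists [p /fin_all_exists [q pq]] := h.
exists (\sum_i p i), (\sum_i q i); split.
- by apply: rpred_sum => i _; case: (pq i).
- by apply: rpred_sum => i _; case: (pq i).
move=> A hA; rewrite /heval !rmorph_sum /=.
have -> : \sum_i F i A = \sum_i Complex (heval (p i) A) (heval (q i) A).
  by apply: eq_bigr => i _; case: (pq i) => _ _ ->.
by apply: (big_rec3 (fun x y z => x = Complex y z)) => // i x y z _ ->.
Qed.

Lemma herm_poly_prod (I : finType) (d : I -> nat) (F : I -> 'M[C]_n -> C) :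
  (forall i, herm_poly (d i) (F i)) -> herm_poly (\sum_i d i)%N (fun A => \prod_i F i A).
Proof.
move=> h; have H (s : seq I) : herm_poly (\sum_(i <- s) d i)%N (fun A => \prod_(i <- s) F i A).
  elim: s => [|i s IHs].
    have [p [q [hp hq E]]] := herm_poly_const 1; exists p, q; split; rewrite ?big_nil //.
    by move=> A hA; rewrite big_nil; exact: E.
  have [p [q [hp hq E]]] := herm_polyM (h i) IHs; exists p, q; split; rewrite ?big_cons //.
  by move=> A hA; rewrite big_cons; exact: E.
exact: H.
Qed.

Lemma herm_poly_ext d F G : (forall A, is_hermitian A -> F A = G A) ->
  herm_poly d G -> herm_poly d F.
Proof. by move=> FG [p [q [hp hq E]]]; exists p, q; split=> // A hA; rewrite FG // E. Qed.

End HermitianPolynomialFunctions.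

Section PowerVectorPolynomial.
Variable R : realType.
Local Notation C := R[i].
Variables (n r : nat).

Lemma herm_poly_pow j a b : herm_poly j (fun A : 'M[C]_n.+1 => (A ^+ j) a b).
Proof.
elim: j a b => [|j IHj] a b.
  apply: (@herm_poly_ext _ _ _ _ (fun=> (a == b)%:R)); last exact: herm_poly_const.
  by move=> A _; rewrite expr0 mxE.
apply: (@herm_poly_ext _ _ _ _ (fun A : 'M[C]_n.+1 => \sum_c A a c * (A ^+ j) c b)).
  by move=> A _; rewrite exprS -mulmxE mxE.
apply: herm_poly_sum => c; rewrite -(add1n j); apply: herm_polyM; last exact: IHj.
exact: herm_poly_entry.
Qed.

(** The powers used are [0, 1, ..., r-1], one per tensor factor; their sum is the origin of the
    degree in (ii). *)
Lemma herm_poly_altsym (b a : {ffun 'I_r -> 'I_n.+1}) :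
  herm_poly 'C(r, 2) (fun A : 'M[C]_n.+1 => altsym (fun i => A ^+ i) b a).
Proof.
apply: herm_poly_sum => s; rewrite -[X in herm_poly X]add0n.
apply: herm_polyM; first exact: herm_poly_const.
apply: herm_poly_sum => t; rewrite -[X in herm_poly X]add0n.
apply: herm_polyM; first exact: herm_poly_const.
rewrite -bin2_sum big_mkord; apply: herm_poly_prod => i.
apply: (@herm_poly_ext _ _ _ _ (fun A : 'M[C]_n.+1 => (A ^+ i) (b (t i)) (a (s (t i))))).
  by move=> A _; rewrite mxE.
exact: herm_poly_pow.
Qed.

(* A matrix of degree [<= r] satisfies [A^r = sum_(l<r) c_l A^l], a singular substitution. *)
Lemma pow_vec_stratum (A : 'M[C]_n.+1) : (minpoly_deg A <= r)%N -> pow_vec r A = 0.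
Proof.
rewrite /minpoly_deg => sA.
have mp := mxminpoly_monic A.
have sz : (0 < size (mxminpoly A))%N by rewrite size_mxminpoly.
(* Padding by a power of the variable gives a monic annihilating polynomial of degree exactly
   [r]. *)
pose q := mxminpoly A * 'X^(r - (size (mxminpoly A)).-1).
have mq : q \is monic by rewrite rpredM // monicXn.
have sq : size q = r.+1.
  rewrite size_monicM ?monic_neq0 ?monicXn // size_polyXn; lia.
have qA : horner_mx A q = 0 by rewrite rmorphM /= mx_root_minpoly mul0r.
have lq : q`_r = 1 by move/monicP: mq; rewrite /lead_coef sq.
pose M : 'M[C]_r.+1 := \matrix_(i, l)
  if i == ord_max then (if l == ord_max then 0 else - q`_l) else (i == l)%:R.
have M0 : \det M = 0.
  rewrite (expand_det_col _ ord_max) big1 // => i _; rewrite mxE eqxx.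
  by case: eqP => _; rewrite mul0r.
rewrite -[RHS](scale0r (pow_vec r A)) -M0 -avec_lin; apply: eq_avec => i.
have [->|im] := eqVneq i ord_max; last first.
  rewrite (bigD1 i) //= mxE (negPf im) eqxx scale1r big1 ?addr0 // => l li.
  by rewrite mxE (negPf im) eq_sym (negPf li) scale0r.
have qE : q = \sum_(i < r.+1) q`_i *: 'X^i by rewrite -sq -poly_def coefK.
have : horner_mx A q = \sum_(i < r.+1) q`_i *: A ^+ i.
  rewrite {1}qE linear_sum; apply: eq_bigr => i' _.
  by rewrite linearZ /= rmorphXn /= horner_mx_X.
rewrite qA big_ord_recr /= lq scale1r => /esym/eqP.
rewrite addrC addr_eq0 => /eqP ->.
rewrite big_ord_recr /= mxE !eqxx scale0r addr0 -sumrN; apply: eq_bigr => l _.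
by rewrite mxE eqxx -val_eqE /= ltn_eqF // scaleNr.
Qed.

End PowerVectorPolynomial.

Section HookRepresentation.
Variable R : realType.
Local Notation C := R[i].

(** In orthonormal coordinates the restriction to the span is the compression [ctr B *m T g *m B],
    which keeps compatibility with adjoints. *)
Lemma orbit_span_rep n N (T : 'M[C]_n -> 'M[C]_N) (v0 : 'cV[C]_N) :
  rational_rep T ->
  exists m (B : 'M[C]_(N, m)), let rho g := ctr B *m T g *m B in
  [/\ ctr B *m B = 1%:M, forall w, orbit_span T v0 w <-> B *m (ctr B *m w) = w,
      forall g, SL g -> T g *m B = B *m rho g, rational_rep rho
    & forall w, orbit_span rho (ctr B *m v0) w].
Proof.
move=> rrT.
have [m [B [BB VB]]] := csubspace_orthobasis (orbit_span_csubspace T v0).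
exists m, B => rho.
have VBy y : orbit_span T v0 (B *m y).
  by apply/VB; rewrite [ctr B *m (B *m _)]mulmxA BB mul1mx.
have TB g : SL g -> T g *m B = B *m (ctr B *m (T g *m B)).
  move=> Sg; apply: mulmx_colP => y.
  have /VB := orbit_span_stable rrT Sg (VBy y).
  by rewrite -!mulmxA => ->.
have TBr g : SL g -> T g *m B = B *m rho g.
  by move=> Sg; rewrite {1}(TB g Sg) /rho !mulmxA.
have [T1 TM [P TP]] := rrT.
split=> //.
- split.
  + by rewrite /rho T1 mulmx1 BB.
  + by move=> g h Sg Sh; rewrite /rho TM // -!mulmxA {1}(TB h Sh).
  + pose c (a b : nat) (X : 'M[C]_(a, b)) : 'M[{mpoly C[n * n]}]_(a, b) := map_mx (@mpolyC _ C) X.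
    have ce a b (X : 'M[C]_(a, b)) w : map_mx (meval w) (c _ _ X) = X.
      by apply/matrixP => i j; rewrite !mxE mevalC.
    exists (c _ _ (ctr B) *m P *m c _ _ B) => g Sg.
    by rewrite [RHS](map_mxM (meval _)) map_mxM !ce /rho TP.
- move=> w W cW Wg.
  have Bv : B *m (ctr B *m v0) = v0 by apply/VB; exact: orbit_span_self.
  rewrite -[w]mul1mx -BB -mulmxA; apply: (VBy w (fun x => W (ctr B *m x))).
    split=> [|x y Wx Wy|a x Wx]; first by rewrite mulmx0; case: cW.
      by rewrite mulmxDr; exact: csubspace_add.
    by rewrite -scalemxAr; exact: csubspace_scale.
  by move=> g Sg; have := Wg g Sg; rewrite /rho -!mulmxA Bv.
Qed.

(* [Psi A] collects the coordinates of [pow_vec r A / (r+1)!] in an orthonormal basis. *)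
Lemma hook_model n r k : (r + k = n)%N -> (0 < r)%N ->
  exists m (rho : 'M[C]_n.+1 -> 'M[C]_m) (Psi : 'M[C]_n.+1 -> 'cV[C]_m),
  [/\ is_V rho (hook_weight n.+1 k),
      (forall g, rho (ctr g) = ctr (rho g)),
      (forall g A, SL g -> is_hermitian A ->
         Psi (g *m A *m invmx g) = rho g *m Psi A),
      (forall i, herm_poly 'C(r.+1, 2) (fun A => Psi A i 0)) /\
      (forall A, (minpoly_deg A <= r)%N -> Psi A = 0)
    & forall A (ev : 'I_n.+1 -> R), is_hermitian A ->
         char_poly A = \prod_j ('X - (((ev j)%:C)%C)%:P) ->
         (ctr (Psi A) *m Psi A) 0 0 = ((sdisc_val k ev)%:C)%C].
Proof.
move=> rkn r0.
have rrT : rational_rep (@trep R n.+1 r.+1) := trep_rational _ _ _.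
have [m [B [BB VB TB rr span]]] := orbit_span_rep (hook_vector R n r k) rrT.
have hv0 := @hook_vector_highest R n r k rkn r0.
have mem := @pow_vec_mem R n r k rkn.
have norm := @pow_vec_norm R n r k rkn.
have conj := @pow_vec_conj R n r.
have star := @trep_ctr R n.+1 r.+1.
have poly := @herm_poly_altsym R n r.+1.
have vanish := @pow_vec_stratum R n r.
have pE (A : 'M[C]_n.+1) j : pow_vec r A j 0 = altsym (fun i : 'I_r.+1 => A ^+ i) (enum_val j).1 (enum_val j).2 :> C.
  by rewrite mxE.
move: (@trep R n.+1 r.+1) (hook_vector R n r k) (@pow_vec R n r) rrT hv0 mem norm conj star vanish pE
  m B BB VB TB rr span => T v0 pv rrT hv0 mem norm conj star vanish pE m B BB VB TB rr span.
pose rho g := ctr B *m T g *m B; pose v := ctr B *m v0.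
have Bv : B *m v = v0 by apply/VB; exact: orbit_span_self.
have hv : highest_vector rho (hook_weight n.+1 k) v.
  by move=> b Sb ub; rewrite /rho -!mulmxA Bv hv0 // -scalemxAr.
(* Were the highest vector zero, the power vectors of all Hermitian matrices would vanish, against
   the norm formula at the distinct eigenvalues [0, ..., n]. *)
have v_neq0 : v != 0.
  apply/eqP => v_eq0; have v00 : v0 = 0 by rewrite -Bv v_eq0 mulmx0.
  have V0 w : orbit_span T v0 w -> w = 0.
    move=> Vw; apply: (Vw (fun w => w = 0)); last by move=> g _; rewrite v00 mulmx0.
    by split=> [//|x y -> ->|a x ->]; rewrite ?addr0 ?scaler0.
  have I1 : (1%:M : 'M[C]_n.+1) *m ctr 1%:M = 1%:M by rewrite ctr1 mulmx1.
  have := norm 1%:M _ (fun i => i%:R) I1 erefl.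
  rewrite (V0 _ (mem 1%:M _ I1)) mulmx0 mxE => /complexI /esym/eqP.
  rewrite mulf_eq0 expf_eq0 /= pnatr_eq0 -[_ == 0%N]negbK -lt0n fact_gt0 /=.
  apply/negP/sdisc_val_neq0 => i j /eqP; rewrite eqr_nat => /eqP; exact: val_inj.
have starr g : rho (ctr g) = ctr (rho g).
  by rewrite /rho star !ctrM ctrK mulmxA.
pose f : C := (r.+1)`!%:R.
have f0 : f != 0 by rewrite pnatr_eq0 -lt0n fact_gt0.
pose Psi (A : 'M[C]_n.+1) := f^-1 *: (ctr B *m pv A).
exists m, rho, Psi; split=> //.
- split=> //; last by exists v.
  by apply: (star_rep_irreducible rr _ hv v_neq0 span) => g _; exact: starr.
- move=> g A Sg /hermitian_spectral [P [e [PP AE]]].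
  have BA := (VB _).1 (mem P (\row_i ((e i)%:C)%C) PP); rewrite -AE in BA.
  by rewrite /Psi conj ?SL_unit // -scalemxAr /rho -!mulmxA BA.
- split=> [i|A sA]; last by rewrite /Psi vanish // mulmx0 scaler0.
  apply: (@herm_poly_ext _ _ _ _ (fun A => f^-1 * \sum_j ctr B i j *
      altsym (fun l : 'I_r.+1 => A ^+ l) (enum_val j).1 (enum_val j).2)).
    by move=> A _; rewrite mxE mxE; congr (_ * _); apply: eq_bigr => j _; rewrite pE.
  rewrite -[X in herm_poly X]add0n; apply: herm_polyM; first exact: herm_poly_const.
  apply: herm_poly_sum => j; rewrite -[X in herm_poly X]add0n.
  by apply: herm_polyM; [exact: herm_poly_const | exact: poly].
- move=> A ev /hermitian_spectral [P [e [PP AE]]].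
  rewrite {1}AE char_poly_conj ?char_poly_diag; last by rewrite (mulmx1C PP).
  under eq_bigr => i _ do rewrite mxE.
  move/eigenvalues_unique => [s es].
  have -> : sdisc_val k ev = sdisc_val k e.
    rewrite -(sdisc_val_perm k ev s) /sdisc_val; apply: eq_bigr => S _.
    by apply: eq_bigr => i _; apply: eq_bigr => j _; rewrite !es.
  have BA := (VB _).1 (mem P (\row_i ((e i)%:C)%C) PP); rewrite -AE in BA.
  rewrite /Psi ctrZ -scalemxAl -scalemxAr ctrM ctrK -mulmxA BA mxE mxE.
  rewrite (norm P A e PP AE) rmorphM rmorphXn rmorph_nat conjc_inv conjc_nat.
  by rewrite expr2 -mulrA -/f mulKf // mulKf.
Qed.

End HookRepresentation.

(** * Embedding the realification in real polynomials *)

Section RealEmbedding.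
Variable R : realType.
Local Notation C := R[i].

Lemma SU_invmx n (g : 'M[C]_n) : SU g -> invmx g = ctr g.
Proof.
move=> Sg; have ug := SL_unit (SU_SL Sg).
by move: Sg; rewrite SU_ctr => /andP[/eqP gg _]; rewrite -[RHS]mul1mx -(mulVmx ug) -mulmxA gg mulmx1.
Qed.

Lemma SU_ctr_closed n (g : 'M[C]_n) : SU g -> SU (ctr g).
Proof.
move=> Sg; have := Sg; rewrite !SU_ctr ctrK => /andP[/eqP gg /eqP dg].
by rewrite (mulmx1C gg) eqxx det_ctr dg rmorph1 eqxx.
Qed.

Lemma hermitian_ctr n (A : 'M[C]_n) : is_hermitian A = (ctr A == A).
Proof.
apply/eqP/eqP => [h|h]; first by rewrite /ctr h trmxK.
by apply: trmx_inj; rewrite trmxK.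
Qed.

Lemma hermitian_conj n (g A : 'M[C]_n) : SU g -> is_hermitian A ->
  is_hermitian (invmx g *m A *m g).
Proof.
rewrite !hermitian_ctr => /SU_invmx -> /eqP hA.
by rewrite !ctrM ctrK hA mulmxA.
Qed.

Lemma su_act_unique n g (f f1 f2 : {mpoly R[n * n]}) : su_act g f f1 -> su_act g f f2 -> f1 = f2.
Proof. by move=> h1 h2; apply: heval_inj => A hA; rewrite h1 ?h2. Qed.

(** With [p] and [q] the real and imaginary parts of [Psi], this is the polynomial
    [A |-> Re (Psi A)^* (T v)]; the real part of a Hermitian pairing keeps all of [v] visible. *)
Definition re_pairing n m m' (p q : 'I_m -> {mpoly R[n * n]}) (T : 'M[C]_(m, m')) (v : 'cV[C]_m') :=
  \sum_i (complex.Re ((T *m v) i 0) *: p i + complex.Im ((T *m v) i 0) *: q i).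

Lemma re_pairing_linear n m m' (p q : 'I_m -> {mpoly R[n * n]}) (T : 'M[C]_(m, m')) (a : R) u v :
  re_pairing p q T ((a%:C)%C *: u + v) = a *: re_pairing p q T u + re_pairing p q T v.
Proof.
rewrite /re_pairing scaler_sumr -big_split; apply: eq_bigr => i _ /=.
rewrite mulmxDr -scalemxAr !mxE; case: (\sum_j T i j * u j 0) => [x y].
case: (\sum_j T i j * v j 0) => [x' y'] /=.
by rewrite !mul0r subr0 addr0 !scalerDl !scalerDr !scalerA addrACA.
Qed.

Lemma heval_re_pairing n m m' (p q : 'I_m -> {mpoly R[n * n]}) (T : 'M[C]_(m, m'))
    (Psi : 'M[C]_n -> 'cV[C]_m) A v :
  (forall i, Psi A i 0 = Complex (heval (p i) A) (heval (q i) A)) ->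
  heval (re_pairing p q T v) A = complex.Re ((ctr (Psi A) *m (T *m v)) 0 0).
Proof.
move=> h; rewrite /heval /re_pairing rmorph_sum mxE.
have ReE : {morph (@complex.Re R : C -> R) : x y / x + y} by case=> [? ?] [? ?].
rewrite (big_morph (@complex.Re R : C -> R) ReE (erefl _)); apply: eq_bigr => i _.
rewrite rmorphD /= !mevalZ ctrE h; case: ((T *m v) i 0) => x y /=.
by rewrite /heval; ring.
Qed.

End RealEmbedding.

Theorem theorem8p1 (R : realType) (n k : nat) :
  (3 <= n)%N -> (k <= n - 3)%N ->
  [/\
   (* (i) the homogeneous components of degree d < C(n-k,2) of I(Her(n)_{k+1}) vanish *)
   (forall (d : nat) (p : {mpoly R[n * n]}),
      (d < 'C(n - k, 2))%N -> p \is d.-homog ->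
      in_vanishing_ideal (@Her_stratum R n k) p -> p = 0),
   (* V^(n-k,1^k) exists *)
   (exists (m : nat) (rho : 'M[R[i]]_n -> 'M[R[i]]_m),
      is_V rho (hook_weight n k))
   &
   (* for (any model of) V = V^(n-k,1^k), of complex dimension m: *)
   forall (m : nat) (rho : 'M[R[i]]_n -> 'M[R[i]]_m),
     is_V rho (hook_weight n k) ->
     (* (ii) an irreducible real SU(n)-submodule of the degree C(n-k,2)
        component of I(Her(n)_{k+1}), isomorphic to V_R *)
     (exists phi : 'cV[R[i]]_m -> {mpoly R[n * n]},
        [/\ (forall (a : R) u v, phi ((a%:C)%C *: u + v) = a *: phi u + phi v),
            injective phi,
            (forall v, phi v \is ('C(n - k, 2)).-homog /\
                       in_vanishing_ideal (@Her_stratum R n k) (phi v)),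
            (forall g v, SU g -> su_act g (phi v) (phi (rho g *m v)))
          & (forall W : {mpoly R[n * n]} -> Prop,
               rsubspace W -> (forall f, W f -> exists v, f = phi v) ->
               su_stable W ->
               (forall f, W f -> f = 0) \/ (forall v, W (phi v)))])
     /\
     (* (iii) sDisc_k is a sum of 2 dim_C V squares in R[Her(n)] *)
     (exists q : 'I_(2 * m) -> {mpoly R[n * n]},
        forall (A : 'M[R[i]]_n) (ev : 'I_n -> R),
          is_hermitian A ->
          char_poly A = \prod_(j < n) ('X - polyC ((ev j)%:C)%C) ->
          sdisc_val k ev = \sum_(j < 2 * m) (heval (q j) A) ^+ 2)].
Proof.
case: n => // n n3 kn; pose r := (n - k)%N.
have rkn : (r + k = n)%N by rewrite /r subnK //; lia.
have nkr : (n.+1 - k = r.+1)%N by lia.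
have r0 : (0 < r)%N by lia.
have [m0 [rho0 [Psi [V0 star0 conj0 [poly0 van0] norm0]]]] := hook_model R rkn r0.
split; first 1 last.
- by exists m0, rho0.
- move=> m rho V; have [T [Tint Tinj mm]] := highest_weight_unique V0 V.
  subst m.
  have uT : T \in unitmx by rewrite -row_free_unit /row_free (trivial_kernel_rank Tinj).
  have /fin_all_exists [p /fin_all_exists [q pq]] := poly0.
  have PsiE A i : is_hermitian A -> Psi A i 0 = Complex (heval (p i) A) (heval (q i) A).
    by move=> hA; case: (pq i) => _ _ ->.
  split; last first.
    (* The squares are those of the [m0] real parts followed by the [m0] imaginary parts. *)
    pose h (j : nat) : {mpoly R[n.+1 * n.+1]} :=
      if insub j is Some i then p i else if insub (j - m0)%N is Some i then q i else 0.
    exists (fun j => h j) => A ev hA cA.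
    rewrite -(big_mkord xpredT (fun j => heval (h j) A ^+ 2)) mul2n -addnn.
    rewrite (@big_cat_nat _ _ _ m0) ?leq_addr //= -{2}[m0]add0n big_addn addnK !big_mkord.
    have h1 (i : 'I_m0) : h i = p i by rewrite /h valK.
    have h2 (i : 'I_m0) : h (i + m0)%N = q i.
      by rewrite /h insubF ?ltnNge ?leq_addl // addnK valK.
    under eq_bigr => i _ do rewrite h1.
    under [X in _ + X]eq_bigr => i _ do rewrite h2.
    apply: complexI; rewrite -(norm0 A ev hA cA) ctr_sqr -big_split rmorph_sum /=.
    apply: eq_bigr => i _; rewrite PsiE // -add_Re2_Im2 //.
  pose phi := re_pairing p q T.
  have phiE A v : is_hermitian A ->
      heval (phi v) A = complex.Re ((ctr (Psi A) *m (T *m v)) 0 0).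
    by move=> hA; apply: heval_re_pairing => i; exact: PsiE.
  have phi_lin (a : R) u v : phi ((a%:C)%C *: u + v) = a *: phi u + phi v.
    exact: re_pairing_linear.
  have phi_act g v : SU g -> su_act g (phi v) (phi (rho g *m v)).
    move=> Sg A hA; rewrite !phiE //; last exact: hermitian_conj.
    have Sg' := SU_ctr_closed Sg.
    have -> : invmx g *m A *m g = ctr g *m A *m invmx (ctr g).
      by rewrite (SU_invmx Sg) (SU_invmx Sg') ctrK.
    rewrite conj0 //; last exact: SU_SL.
    by rewrite star0 ctrM ctrK [T *m (rho g *m v)]mulmxA -Tint ?SU_SL // !mulmxA.
  have irr U : realsubspace U -> (forall g v, SU g -> U v -> U (rho g *m v)) ->
      (forall v, U v -> v = 0) \/ (forall v, U v).
    by apply: hook_rep_real_irreducible V; lia.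
  have phi0 : phi 0 = 0.
    by have := phi_lin (-1) 0 0; rewrite scaler0 addr0 scaleN1r addNr.
  have phiD u v : phi (u + v) = phi u + phi v.
    by have := phi_lin 1 u v; rewrite rmorph1 !scale1r.
  have phiZ (a : R) u : phi ((a%:C)%C *: u) = a *: phi u.
    by have := phi_lin a u 0; rewrite phi0 !addr0.
  exists phi; split=> //.
  (* The kernel of [phi] is a real stable subspace, hence zero or everything. The latter fails at
     [A = diag(0, ..., n)] and [v = T^-1 Psi A], where [phi v] takes the nonzero value of the
     subdiscriminant. *)
  + have ker0 v : phi v = 0 -> v = 0.
      have [||h|h] := irr (fun v => phi v = 0); last 2 first.
      * exact: h.
      * move=> _; exfalso.
        pose ev (i : 'I_n.+1) : R := (i : nat)%:R.
        pose A : 'M[R[i]]_n.+1 := diag_mx (\row_i ((ev i)%:C)%C).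
        have hA : is_hermitian A.
          by have := hermitian_diag 1%:M ev; rewrite ctr1 mul1mx mulmx1.
        have cA : char_poly A = \prod_(j < n.+1) ('X - polyC ((ev j)%:C)%C).
          by rewrite char_poly_diag; apply: eq_bigr => i _; rewrite mxE.
        have := phiE A (invmx T *m Psi A) hA; rewrite h /heval meval0 mulKVmx // (norm0 A ev) //=.
        apply/eqP; rewrite eq_sym; apply: sdisc_val_neq0 => i j /eqP.
        by rewrite /ev eqr_nat => /eqP; exact: val_inj.
      * split=> [|u w hu hw|a u hu]; first exact: phi0.
          by rewrite phiD hu hw addr0.
        by rewrite phiZ hu scaler0.
      * move=> g w Sg hw; apply: heval_eq0 => A hA.
        by rewrite (phi_act g w Sg A hA) hw /heval meval0.
    move=> u v uv; apply/eqP; rewrite -subr_eq0; apply/eqP/ker0.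
    rewrite phiD -scaleN1r -(rmorph1 (real_complex R)) -rmorphN phiZ scaleN1r uv subrr //.
  + move=> v; rewrite nkr; split.
      apply: rpred_sum => i _; case: (pq i) => hp hq _.
      by rewrite rpredD // dhomogZ.
    move=> A [hA sA]; rewrite phiE // van0; last by move: sA; rewrite nkr subn1.
    by rewrite /ctr map_mx0 trmx0 mul0mx mxE.
  + move=> W [W0 WD WZ] Wim Wst.
    have [||h|h] := irr (fun v => W (phi v)).
    * split=> [|u w hu hw|a u hu]; first by rewrite phi0.
        by rewrite phiD; exact: WD.
      by rewrite phiZ; exact: WZ.
    (* [su_stable] only provides some polynomial with the right values on Hermitian matrices; such
       values determine it. *)
    * move=> g v Sg Wv; have [f' [Wf' af']] := Wst _ g Wv Sg.
      by rewrite (su_act_unique (phi_act g v Sg) af').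
    * by left=> f Wf; have [v fv] := Wim f Wf; rewrite fv (h v) ?phi0 // -fv.
    * by right.
- move=> d p; rewrite nkr; apply: stratum_ideal_low_degree => //.
  by rewrite nkr subn1.
Qed.
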